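(* Let $A$ be an expanding $d\times d$ integer matrix, let $\mathcal{D}_1,\mathcal{D}_2\subset\mathbb{Z}^d$ be finite nonempty digit sets, and let $K=A^{-1}(K+\mathcal{D}_1)$ and $K'=A^{-1}(K'+\mathcal{D}_2)$ be the corresponding integral self-affine sets. Suppose that both iterated function systems $\{x\mapsto A^{-1}(x+e)\}_{e\in\mathcal{D}_1}$ and $\{x\mapsto A^{-1}(x+e)\}_{e\in\mathcal{D}_2}$ satisfy the open set condition and that $K$ and $K'$ are totally disconnected. Then $K\simeq_w K'$ if and only if $\#\mathcal{D}_1=\#\mathcal{D}_2$.
   Context: A matrix is expanding if all its eigenvalues have modulus strictly greater than $1$. For a finite digit set $\mathcal{D}\subset\mathbb{Z}^d$, the integral self-affine set of $(A,\mathcal{D})$ is the unique nonempty compact $K\subset\mathbb{R}^d$ with $K=A^{-1}(K+\mathcal{D})$. Open set condition for $\{S_i\}_{i=1}^N$: there is a bounded nonempty open set $O$ with $\bigcup_{i=1}^N S_i(O)\subset O$ and $S_i(O)\cap S_j(O)=\emptyset$ for $i\ne j$. Pseudo-norm $w$ associated with $A$: let $q=|\det A|$ and write $B_r$ for the open ball in $\mathbb{R}^d$ with center $0$ and radius $r$. Fix $0<\epsilon_0<1/2$ and a $C^\infty$ function $\varphi\ge 0$ supported in $B_{\epsilon_0}$ with $\varphi(x)=\varphi(-x)$ and $\int_{\mathbb{R}^d}\varphi=1$. Let $V=AB_1\setminus B_1$, $h=\chi_V*\varphi$ (convolution), and $w(x)=\sum_{n=-\infty}^{\infty}q^{-n/d}h(A^nx)$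 for $x\in\mathbb{R}^d$. Then: (1) $w(x)=w(-x)$, and $w(x)=0$ iff $x=0$; (2) $w(Ax)=q^{1/d}w(x)$; (3) there is $\beta>0$ with $w(x+y)\le\beta\max\{w(x),w(y)\}$ for all $x,y$. $E\simeq_w F$ ($w$-Lipschitz equivalence) means: there exist a bijection $\sigma:E\to F$ and a constant $C>0$ such that $C^{-1}w(x-y)\le w(\sigma(x)-\sigma(y))\le C\,w(x-y)$ for all $x,y\in E$.
   Formalization: The formal theorem assumes that w(x)=0 only for x=0 (part of property (1) of the pseudo-norm); this can fail for mollifiers φ vanishing near 0, and the claim is then false for some digit sets. *)

(* Defs.v *)
From HB Require Import structures.
From mathcomp Require Import all_boot all_order all_algebra.
From mathcomp Require Import finmap.
From mathcomp Require Import all_classical all_reals all_analysis.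
From mathcomp Require Import complex.

Set Implicit Arguments.
Unset Strict Implicit.
Unset Printing Implicit Defensive.

Import Order.TTheory GRing.Theory Num.Theory.
Import numFieldNormedType.Exports.

Local Open Scope classical_set_scope.
Local Open Scope ring_scope.

(* [eigenvalue] is relative to row vectors; a square matrix and its transpose
   have the same eigenvalues. *)
Definition expanding (R : realType) (n : nat) (A : 'M[int]_n) : Prop :=
  forall lambda : R[i],
    eigenvalue (map_mx intr A : 'M[R[i]]_n) lambda -> 1 < `|lambda|.

Definition rmx (R : realType) (m n : nat) (A : 'M[int]_(m, n)) : 'M[R]_(m, n) :=
  map_mx intr A.
Arguments rmx R {m n} A.

(* In this file the ambient space R^d is ['cV[R]_d.+1], so the dimension is
   [d.+1]: it is positive and the square matrices form a ring. *)

Definition ifs_map (R : realType) (d : nat) (A : 'M[int]_d.+1)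
    (e : 'cV[int]_d.+1) (x : 'cV[R]_d.+1) : 'cV[R]_d.+1 :=
  invmx (rmx R A) *m (x + rmx R e).

Definition self_affine_set (R : realType) (d : nat) (A : 'M[int]_d.+1)
    (D : {fset 'cV[int]_d.+1}) (K : set 'cV[R]_d.+1) : Prop :=
  [/\ K !=set0, compact K &
      K = [set y | exists x e, [/\ K x, e \in D & y = ifs_map A e x]]].

Definition open_set_condition (R : realType) (d : nat) (A : 'M[int]_d.+1)
    (D : {fset 'cV[int]_d.+1}) : Prop :=
  exists O : set 'cV[R]_d.+1,
    [/\ open O, bounded_set O, O !=set0,
        (forall e, e \in D -> ifs_map A e @` O `<=` O) &
        (forall e e', e \in D -> e' \in D -> e <> e' ->
           (ifs_map A e @` O) `&` (ifs_map A e' @` O) = set0)].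

(* The norm of the library on ['cV[R]_n] is the sup norm, whence an explicit
   Euclidean ball. *)
Definition eucl_ball (R : realType) (n : nat) (r : R) : set 'cV[R]_n :=
  [set x | Num.sqrt (\sum_(i < n) x i 0 ^+ 2) < r].
Arguments eucl_ball {R} n r.

Fixpoint Ck (R : realType) (n k : nat) (f : 'cV[R]_n -> R) : Prop :=
  if k is k'.+1 then
    continuous f /\
    forall i : 'I_n,
      (forall x, derivable f x (delta_mx i 0)) /\
      Ck k' (fun x => 'D_(delta_mx i 0) f x)
  else continuous f.

Definition Coo (R : realType) (n : nat) (f : 'cV[R]_n -> R) : Prop :=
  forall k, Ck k f.

(* Lebesgue measure on R^n, carried by n-tuples with their product
   sigma-algebra: the Dirac mass at the only point for n = 0, and the image of
   lambda \x lambda^n under (x, t) |-> x :: t in the inductive step. *)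
Section lebesgue_step.
Context (R : realType) (n : nat).
Local Notation T := (measurableTypeR R).

Definition tuple_consT (p : T * n.-tuple T) : n.+1.-tuple T :=
  [tuple of p.1 :: p.2].

Lemma measurable_tuple_consT : measurable_fun setT tuple_consT.
Proof. by apply: measurable_cons; [exact: measurable_fst | exact: measurable_snd]. Qed.

Variable mu : {sigma_finite_measure set (n.-tuple T) -> \bar R}.

Definition lebesgue_step : set (n.+1.-tuple T) -> \bar R :=
  pushforward (lebesgue_measure \x mu)%E tuple_consT.

Let pre_measurable (A : set (n.+1.-tuple T)) :
  measurable A -> measurable (tuple_consT @^-1` A).
Proof. by move=> mA; rewrite -[X in measurable X]setTI; exact: measurable_tuple_consT. Qed.

Let lebesgue_step0 : lebesgue_step set0 = 0%E.
Proof. by rewrite /lebesgue_step /pushforward preimage_set0 measure0. Qed.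

Let lebesgue_step_ge0 A : (0 <= lebesgue_step A)%E.
Proof. exact: (measure_ge0 (product_measure1 lebesgue_measure mu)). Qed.

Let lebesgue_step_sigma_additive : semi_sigma_additive lebesgue_step.
Proof.
move=> F mF tF mUF; rewrite /lebesgue_step /pushforward preimage_bigcup.
apply: measure_semi_sigma_additive.
- by move=> i; exact: pre_measurable.
- apply/trivIsetP => /= i j _ _ ij; rewrite -preimage_setI.
  by move/trivIsetP : tF => /(_ _ _ _ _ ij) ->//; rewrite preimage_set0.
- by rewrite -preimage_bigcup; exact: pre_measurable.
Qed.

HB.instance Definition _ := isMeasure.Build _ _ _ lebesgue_step
  lebesgue_step0 lebesgue_step_ge0 lebesgue_step_sigma_additive.

Let tuple_unconsT (t : n.+1.-tuple T) : T * n.-tuple T :=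
  (thead t, [tuple of behead t]).

Let tuple_consTK : cancel tuple_consT tuple_unconsT.
Proof. by case=> x t; congr pair; apply/val_inj. Qed.

Let measurable_tuple_unconsT : measurable_fun setT tuple_unconsT.
Proof.
by apply/measurable_fun_pair; [exact: measurable_tnth|exact: measurable_behead].
Qed.

Let product_sigma_finite : sigma_finite setT (lebesgue_measure \x mu)%E.
Proof.
have /sigma_finiteP[F [TF ndF Foo]] :=
  @sigma_finiteT _ T R (lebesgue_measure : {sigma_finite_measure set T -> \bar R}).
have /sigma_finiteP[G [TG ndG Goo]] := sigma_finiteT mu.
exists (fun k => F k `*` G k).
  rewrite -setXTT TF TG predeqE => -[x y]; split.
    move=> [/= [k _ Fkx] [l _ Gly]]; exists (maxn k l) => //; split.
    - by move: x Fkx; exact/subsetPset/ndF/leq_maxl.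
    - by move: y Gly; exact/subsetPset/ndG/leq_maxr.
  by move=> [k _ []/= ? ?]; split; exists k.
move=> k; have [? ?] := Foo k; have [? ?] := Goo k.
split; first exact: measurableX.
by rewrite product_measure1E// lte_mul_pinfty// ge0_fin_numE.
Qed.

Let lebesgue_step_sigma_finite : sigma_finite setT lebesgue_step.
Proof.
have [F FT Foo] := product_sigma_finite.
exists (fun k => tuple_unconsT @^-1` F k).
  by rewrite -preimage_bigcup -FT preimage_setT.
move=> k; have [mF Fk] := Foo k; split.
  by rewrite -[X in measurable X]setTI; exact: measurable_tuple_unconsT.
rewrite /lebesgue_step /pushforward -comp_preimage.
rewrite (_ : tuple_unconsT \o tuple_consT = idfun) ?preimage_id//.
by apply/funext => p; exact: tuple_consTK.
Qed.

HB.instance Definition _ := Measure_isSigmaFinite.Build _ _ _ lebesgue_step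
  lebesgue_step_sigma_finite.

End lebesgue_step.

Fixpoint lebesgue_tuple (R : realType) (n : nat) :
    {sigma_finite_measure set (n.-tuple (measurableTypeR R)) -> \bar R} :=
  if n is n'.+1 then lebesgue_step (lebesgue_tuple R n')
  else @dirac _ _ [tuple] R.

Definition integral_Rn (R : realType) (n : nat) (f : 'cV[R]_n -> R) : R :=
  Rintegral (lebesgue_tuple R n) setT (fun t => f (\col_i tnth t i)).

Section pseudo_norm.
Context (R : realType) (d : nat) (A : 'M[int]_d.+1) (phi : 'cV[R]_d.+1 -> R).
Local Notation AR := (rmx R A).

Definition det_mod : R := `|\det AR|.

Definition annulus : set 'cV[R]_d.+1 :=
  ((fun x => AR *m x) @` eucl_ball d.+1 1) `\` eucl_ball d.+1 1.

Definition smoothed_annulus (x : 'cV[R]_d.+1) : R :=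
  integral_Rn (fun y => \1_annulus (x - y) * phi y).

(* All terms are nonnegative, so the two-sided series is their sum over the
   index set of all integers, in any order. It is finite (for an expanding A
   and phi supported in the unit ball), hence [fine] loses nothing. *)
Definition pseudo_norm (x : 'cV[R]_d.+1) : R :=
  fine (\esum_(n in [set: int])
    (det_mod `^ (- (n%:~R / d.+1%:R)) * smoothed_annulus (AR ^ n *m x))%:E).

End pseudo_norm.

Definition w_lipschitz_equiv (R : realType) (V : zmodType) (w : V -> R)
    (E F : set V) : Prop :=
  exists sigma : V -> V, set_bij E F sigma /\
    exists2 C : R, 0 < C &
      forall x y, E x -> E y ->
        C^-1 * w (x - y) <= w (sigma x - sigma y) <= C * w (x - y).

Record mollifier (R : realType) (n : nat) (eps : R) (phi : 'cV[R]_n -> R) :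
    Prop := Mollifier {
  mollifier_smooth : Coo phi;
  mollifier_ge0 : forall x, 0 <= phi x;
  mollifier_supp : closure [set x | phi x != 0] `<=` eucl_ball n eps;
  mollifier_even : forall x, phi (- x) = phi x;
  mollifier_int : integral_Rn phi = 1 }.

(* Main.v *)
Require Import Defs.
From HB Require Import structures.
From mathcomp Require Import all_boot all_order all_algebra.
From mathcomp Require Import finmap.
From mathcomp Require Import all_classical all_reals all_analysis.
From mathcomp Require Import complex.
From mathcomp Require Import measurable_realfun.
From mathcomp Require Import zify ring lra.

Set Implicit Arguments.
Unset Strict Implicit.
Unset Printing Implicit Defensive.

Import Order.TTheory GRing.Theory Num.Theory.
Import numFieldNormedType.Exports.

Local Open Scope classical_set_scope.
Local Open Scope ring_scope.

(** The proof shows that K, seen through the pseudo-norm w, is a symbolic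
    space whose only parameter is the number N of digits. Put q = |det A| and
    rho = q^(-1/n), where n is the dimension. For every multiple L of some L0
    there is a bijection of K onto the sequences over N^L letters such that
    w(x - y) is comparable to rho^(L k) when the codes of x and y first differ
    at index k ([coding], [self_affine_coding]). With a common L for the two
    systems, equal numbers of digits give the same symbolic space, hence an
    equivalence ([coding_equiv]). Conversely an equivalence maps words of
    length k to distinct words of length k + m, with m fixed, so that
    Q^k <= Q'^(k+m) for all k and Q <= Q' for the sizes of the alphabets
    ([coding_le]); the two sizes are equal by symmetry.

    Pseudo-norm. The scaling w(x) = rho w(A x) ([pseudo_norm_scale]) reduces all
    estimates to a shell delta <= |x| <= r, on which w lies between two
    positive constants ([pseudo_norm_shell]). The upper bound holds because the
    smoothed annulus is supported in a shell and the powers of A^-1 tend to 0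
    ([expanding_inv]), so that boundedly many terms of the series survive. The
    lower bound comes from definiteness and compactness, since positivity of a
    term is an open condition with a local lower bound
    ([smoothed_lower_bound]).

    Tree. Let Z_0 = {0} and Z_(n+1) = A Z_n + D, so that A^n K is the union of
    the tiles K + a for a in Z_n. The nodes of level n are the components of
    Z_n for the relation that K + a meets K + b; the children of a node P are
    the components of A P + D; the mass of a node is its cardinal. The open set
    condition makes (a, e) |-> A a + e injective on Z_n x D
    ([Z_expand_inj]), so the children of P have total mass N times that of P.
    Total disconnectedness bounds the diameters of the components
    ([component_bounded]): hence masses are bounded and, seen at scale A^n,
    distinct nodes of level n carry parts of K at a distance bounded below
    ([cells_apart]). It remains to cut K into N^L pieces, each piece a list of
    nodes of bounded spread, then each piece into N^L pieces of the same kind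
    L levels below, and so on: the pieces are the cylinders of the code.

    Equal splitting ([equal_splitting]). A neighbourhood of maximal size in the
    orbit of the origin recurs everywhere ([recurrent_component]), so some node
    C has a translate at a fixed depth under every node. Call good the
    descendants of translates of C; the proportion of mass in nodes that are
    not good decays geometrically, and at one fixed depth every node has good
    descendants of every possible good mass ([node_splitting]). Let g be the
    gcd of these masses. Good nodes, after s levels, can be regrouped in exact
    groups, of mass exactly g N^s each ([exact_groups]): cut the list of masses
    at multiples of the target, and correct each cut by exchanging small lists
    of nodes whose total masses differ by g ([exact_bins]). An exact group
    produces exactly N^L exact groups L levels below. A list of i exact groups,
    1 <= i <= N^L, then splits into exactly N^L lists of exact groups: the first
    group yields N^L groups, used as N^L - i singletons and one list of i, and
    each of the i - 1 other groups yields a full list of N^L. The masses of the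
    pieces are different, but only by bounded factors, and the number of pieces
    is always N^L. All the descendants of a single node are handled in the same
    way, the few nodes that are not good being pieces of their own. *)

(** * Regrouping lists of integers into bins of equal sum *)

Section Coins.
Local Open Scope nat_scope.

Definition rep (T : Type) k (s : seq T) := flatten (nseq k s).

Lemma count_rep (T : Type) (a : pred T) k (s : seq T) :
  count a (rep k s) = k * count a s.
Proof. by elim: k => [|k IH] //; rewrite /rep /= count_cat -/(rep k s) IH mulSn. Qed.

Lemma sumn_rep k s : sumn (rep k s) = k * sumn s.
Proof. by elim: k => [|k IH] //; rewrite /rep /= sumn_cat -/(rep k s) IH mulSn. Qed.

(** The least positive difference of two sums of values divides every value:
    otherwise the remainder of a value would be a smaller difference. *)
Lemma least_difference (V : seq nat) v0 : v0 \in V -> 0 < v0 ->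
  exists g P P', [/\ 0 < g, forall v, v \in V -> g %| v,
    {subset P <= V}, {subset P' <= V} & sumn P = sumn P' + g].
Proof.
move=> v0V v0_gt0.
pose diff g := 0 < g /\ exists P P', [/\ {subset P <= V}, {subset P' <= V} &
  sumn P = sumn P' + g].
have ex : exists g, `[< diff g >].
  exists v0; apply/asboolP; split => //; exists [:: v0], [::].
  by split => //= [x|]; rewrite ?inE ?addn0// => /eqP ->.
case: (ex_minnP ex) => g /asboolP[g_gt0 [P [P' [PV P'V PP']]]] g_min.
exists g, P, P'; split => // v vV; apply: contraT => ngv.
have r_gt0 : 0 < v %% g by rewrite lt0n.
suff /g_min : `[< diff (v %% g) >] by rewrite leqNgt ltn_pmod.
apply/asboolP; split=> //; exists (v :: rep (v %/ g) P'), (rep (v %/ g) P).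
have sub s : {subset s <= V} -> {subset rep (v %/ g) s <= V}.
  by move=> sV x /flattenP[t /nseqP[-> _]]; exact: sV.
split; last by rewrite /= !sumn_rep PP' {1}(divn_eq v g); lia.
- by move=> x; rewrite inE => /orP[/eqP -> //|]; exact: sub.
- exact: sub.
Qed.

(** All entries are multiples of [g] bounded by [M]. Between consecutive bins
    stands a pool made of [K] copies of [P] and [K] copies of [P']; moving a
    copy of [P] across the cut against a copy of [P'] transfers [g]. As
    [M <= K * g], the pool can repair any cut made next to the ideal place. *)
Section ExactBins.
Variables (g K M tau : nat) (P P' : seq nat).
Hypotheses (g_gt0 : 0 < g) (PP' : sumn P = sumn P' + g).
Hypotheses (MK : M <= K * g) (gtau : g %| tau).

Let item v := (g %| v) && (v <= M).

Lemma cut_prefix t U : all item U -> g %| t -> t <= sumn U ->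
  exists L U' delta, [/\ U = L ++ U', delta <= K & sumn L + delta * g = t].
Proof.
elim: U t => [|a U IH] t /=.
  by move=> _ _; rewrite leqn0 => /eqP ->; exists [::], [::], 0.
move=> /andP[/andP[ga aM] allU] gt tU; have [le_at|lt_ta] := leqP a t.
  have [//|||L [U' [delta [-> dK Lt]]]] := IH (t - a).
  - exact: dvdn_sub.
  - by rewrite leq_subLR.
  - by exists (a :: L), U', delta; split => //=; lia.
exists [::], (a :: U), (t %/ g); split => //; last by rewrite /= divnK.
rewrite -(leq_pmul2r g_gt0) divnK//; lia.
Qed.

(** [delta] is the number of units [g] that the preceding cut left over to the
    first bin, which accordingly receives [K - delta] copies of [P] and [delta]
    copies of [P'] from the pool of that cut. *)
Lemma fill_bins c delta U : delta <= K -> all item U ->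
  sumn U = c.+1 * tau + delta * g ->
  exists parts, [/\ size parts = c.+1,
    all (fun p => sumn p == tau + K * (sumn P + sumn P')) parts &
    perm_eq (flatten parts) (U ++ rep (K - delta) P ++ rep delta P'
      ++ rep c (rep K P ++ rep K P') ++ rep K P')].
Proof.
elim: c delta U => [|c IH] delta U dK allU sU.
  exists [:: U ++ rep (K - delta) P ++ rep delta P' ++ rep K P'].
  split => //=; last by rewrite cats0.
  by rewrite !sumn_cat !sumn_rep sU PP' andbT; nia.
have [||L [U' [delta' [eU d'K sL]]]] := @cut_prefix (tau + delta * g) U allU.
- by rewrite dvdn_add// dvdn_mull.
- by rewrite sU; nia.
have allU' : all item U' by move: allU; rewrite eU all_cat => /andP[].
have [|parts [sz sums perm]] := IH delta' U' d'K allU'.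
  by move: sU; rewrite eU sumn_cat; nia.
exists ((L ++ rep (K - delta) P ++ rep delta P' ++
         rep delta' P ++ rep (K - delta') P') :: parts).
split => /=; first by rewrite sz.
- by rewrite sums andbT !sumn_cat !sumn_rep PP'; apply/eqP; nia.
- apply/permP => a; rewrite count_cat (permP perm) eU.
  rewrite /rep /= -!/(rep _ _) !count_cat !count_rep !count_cat !count_rep; nia.
Qed.

End ExactBins.

Lemma exact_bins g K M c beta (P P' l : seq nat) :
  0 < g -> 0 < c -> sumn P = sumn P' + g -> g %| sumn P' ->
  all (fun v => (g %| v) && (v <= M)) l -> M <= K * g ->
  g %| beta -> K * (sumn P + sumn P') <= beta -> sumn l = c * beta ->
  (forall v, c * K * count_mem v (P ++ P') <= count_mem v l) ->
  exists parts, [/\ size parts = c, all (fun p => sumn p == beta) parts &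
    perm_eq (flatten parts) l].
Proof.
move=> g_gt0; case: c => // c _ PP' gP' iteml MK gbeta le_beta suml cnt.
have [s sub perms] : exists2 s, subseq s l & perm_eq (rep (c.+1 * K) (P ++ P')) s.
  by apply/count_subseqP => v; rewrite count_rep.
have [U permU] := perm_to_subseq sub.
have gP : g %| sumn P by rewrite PP' dvdn_add.
have permU' : perm_eq l (rep (c.+1 * K) (P ++ P') ++ U).
  by rewrite (perm_trans permU)// perm_cat2r perm_sym.
pose tau := beta - K * (sumn P + sumn P').
have tauE : tau + K * (sumn P + sumn P') = beta by rewrite subnK.
have gtau : g %| tau by rewrite dvdn_sub// dvdn_mull// dvdn_add.
have iU : all (fun v => (g %| v) && (v <= M)) U.
  by move: iteml; rewrite (perm_all _ permU') all_cat => /andP[].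
have sU : sumn U = c.+1 * tau + 0 * g.
  move: (perm_sumn permU'); rewrite sumn_cat sumn_rep sumn_cat suml -tauE.
  by rewrite mulnDr mulnA addnC mul0n addn0 => /addnI/esym.
have [parts [sz sums perm]] := fill_bins g_gt0 PP' MK gtau (leq0n K) iU sU.
exists parts; split => //.
  by apply: sub_all sums => p; rewrite tauE.
rewrite (perm_trans perm)// perm_sym (perm_trans permU')//.
apply/permP => a; rewrite !count_cat !count_rep !count_cat !count_rep subn0; ring.
Qed.

Lemma perm_map_lift (T : eqType) (f : T -> nat) (s : seq nat) (l : seq T) :
  perm_eq s (map f l) -> exists2 l', perm_eq l' l & map f l' = s.
Proof.
case: l => [|x0 l0]; first by move/perm_nilP => ->; exists [::].
set l := x0 :: l0.
move=> /(perm_iotaP 0)[I permI ->]; rewrite size_map in permI.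
exists (map (nth x0 l) I).
  by rewrite -{2}(mkseq_nth x0 l) perm_map.
rewrite -map_comp; apply/eq_in_map => i; rewrite (perm_mem permI) mem_iota add0n => Hi.
by rewrite [RHS](nth_map x0).
Qed.

Lemma perm_flatten_lift (T : eqType) (f : T -> nat) (ss : seq (seq nat)) (l : seq T) :
  perm_eq (flatten ss) (map f l) ->
  exists2 parts, perm_eq (flatten parts) l & map (map f) parts = ss.
Proof.
move=> /perm_map_lift[l' perm_l eq_l].
have sz : size l' = sumn (shape ss) by rewrite -size_flatten -eq_l size_map.
exists (reshape (shape ss) l'); first by rewrite reshapeKr// sz.
by rewrite map_reshape eq_l flattenK.
Qed.

Lemma size_flatten_const (T : eqType) n (G : seq (seq T)) :
  (forall p, p \in G -> size p = n) -> size (flatten G) = size G * n.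
Proof.
elim: G => //= p G IH h; rewrite size_cat (h p) ?mem_head// IH// => q qG.
by apply: h; rewrite inE qG orbT.
Qed.

Lemma flatten_flatten (T : Type) (G : seq (seq (seq T))) :
  flatten (flatten G) = flatten (map flatten G).
Proof. by elim: G => //= p G <-; rewrite flatten_cat. Qed.

Lemma uniq_flatten_nth (T : eqType) (ss : seq (seq T)) (x : T) i j : uniq (flatten ss) ->
  x \in nth [::] ss i -> x \in nth [::] ss j -> i = j.
Proof.
elim: ss i j => [|s ss IH] [|i] [|j] //=; rewrite cat_uniq => /and3P[_ /hasPn dis us] xi xj.
- have : x \in flatten ss.
    apply/flattenP; exists (nth [::] ss j) => //; apply: mem_nth.
    by rewrite ltnNge; apply/negP => h; rewrite nth_default in xj.
  by move/dis; rewrite /= xi.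
- have : x \in flatten ss.
    apply/flattenP; exists (nth [::] ss i) => //; apply: mem_nth.
    by rewrite ltnNge; apply/negP => h; rewrite nth_default in xi.
  by move/dis; rewrite /= xj.
- by rewrite (IH i j us xi xj).
Qed.

Lemma uniq_flatten_part (T : eqType) (ss : seq (seq T)) i :
  uniq (flatten ss) -> uniq (nth [::] ss i).
Proof.
elim: ss i => [|s ss IH] [|i] //=; rewrite cat_uniq => /and3P[] //.
by move=> _ _ /IH.
Qed.

Lemma uniq_flatten_cat (T : eqType) (ss : seq (seq T)) i j : uniq (flatten ss) -> i != j ->
  uniq (nth [::] ss i ++ nth [::] ss j).
Proof.
move=> us ij; rewrite cat_uniq !uniq_flatten_part// andbT /=; apply/hasPn => x xj; apply: contra ij => xi.
by apply/eqP; exact: uniq_flatten_nth us xi xj.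
Qed.

(** Bernoulli's inequality for [1 + 1/b]. *)
Lemma pow_gap b C : exists k, C * b ^ k <= b.+1 ^ k.
Proof.
have [->|b_gt0] := posnP b; first by exists 1; rewrite muln0.
have bern k : b ^ k * (b + k) <= b.+1 ^ k * b.
  by elim: k => [|k IH]; rewrite ?mul1n ?addn0// !expnS; nia.
exists (C * b); rewrite -(leq_pmul2r b_gt0); apply: leq_trans (bern _).
by move: (b ^ (C * b)) => t; nia.
Qed.

Lemma chunk (T : Type) J k (s : seq T) : k <= size s -> size s <= k * J ->
  exists parts, [/\ size parts = k, flatten parts = s &
    all (fun p => 0 < size p <= J) parts].
Proof.
elim: k s => [|k IH] s.
  by rewrite leqn0 => _ /nilP ->; exists [::].
move=> ks; rewrite mulSn => sJ; pose t := minn J (size s - k).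
have J_gt0 : 0 < J by rewrite lt0n; apply: contraTneq sJ => ->; rewrite muln0; lia.
have kJ : k <= k * J by rewrite leq_pmulr.
have [||parts [sz fl al]] := IH (drop t s).
- by rewrite size_drop /t; lia.
- by rewrite size_drop /t; lia.
exists (take t s :: parts); split => /=; first by rewrite sz.
- by rewrite fl cat_take_drop.
- by rewrite al andbT size_takel /t; lia.
Qed.

End Coins.

(** * Trees with bounded masses *)

Section Tree.
Local Open Scope nat_scope.
Variables (X : eqType) (ch : X -> seq X) (m : X -> nat).

Definition mass (p : seq X) := sumn (map m p).
Definition gens n (p : seq X) := iter n (fun p => flatten (map ch p)) p.

Lemma mass_cat p q : mass (p ++ q) = mass p + mass q.
Proof. by rewrite /mass map_cat sumn_cat. Qed.

Lemma mass_perm p q : perm_eq p q -> mass p = mass q.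
Proof. by move=> pq; apply/perm_sumn/perm_map. Qed.

Lemma gens_cat n p q : gens n (p ++ q) = gens n p ++ gens n q.
Proof. by elim: n => [|n /= ->] //=; rewrite map_cat flatten_cat. Qed.

Lemma gens_nil n : gens n [::] = [::].
Proof. by elim: n => //= n ->. Qed.

Lemma gens_cons n x p : gens n (x :: p) = gens n [:: x] ++ gens n p.
Proof. by rewrite -cat1s gens_cat. Qed.

Lemma gensD a b p : gens (a + b) p = gens a (gens b p).
Proof. exact: iterD. Qed.

Lemma gens_perm n p q : perm_eq p q -> perm_eq (gens n p) (gens n q).
Proof. by move=> pq; elim: n => //= n IH; exact/perm_flatten/perm_map. Qed.

Lemma mem_gens n p z :
  reflect (exists2 x, x \in p & z \in gens n [:: x]) (z \in gens n p).
Proof.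
elim: p => [|x p IH]; first by rewrite gens_nil; constructor => -[].
rewrite gens_cons mem_cat; apply: (iffP orP) => [[zx|/IH[y yp zy]]|[y]].
- by exists x => //; exact: mem_head.
- by exists y => //; rewrite inE yp orbT.
- by rewrite inE => /orP[/eqP ->|yp zy]; [left|right; apply/IH; exists y].
Qed.

Lemma gens_sub n p q : {subset p <= q} -> {subset gens n p <= gens n q}.
Proof. by move=> pq z /mem_gens[x xp zx]; apply/mem_gens; exists x => //; exact: pq. Qed.

Section MassTree.
Variables (ok : X -> Prop) (good : pred X) (V : seq nat) (N M D : nat).
Hypothesis ok_ch : forall x y, ok x -> y \in ch x -> ok y.
Hypothesis m_gt0 : forall x, ok x -> 0 < m x.
Hypothesis m_le : forall x, ok x -> m x <= M.
Hypothesis m_ch : forall x, ok x -> mass (ch x) = N * m x.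
Hypothesis good_ch : forall x y, good x -> y \in ch x -> good y.
Hypothesis good_V : forall x, ok x -> good x -> m x \in V.
Hypothesis V_good : forall x v, ok x -> v \in V ->
  exists y, [/\ y \in gens D [:: x], good y & m y = v].
Variable v0 : nat.
Hypotheses (v0V : v0 \in V) (v0_gt0 : 0 < v0).

Definition oks (p : seq X) := forall x, x \in p -> ok x.

Lemma oks1 x : ok x -> oks [:: x].
Proof. by move=> okx y; rewrite inE => /eqP ->. Qed.

Lemma oks_cons x p : oks (x :: p) -> ok x /\ oks p.
Proof.
by move=> okp; split; [apply: okp; exact: mem_head|move=> y yp; apply: okp; rewrite inE yp orbT].
Qed.

Lemma oks_sub p q : {subset p <= q} -> oks q -> oks p.
Proof. by move=> pq okq x /pq/okq. Qed.

Lemma oks_gens n p : oks p -> oks (gens n p).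
Proof.
move=> okp; elim: n => //= n IH z /flattenP[_ /mapP[x xp ->]].
by apply: ok_ch; exact: IH.
Qed.

Lemma good_gens n p : all good p -> all good (gens n p).
Proof.
move=> /allP gp; elim: n => [|n IH]; first exact/allP.
apply/allP => z /flattenP[_ /mapP[x xp ->]].
by apply: good_ch; exact: (allP IH).
Qed.

Lemma mass_gens n p : oks p -> mass (gens n p) = N ^ n * mass p.
Proof.
move=> okp; elim: n => [|n IH]; first by rewrite mul1n.
rewrite expnS -mulnA -IH /= -/(gens n p).
have := oks_gens (n := n) okp; elim: (gens n p) => [|x q IHq] /=; first by rewrite muln0.
move=> /oks_cons[okx okq]; rewrite mass_cat IHq// m_ch//.
by rewrite -[x :: q]cat1s mass_cat mulnDr {2}/mass /= addn0.
Qed.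

Lemma mass_cons x p : mass (x :: p) = m x + mass p.
Proof. by []. Qed.

Lemma size_le_mass p : oks p -> size p <= mass p.
Proof.
elim: p => //= x p IH /oks_cons[okx okp]; rewrite mass_cons.
by rewrite -add1n leq_add// ?m_gt0// IH.
Qed.

Lemma mass_le_size p : oks p -> mass p <= M * size p.
Proof.
elim: p => //= x p IH /oks_cons[okx okp]; rewrite mass_cons mulnS.
by rewrite leq_add// ?m_le// IH.
Qed.

Lemma count_value v p : oks p -> v \in V ->
  size p <= count (fun x => m x == v) (gens D p).
Proof.
move=> okp vV; elim: p okp => //= x p IH /oks_cons[okx okp].
rewrite gens_cons count_cat -add1n leq_add// ?IH// -has_count.
have [y [yx _ my]] := V_good okx vV.
by apply/hasP; exists y => //; exact/eqP.
Qed.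

(** * Decay of the bad mass *)

(** Descendants of good nodes are good, so bad mass never appears below them;
    each bad node has a good descendant [D] levels below, so a fixed proportion
    of the bad mass is lost every [D] levels. *)
Definition bad_mass (p : seq X) := mass [seq x <- p | predC good x].

Lemma bad_cat p q : bad_mass (p ++ q) = bad_mass p + bad_mass q.
Proof. by rewrite /bad_mass filter_cat mass_cat. Qed.

Lemma good_bad p : mass [seq x <- p | good x] + bad_mass p = mass p.
Proof.
by rewrite /bad_mass -mass_cat; apply: mass_perm; rewrite perm_filterC.
Qed.

Lemma bad_good p : all good p -> bad_mass p = 0.
Proof.
move=> gp; rewrite /bad_mass (_ : [seq x <- p | predC good x] = [::])//.
by apply/eqP; rewrite -[_ == _]negbK -has_filter has_predC gp.
Qed.

Lemma bad_gens1 x n : ok x -> bad_mass (gens n [:: x]) <= N ^ n * bad_mass [:: x].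
Proof.
move=> okx; have [gx|bx] := boolP (good x).
  by rewrite bad_good// good_gens//= gx.
rewrite {2}/bad_mass /= bx /= -[[:: x]]/([:: x]) -mass_gens; last exact: oks1.
by rewrite -[mass (gens _ _)]good_bad leq_addl.
Qed.

Lemma bad_gens n p : oks p -> bad_mass (gens n p) <= N ^ n * bad_mass p.
Proof.
elim: p => [|x p IH]; first by rewrite gens_nil.
move=> /oks_cons[okx okp]; rewrite gens_cons -[x :: p]cat1s !bad_cat mulnDr.
by rewrite leq_add ?IH// bad_gens1.
Qed.

(** Of the mass [N ^ D * m x <= M * N ^ D] of the descendants of a bad node, at
    least one unit is good. *)
Lemma bad_gensD1 x : ok x ->
  M * bad_mass (gens D [:: x]) <= (M * N ^ D).-1 * bad_mass [:: x].
Proof.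
move=> okx; have [gx|bx] := boolP (good x).
  by rewrite bad_good// ?muln0// good_gens//= gx.
have [y [yx gy my]] := V_good okx v0V.
have := mass_gens D (oks1 okx); rewrite -[mass (gens _ _)]good_bad => e.
have : 0 < mass [seq y <- gens D [:: x] | good y].
  apply: leq_trans (size_le_mass _).
    by rewrite size_filter -has_count; apply/hasP; exists y.
  by apply: (@oks_sub _ (gens D [:: x])); [exact: mem_subseq (filter_subseq _ _)|exact/oks_gens/oks1].
have -> : bad_mass [:: x] = m x by rewrite /bad_mass /= bx /mass /= addn0.
rewrite (_ : mass [:: x] = m x) in e; last by rewrite /mass /= addn0.
move: e; have := m_le okx; have := m_gt0 okx; nia.
Qed.

Lemma bad_gensD p : oks p ->
  M * bad_mass (gens D p) <= (M * N ^ D).-1 * bad_mass p.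
Proof.
elim: p => [|x p IH]; first by rewrite gens_nil /bad_mass !muln0.
move=> /oks_cons[okx okp]; rewrite gens_cons -[x :: p]cat1s !bad_cat !mulnDr.
by rewrite leq_add ?IH// bad_gensD1.
Qed.

Lemma bad_gensDk k p : oks p ->
  M ^ k * bad_mass (gens (k * D) p) <= (M * N ^ D).-1 ^ k * bad_mass p.
Proof.
move=> okp; elim: k => [|k IH]; first by rewrite !mul1n.
rewrite mulSn gensD expnSr -mulnA; have := bad_gensD (oks_gens (n := k * D) okp).
move=> /(leq_mul (leqnn (M ^ k))) /leq_trans; apply.
by rewrite mulnCA expnS -mulnA leq_mul.
Qed.

Lemma bad_mass_small : exists L1, forall L x, L1 <= L -> ok x ->
  2 * bad_mass (gens L [:: x]) <= N ^ L.
Proof.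
have [k hk] := pow_gap (M * N ^ D).-1 (2 * M).
exists (k * D) => L x le_L okx.
have M_gt0 : 0 < M by apply: leq_trans (m_gt0 okx) (m_le okx).
have okD := oks_gens (n := k * D) (oks1 okx).
rewrite -(subnK le_L) gensD expnD.
have H1 := bad_gens (L - k * D) okD.
suff H2 : 2 * bad_mass (gens (k * D) [:: x]) <= N ^ (k * D) by nia.
have ND_gt0 : 0 < M * N ^ D.
  have [y [yx _ _]] := V_good okx v0V.
  have := size_le_mass (oks_gens (n := D) (oks1 okx)); rewrite mass_gens; last exact: oks1.
  by case: (gens D [:: x]) yx => //= ? ? _; rewrite muln_gt0 M_gt0 /=; case: (N ^ D).
move: hk; rewrite prednK// expnMn -expnM [D * k]mulnC => hk.
have := bad_gensDk k (oks1 okx).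
have bx : bad_mass [:: x] <= M.
  by rewrite /bad_mass /= ; case: (good x); rewrite //= /mass /= addn0 m_le.
have Mk_gt0 : 0 < M ^ k by rewrite expn_gt0 M_gt0.
move=> H3; rewrite -(leq_pmul2l Mk_gt0); nia.
Qed.

(** * Exact groups of nodes *)
Section Exact.
Variables (g s : nat) (P P' : seq nat).
Hypotheses (g_gt0 : 0 < g) (gV : forall v, v \in V -> g %| v).
Hypotheses (PV : {subset P <= V}) (P'V : {subset P' <= V}).
Hypothesis PP' : sumn P = sumn P' + g.
Hypotheses (le_Ds : D <= s) (s_sums : M * (sumn P + sumn P') <= g * N ^ s).
Hypothesis s_count : M * M * M * size (P ++ P') <= N ^ (s - D).

(** Exact groups all have the same mass; this is what makes them split into
    the same number of exact groups, whatever nodes they are made of. The last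
    clause bounds their spread. *)
Definition exact_group (q : seq X) := [/\ oks q, all good q, mass q = g * N ^ s &
  exists2 y, ok y & {subset q <= gens s [:: y]}].

(** The [s]-th generation of [y] has mass [(m y %/ g) * (g * N ^ s)], and
    contains every value of [V] often enough to serve as a pool for
    [exact_bins]: each of the nodes of generation [s - D] has a descendant of
    any given value. *)
Lemma exact_groups1 y : ok y -> good y -> exists parts,
  [/\ size parts = m y %/ g, forall q, q \in parts -> exact_group q &
      perm_eq (flatten parts) (gens s [:: y])].
Proof.
move=> oky gy; set l := gens s [:: y].
have okl : oks l by exact/oks_gens/oks1.
have gl : all good l by apply: good_gens; rewrite /= gy.
have gm x : x \in l -> g %| m x by move=> xl; apply/gV/good_V; [exact: okl|exact: (allP gl)].
have gmy : g %| m y by apply/gV/good_V.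
have c_gt0 : 0 < m y %/ g by rewrite divn_gt0// dvdn_leq// m_gt0.
have gP' : g %| sumn P'.
  elim: (P') P'V => //= a p IH /= sub; rewrite dvdn_add//.
    by apply/gV/sub/mem_head.
  by apply: IH => z zp; apply: sub; rewrite inE zp orbT.
have cM : m y %/ g <= M by apply: leq_trans (m_le oky); exact: leq_div.
have cnt v : m y %/ g * M * count_mem v (P ++ P') <= count_mem v (map m l).
  have [vV|vV] := boolP (v \in V); last first.
    have /count_memPn -> : v \notin P ++ P'.
      by apply: contra vV; rewrite mem_cat => /orP[/PV|/P'V].
    by rewrite muln0.
  have okk := oks_gens (n := s - D) (oks1 oky).
  have := count_value okk vV; rewrite -gensD subnKC// -/l.
  have := mass_le_size okk; rewrite mass_gens; last exact: oks1.
  have := count_size (pred1 v) (P ++ P').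
  have -> : count_mem v (map m l) = count (fun x => m x == v) l by rewrite count_map.
  have : 0 < mass [:: y] by rewrite /mass /= addn0 m_gt0.
  have M_gt0 : 0 < M by apply: leq_trans (m_gt0 oky) (m_le oky).
  set a := count _ l; set b := count _ _; set c := m y %/ g in cM *.
  move: s_count; set u := N ^ _; set t := size (P ++ P'); set z := size _; set r := mass _.
  move=> h1 h2 h3 h4 h5.
  have h6 : M * (M * M * b) <= M * z.
    apply: leq_trans h4; apply: leq_trans (leq_pmulr u h2).
    by apply: leq_trans h1; rewrite !mulnA leq_mul.
  have h7 : M * M * b <= z by rewrite leq_pmul2l in h6.
  by apply: leq_trans h5; apply: leq_trans h7; rewrite leq_mul// leq_mul.
have [||||| // | parts [sz sums perm]] :=
  @exact_bins g M M (m y %/ g) (g * N ^ s) P P' (map m l) g_gt0 c_gt0 PP' gP'.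
- by apply/allP => v /mapP[x xl ->]; rewrite gm// m_le//; exact: okl.
- by rewrite leq_pmulr.
- exact: dvdn_mulr.
- exact: s_sums.
- rewrite -/(mass l) mass_gens; last exact: oks1.
  by rewrite /mass /= addn0 mulnA divnK// mulnC.
have [qs permq eqs] := perm_flatten_lift perm.
exists qs; split => //; first by rewrite -(size_map (map m)) eqs.
move=> q qqs.
have ql : {subset q <= l}.
  by move=> x xq; rewrite -(perm_mem permq); apply/flattenP; exists q.
split.
- exact: oks_sub okl.
- by apply/allP => x /ql; exact: (allP gl).
- by apply/eqP; apply: (allP sums); rewrite -eqs; exact: map_f.
- by exists y.
Qed.

Lemma exact_groups p : oks p -> all good p -> exists parts,
  [/\ size parts * g = mass p, forall q, q \in parts -> exact_group q &
      perm_eq (flatten parts) (gens s p)].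
Proof.
elim: p => [|y p IH]; first by exists [::]; rewrite gens_nil.
move=> /oks_cons[oky okp] /= /andP[gy gp].
have [ps1 [sz1 ex1 perm1]] := exact_groups1 oky gy.
have [ps2 [sz2 ex2 perm2]] := IH okp gp.
exists (ps1 ++ ps2); split.
- by rewrite size_cat mulnDl sz2 sz1 divnK//; exact/gV/good_V.
- by move=> q; rewrite mem_cat => /orP[/ex1|/ex2].
- by rewrite flatten_cat gens_cons perm_cat.
Qed.

Lemma exact_split q : exact_group q -> exists parts,
  [/\ size parts = N ^ s, forall q', q' \in parts -> exact_group q' &
      perm_eq (flatten parts) (gens s q)].
Proof.
move=> [okq gq mq _]; have [ps [sz ex perm]] := exact_groups okq gq.
by exists ps; split=> //; move: sz; rewrite mq mulnC => /eqP; rewrite eqn_pmul2l// => /eqP.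
Qed.

(** The groups are split separately and kept grouped by parent: a list of
    groups with a common parent has bounded spread, the whole list need not. *)
Lemma split_all n k qs :
  (forall q, q \in qs -> exists parts, [/\ size parts = n,
      forall q', q' \in parts -> exact_group q' &
      perm_eq (flatten parts) (gens k q)]) ->
  exists G : seq (seq (seq X)), [/\ size G = size qs,
    forall ps, ps \in G -> [/\ size ps = n, forall q', q' \in ps -> exact_group q' &
      exists2 q, q \in qs & {subset flatten ps <= gens k q}] &
    perm_eq (flatten (map flatten G)) (gens k (flatten qs))].
Proof.
elim: qs => [|q qs IH] hqs; first by exists [::]; rewrite gens_nil.
have [ps [sz ex perm]] := hqs q (mem_head _ _).
have [|G [szG hG permG]] := IH.
  by move=> q' q'qs; apply: hqs; rewrite inE q'qs orbT.
exists (ps :: G); split => /=; first by rewrite szG.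
- move=> ps'; rewrite inE => /orP[/eqP -> |/hG[sz' ex' [q' q'qs sub']]].
    split=> //; exists q; first exact: mem_head.
    by move=> x; rewrite (perm_mem perm).
  by split => //; exists q' => //; rewrite inE q'qs orbT.
- by rewrite gens_cat perm_cat.
Qed.

Lemma exact_splitX j q : exact_group q -> exists parts,
  [/\ size parts = N ^ (s * j), forall q', q' \in parts -> exact_group q' &
      perm_eq (flatten parts) (gens (s * j) q)].
Proof.
elim: j q => [|j IH] q exq.
  exists [:: q]; rewrite muln0 /= cats0; split => // q'.
  by rewrite inE => /eqP ->.
have [ps [sz ex perm]] := exact_split exq.
have [|G [szG hG permG]] := @split_all (N ^ (s * j)) (s * j) ps.
  by move=> q' /ex/IH.
exists (flatten G); split.
- rewrite (size_flatten_const (n := N ^ (s * j))); last by move=> p /hG[].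
  by rewrite szG sz -expnD mulnS.
- by move=> q' /flattenP[p /hG[_ h _]]; exact: h.
- rewrite flatten_flatten.
  by rewrite (perm_trans permG)// mulnS addnC gensD gens_perm.
Qed.

(** * Splitting into equally many pieces *)

Variable j : nat.
Let L := s * j.
Let H := s + s.
Hypotheses (N_gt0 : 0 < N) (s_gt0 : 0 < s) (j_ge2 : 2 <= j) (s_big : 2 * M <= N ^ s).
Hypothesis bad_small : forall x, ok x -> 2 * bad_mass (gens L [:: x]) <= N ^ L.

(** Nodes with a common ancestor at most [c] levels above: in the geometric
    tree, such nodes are at bounded distance. *)
Definition close_nodes c (p : seq X) := exists y b,
  [/\ ok y, b <= c & {subset p <= gens b [:: y]}].

(** The two states of the recursion. A piece of the first kind is taken [H]
    levels below its ancestor because good nodes need [H] levels to be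
    regrouped into exact groups, and all the pieces of a splitting must be at
    the same level. The bound on the number of groups in a piece of
    the second kind is what keeps their masses comparable. *)
Definition piece (p : seq X) :=
  (exists2 x, ok x & p = gens H [:: x]) \/
  (exists qs, [/\ 0 < size qs <= N ^ L, forall q, q \in qs -> exact_group q,
     p = flatten qs & close_nodes (L + H) p]).

Lemma M_gt0 x : ok x -> 0 < M.
Proof. by move=> okx; apply: leq_trans (m_gt0 okx) (m_le okx). Qed.

Lemma mass_exact_gt0 q : exact_group q -> 0 < mass q.
Proof. by case=> okq _ -> [y oky _]; rewrite muln_gt0 g_gt0 expn_gt0 N_gt0. Qed.

Lemma size_exact_gt0 q : exact_group q -> 0 < size q.
Proof. by move/mass_exact_gt0; case: q. Qed.

(** For a piece of the first kind, [L] levels below [x], the bad nodes are too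
    few to fill [N ^ L] places and start pieces of the first kind. The good ones
    supply the other pieces: the [H = s + s] further levels regroup them a first
    time, then multiply the number of groups by [N ^ s], so that there are
    enough groups to occupy every remaining place.

    For a piece made of [i] groups, each group gives [N ^ L] groups. Those of
    the first group make [N ^ L - i] singletons and one list of [i]; those of
    each of the [i - 1] other groups make one list, of [N ^ L] groups. *)
Lemma piece_split p : piece p -> exists parts, [/\ size parts = N ^ L,
  forall q, q \in parts -> piece q & perm_eq (flatten parts) (gens L p)].
Proof.
case=> [[x okx ->]|[qs [/andP[sz_gt0 sz_le] exqs -> _]]].
  set B := gens L [:: x].
  have okB : oks B by exact/oks_gens/oks1.
  set bad := [seq z <- B | predC good z]; set G := [seq z <- B | good z].
  have okG : oks G by apply: oks_sub okB; exact: mem_subseq (filter_subseq _ _).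
  have okbad : oks bad by apply: oks_sub okB; exact: mem_subseq (filter_subseq _ _).
  have gG : all good G by exact: filter_all.
  have [ps0 [sz0 ex0 perm0]] := exact_groups okG gG.
  have [|G1 [szG1 hG1 permG1]] := @split_all (N ^ s) s ps0; first by move=> q /ex0/exact_split.
  set ps1 := flatten G1.
  have sz1 : size ps1 = size ps0 * N ^ s.
    by rewrite (size_flatten_const (n := N ^ s)) ?szG1// => q /hG1[].
  have ex1 q : q \in ps1 -> exact_group q by move=> /flattenP[r /hG1[_ h _]]; exact: h.
  have perm1 : perm_eq (flatten ps1) (gens H G).
    by rewrite /H gensD flatten_flatten (perm_trans permG1)// gens_perm.
  have mB : mass G + bad_mass B = N ^ L * m x.
    by rewrite good_bad /B mass_gens; [rewrite /mass /= addn0|exact: oks1].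
  have badL : 2 * bad_mass B <= N ^ L by exact: bad_small.
  have szbad : size bad <= bad_mass B by exact: size_le_mass.
  have QQ : N ^ L = N ^ s * N ^ (s * j.-1) by rewrite -expnD /L -mulnS prednK//; lia.
  have QQ' : N ^ s <= N ^ (s * j.-1).
    by rewrite leq_pexp2l// -{1}[s]muln1 leq_mul2l -ltnS prednK ?j_ge2 ?orbT//; lia.
  have gM : g <= M.
    have [y [yx _ my]] := V_good okx v0V.
    have oky : ok y by apply: (oks_gens (n := D) (oks1 okx)).
    by apply: leq_trans (m_le oky); rewrite my dvdn_leq// gV.
  have [||chunks [szc flc sizes]] := @chunk _ (N ^ L) (N ^ L - size bad) ps1.
  - apply: leq_trans (leq_subr _ _) _; rewrite sz1.
    have mx := m_gt0 okx; have mG : N ^ L <= 2 * mass G by nia.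
    rewrite -(leq_pmul2r g_gt0) mulnAC sz0; nia.
  - have mx := m_le okx; rewrite sz1.
    have mG : size ps0 <= M * N ^ L by nia.
    have h1 : N ^ L <= 2 * (N ^ L - size bad) by lia.
    have h2 : 2 * M * N ^ s <= N ^ L by rewrite QQ mulnC leq_mul// (leq_trans s_big).
    nia.
  exists (map (fun z => gens H [:: z]) bad ++ map flatten chunks); split.
  + by rewrite size_cat !size_map szc subnKC//; lia.
  + move=> q; rewrite mem_cat => /orP[/mapP[z zbad ->]|/mapP[c cc ->]].
      by left; exists z => //; exact: okbad.
    right; exists c; split => //.
    * exact: (allP sizes).
    * by move=> r rc; apply: ex1; rewrite -flc; apply/flattenP; exists c.
    * exists x, (L + H); split => // z zc; rewrite addnC gensD -/B.
      have : z \in flatten ps1.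
        case/flattenP: zc => r rc zr; apply/flattenP; exists r => //.
        by rewrite -flc; apply/flattenP; exists c.
      rewrite (perm_mem perm1); apply: gens_sub.
      exact: mem_subseq (filter_subseq _ _).
  + rewrite flatten_cat -gensD addnC gensD -/B.
    have -> : flatten (map flatten chunks) = flatten ps1.
      by rewrite -flc flatten_flatten.
    have -> : flatten [seq gens H [:: z] | z <- bad] = gens H bad.
      by elim: (bad) => [|z b IH] /=; rewrite ?gens_nil// (gens_cons _ z b) IH.
    apply: (@perm_trans _ (gens H (bad ++ G))); first by rewrite gens_cat perm_cat2l.
    by apply: gens_perm; rewrite perm_catC perm_filterC.
case: qs sz_gt0 sz_le exqs => // q qs _ sz_le exqs.
have exq : exact_group q by apply: exqs; exact: mem_head.
have [ps [sz ex perm]] := exact_splitX j exq.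
have [|G [szG hG permG]] := @split_all (N ^ L) L qs.
  by move=> q' q'qs; apply/exact_splitX/exqs; rewrite inE q'qs orbT.
set i := size (q :: qs) in sz_le.
pose G0 := map (fun q => [:: q]) (take (N ^ L - i) ps) ++ drop (N ^ L - i) ps :: G.
have near_sub q' (r : seq X) : exact_group q' -> {subset r <= gens L q'} -> close_nodes (L + H) r.
  case=> _ _ _ [y oky q'y] rq'; exists y, (L + s); split => //.
    by rewrite leq_add2l leq_addr.
  by move=> z /rq'; rewrite gensD; exact: gens_sub.
exists (map flatten G0); split.
- rewrite size_map /G0 size_cat size_map size_takel; last by rewrite sz leq_subr.
  by rewrite /= szG -/i subnK.
- move=> _ /mapP[G1 hG1 ->]; right; exists G1.
  have psub z : z \in flatten ps -> z \in gens L q by rewrite (perm_mem perm).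
  move: hG1; rewrite mem_cat => /orP[/mapP[q' q't ->]|].
    have q'ps := mem_take q't; split => //=.
    + by rewrite expn_gt0 N_gt0.
    + by move=> r; rewrite inE => /eqP ->; exact: ex.
    + rewrite cats0; apply: near_sub exq _ => z zq'; apply: psub.
      by apply/flattenP; exists q'.
  rewrite inE => /orP[/eqP -> |G1G].
    split => //.
    + by rewrite size_drop sz -/L; have := sz_le; rewrite /i /=; lia.
    + by move=> r /mem_drop; exact: ex.
    + apply: near_sub exq _ => z /flattenP[r /mem_drop rps zr]; apply: psub.
      by apply/flattenP; exists r.
  have [sz1 ex1 [q1 q1qs sub1]] := hG _ G1G; split => //.
  + rewrite sz1 leqnn andbT; exact: leq_trans sz_le.
  + by apply: (near_sub q1) => //; apply: exqs; rewrite inE q1qs orbT.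
- rewrite /= gens_cat /G0 map_cat /= flatten_cat /= catA perm_cat//.
  rewrite -map_comp (perm_trans _ perm)// -{3}(cat_take_drop (N ^ L - i) ps) flatten_cat perm_cat2r.
  by rewrite (eq_map (g := id)) ?map_id// => r /=; rewrite cats0.
Qed.

Lemma piece_close p : piece p -> close_nodes (L + H) p.
Proof. by case=> [[x okx ->]|[qs []//]]; exists x, H; split => //; rewrite leq_addl. Qed.

Lemma piece_neq0 p : piece p -> 0 < size p.
Proof.
case=> [[x okx ->]|[qs [/andP[+ _] ex -> _]]].
  have := mass_gens H (oks1 okx); case: (gens _ _) => //= /esym/eqP.
  by rewrite /mass /= addn0 muln_eq0 expn_eq0 eqn0Ngt N_gt0 eqn0Ngt m_gt0.
case: qs ex => //= q qs ex _; rewrite size_cat ltn_addr// size_exact_gt0//.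
by apply: ex; exact: mem_head.
Qed.

End Exact.

(** When [N = 1] the mass is constant, and each generation of the root is a
    single node of mass one. *)
Theorem equal_splitting root : 0 < N -> ok root -> m root = 1 ->
  exists2 L0, 0 < L0 & forall L, 0 < L -> L0 %| L ->
  exists H c (Phi : seq X -> Prop), [/\ Phi (gens H [:: root]),
    forall p, Phi p -> exists parts, [/\ size parts = N ^ L,
      forall q, q \in parts -> Phi q & perm_eq (flatten parts) (gens L p)],
    forall p, Phi p -> 0 < size p &
    forall p, Phi p -> close_nodes c p].
Proof.
move=> N_gt0 okr mr; have [N_ge2|N_le1] := ltnP 1 N; last first.
  have {N_gt0 N_le1} N1 : N = 1 by lia.
  exists 1 => // L _ _; exists 0, 0, (fun p => exists x, [/\ ok x, m x = 1 & p = [:: x]]).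
  split; first by exists root.
  - move=> _ [x [okx mx ->]]; exists [:: gens L [:: x]]; rewrite N1 exp1n; split => //=.
      move=> q; rewrite inE => /eqP ->.
      have okg := oks_gens (n := L) (oks1 okx).
      have := mass_gens L (oks1 okx); rewrite N1 exp1n mul1n {2}/mass /= mx addn0.
      case: (gens _ _) okg => // y p /oks_cons[oky okp]; rewrite mass_cons => eq1.
      have := m_gt0 oky; have := size_le_mass okp; case: p {okp} eq1 => [|z p] /=.
        by rewrite {1}/mass /= addn0 => my _ _; exists y.
      by rewrite mass_cons; lia.
    by rewrite cats0.
  - by move=> _ [x [_ _ ->]].
  - by move=> _ [x [okx _ ->]]; exists x, 0; split.
have [g [P [P' [g_gt0 gV PV P'V PP']]]] := least_difference v0V v0_gt0.
(* as [t <= N ^ t], a sum of all the demands makes [N ^ s] exceed each of them *)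
pose s := D + (2 * M + M * (sumn P + sumn P') + M * M * M * size (P ++ P')).
have M_gt0' := M_gt0 okr.
have le_exp t : t <= N ^ t by exact/ltnW/ltn_expl.
have le_exps t : t <= s -> t <= N ^ s by move=> /leq_trans; apply; exact: le_exp.
have s_gt0 : 0 < s by rewrite /s; lia.
have s_big : 2 * M <= N ^ s by apply: le_exps; rewrite /s; lia.
have s_sums : M * (sumn P + sumn P') <= g * N ^ s.
  by apply: leq_trans (leq_pmull _ g_gt0); apply: le_exps; rewrite /s; lia.
have le_Ds : D <= s by rewrite /s leq_addr.
have s_count : M * M * M * size (P ++ P') <= N ^ (s - D).
  by rewrite /s addKn; apply: leq_trans (le_exp _); lia.
have [L1 hL1] := bad_mass_small.
exists (s * (L1 + 2)) => [|L L_gt0 /dvdnP[k eL]]; first by rewrite muln_gt0 s_gt0 addn2.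
pose j := (L1 + 2) * k.
have eLj : L = s * j by rewrite eL /j mulnC mulnA.
have k_gt0 : 0 < k by case: (k) eL L_gt0 => // ->; rewrite mul0n.
have j_ge2 : 2 <= j by rewrite /j; nia.
have le_L1 : L1 <= L by rewrite eLj /j; nia.
exists (s + s), (s * j + (s + s)), (piece g s j); rewrite eLj; split.
- by left; exists root.
- have bs x : ok x -> 2 * bad_mass (gens (s * j) [:: x]) <= N ^ (s * j).
    by move=> okx; rewrite -eLj; exact: hL1.
  move=> p; exact: (piece_split g_gt0 gV PV P'V PP' le_Ds s_sums s_count N_gt0 s_gt0 j_ge2 s_big bs).
- by move=> p; exact: piece_neq0.
- by move=> p; exact: piece_close.
Qed.

End MassTree.
End Tree.

(** * Components of a finite set for a reflexive symmetric relation *)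

Section Components.
Variables (V : choiceType) (adj : V -> V -> Prop).
Hypothesis adj_refl : forall x, adj x x.
Hypothesis adj_sym : forall x y, adj x y -> adj y x.
Implicit Types (S T : {fset V}) (a b x y : V).
Local Open Scope fset_scope.

Definition closed_in S T := forall x y, x \in T -> y \in S -> adj x y -> y \in T.

(** As an intersection of closed parts: induction along paths is then an
    application of minimality, see [comp_min]. *)
Definition component S a : {fset V} :=
  [fset b in S | `[< forall T, a \in T -> closed_in S T -> b \in T >]].

Definition components S : seq {fset V} := undup [seq component S a | a <- enum_fset S].

Lemma in_sep S (p : pred V) x : (x \in [fset x in S | p x]) = (x \in S) && p x.
Proof. by rewrite !inE. Qed.

Lemma comp_sub S a : component S a `<=` S.
Proof. by apply/fsubsetP => x; rewrite !inE => /andP[]. Qed.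

Lemma mem_comp S a : a \in S -> a \in component S a.
Proof. by move=> aS; rewrite !inE aS /=; apply/asboolP. Qed.

Lemma comp_min S T a : a \in T -> closed_in S T -> component S a `<=` T.
Proof.
by move=> aT clT; apply/fsubsetP => x; rewrite !inE => /andP[_ /asboolP]; exact.
Qed.

Lemma comp_closed S a : closed_in S (component S a).
Proof.
move=> x y; rewrite !inE => /andP[xS /asboolP xT] yS xy; rewrite yS /=.
by apply/asboolP => T aT clT; apply: (clT x) => //; exact: xT.
Qed.

Lemma comp_eq S a b : a \in S -> b \in component S a -> component S b = component S a.
Proof.
move=> aS bSa; apply/eqP; rewrite eqEfsubset; apply/andP; split.
  by apply: comp_min => //; exact: comp_closed.
suff abS : a \in component S b by apply: comp_min => //; exact: comp_closed.
pose T := [fset x in S | a \in component S x].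
have clT : closed_in S T.
  move=> x y; rewrite in_sep => /andP[xS axS] yS xy; rewrite in_sep yS /=.
  have sub : component S x `<=` component S y.
    apply: comp_min; last exact: comp_closed.
    by apply: comp_closed (mem_comp yS) xS _; exact: adj_sym.
  exact: (fsubsetP sub).
have aT : a \in T by rewrite in_sep aS mem_comp.
by move: (fsubsetP (comp_min aT clT) b bSa); rewrite in_sep => /andP[].
Qed.

Lemma compsP S P : reflect (exists2 a, a \in S & P = component S a) (P \in components S).
Proof. by rewrite mem_undup; exact: mapP. Qed.

Lemma mem_comps S a : a \in S -> component S a \in components S.
Proof. by move=> aS; apply/compsP; exists a. Qed.

Lemma comps_sub S P : P \in components S -> P `<=` S.
Proof. by move=> /compsP[a aS ->]; exact: comp_sub. Qed.

Lemma comps_eq S P a : P \in components S -> a \in P -> P = component S a.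
Proof. by move=> /compsP[b bS ->] abS; rewrite (comp_eq bS abS). Qed.

Lemma comps_closed S P : P \in components S -> closed_in S P.
Proof. by move=> /compsP[b bS ->]; exact: comp_closed. Qed.

Lemma comps_neq0 S P : P \in components S -> exists a, a \in P.
Proof. by move=> /compsP[b bS ->]; exists b; exact: mem_comp. Qed.

(** This lets the components of a later generation be computed inside each
    component of an earlier one. *)
Lemma comp_closed_part S T a : T `<=` S -> closed_in S T -> a \in T ->
  component T a = component S a.
Proof.
move=> TS clT aT; apply/eqP; rewrite eqEfsubset; apply/andP; split.
  apply: comp_min; first by apply: mem_comp; exact: (fsubsetP TS).
  move=> x y xS yT xy; apply: comp_closed xS _ xy; exact: (fsubsetP TS).
apply: comp_min; first exact: mem_comp.
move=> x y xTa yS xy; apply: comp_closed (xTa) _ (xy).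
by apply: (clT x) => //; exact: (fsubsetP (comp_sub T a)).
Qed.

Lemma mem_flatten_fsets (ps : seq {fset V}) x :
  reflect (exists2 P, P \in ps & x \in P) (x \in flatten [seq enum_fset P | P <- ps]).
Proof. exact: (@flatten_mapP _ _ (fun P : {fset V} => enum_fset P)). Qed.

Lemma sum_comps S : (sumn [seq #|` P| | P <- components S] = #|` S|)%N.
Proof.
have -> : #|` S| = size (flatten [seq enum_fset P | P <- components S]).
  apply/perm_size/uniq_perm; first exact: fset_uniq.
    rewrite (_ : uniq _ = true)//.
    have : uniq (components S) by exact: undup_uniq.
    have : {subset components S <= components S} by [].
    elim: {1 3 4}(components S) => //= P ps IH sub /andP[Pps ups].
    rewrite cat_uniq fset_uniq IH// ?andbT/=; last first.
      by move=> Q Qps; apply: sub; rewrite inE Qps orbT.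
    apply/hasPn => x /mem_flatten_fsets[Q Qps xQ]; apply: contra Pps => xP.
    have PS := sub _ (mem_head _ _).
    have QS : Q \in components S by apply: sub; rewrite inE Qps orbT.
    by rewrite (comps_eq PS xP) -(comps_eq QS xQ).
  move=> x; apply/idP/mem_flatten_fsets => [xS|[P PS xP]].
    by exists (component S x); [exact: mem_comps|exact: mem_comp].
  exact: (fsubsetP (comps_sub PS)).
by rewrite size_flatten /shape -map_comp.
Qed.

End Components.

(** * The tree of components of the orbit of the origin *)

Section Expansion.
Variables (V : zmodType) (fA : V -> V) (D : {fset V}) (adj : V -> V -> Prop).
Hypothesis fAD : {morph fA : x y / x + y}.
Hypothesis adj_refl : forall x, adj x x.
Hypothesis adj_sym : forall x y, adj x y -> adj y x.
Hypothesis adj_shift : forall x y t, adj x y -> adj (x + t)%R (y + t)%R.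
Hypothesis adj_expand : forall x y e e', e \in D -> e' \in D ->
  adj (fA x + e)%R (fA y + e')%R -> adj x y.
Local Open Scope fset_scope.

Definition expand (S : {fset V}) : {fset V} := [fset (fA p.1 + p.2)%R | p in S `*` D].
Local Notation components := (components adj).
Local Notation component := (component adj).
Definition children (P : {fset V}) := components (expand P).
Local Notation gens := (gens children).

Lemma expandP S z :
  reflect (exists a e, [/\ a \in S, e \in D & z = (fA a + e)%R]) (z \in expand S).
Proof.
apply: (iffP (imfsetP _ _ _ _)) => [[[a e] /=]|[a [e [aS eD ->]]]].
  by rewrite inE => /andP[aS eD] ->; exists a, e.
by exists (a, e) => //=; rewrite !inE aS.
Qed.

Lemma expand_mono S T : S `<=` T -> expand S `<=` expand T.
Proof.
move=> /fsubsetP ST; apply/fsubsetP => z /expandP[a [e [aS eD ->]]].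
by apply/expandP; exists a, e; split => //; exact: ST.
Qed.

Lemma expand_closed S T : closed_in adj S T -> closed_in adj (expand S) (expand T).
Proof.
move=> clT _ _ /expandP[a [e [aT eD ->]]] /expandP[b [e' [bS e'D ->]]] ab.
by apply/expandP; exists b, e'; split => //; apply: clT aT bS _; exact: adj_expand ab.
Qed.

(** Points of adjacent images have adjacent parents by [adj_expand], so the
    image of a component is closed and the images of distinct components do
    not touch. *)
Lemma perm_comps_expand S :
  perm_eq (flatten [seq children P | P <- components S]) (components (expand S)).
Proof.
have chS P Q : P \in components S -> Q \in children P -> Q \in components (expand S).
  move=> PS /compsP[z zP ->]; have PsubS := expand_mono (comps_sub PS).
  rewrite (comp_closed_part PsubS)//; first by apply: mem_comps; exact: (fsubsetP PsubS).
  by apply: expand_closed; exact: comps_closed PS.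
apply: uniq_perm; last 1 first.
- move=> Q; apply/flatten_mapP/idP => [[P PS]|]; first exact: chS.
  move=> /compsP[z /expandP[a [e [aS eD zE]]] ->].
  have PS := mem_comps adj aS.
  exists (component S a) => //.
  apply/compsP; exists z; first by apply/expandP; exists a, e; split=> //; exact: mem_comp.
  rewrite (comp_closed_part (expand_mono (comps_sub PS)))//.
  - by apply: expand_closed; exact: comps_closed PS.
  - by apply/expandP; exists a, e; split=> //; exact: mem_comp.
- have : uniq (components S) by exact: undup_uniq.
  have : {subset components S <= components S} by [].
  elim: {1 3 4}(components S) => //= P ps IH sub /andP[Pps ups].
  have sub' : {subset ps <= components S} by move=> Q Qps; apply: sub; rewrite inE Qps orbT.
  rewrite cat_uniq undup_uniq IH// ?andbT/=.
  apply/hasPn => R /flatten_mapP[Q Qps RQ]; apply: contra Pps => RP.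
  have PS := sub _ (mem_head _ _); have QS := sub' _ Qps.
  have [z zR] := comps_neq0 RP.
  have /expandP[a [e [aP eD zE]]] := fsubsetP (comps_sub RP) _ zR.
  have /expandP[b [e' [bQ e'D zE']]] := fsubsetP (comps_sub RQ) _ zR.
  have ab : adj a b by apply: (@adj_expand _ _ e e') => //; rewrite -zE -zE'.
  have bP : b \in P by apply: (comps_closed PS aP) ab; exact: (fsubsetP (comps_sub QS)).
  by rewrite (comps_eq adj_sym PS bP) -(comps_eq adj_sym QS bQ).
- exact: undup_uniq.
Qed.

Lemma perm_gens_comps n S : perm_eq (gens n (components S)) (components (iter n expand S)).
Proof.
elim: n => //= n IH; apply: perm_trans (perm_comps_expand _).
by apply/perm_flatten/perm_map.
Qed.

Lemma comps1 a : components [fset a] = [:: [fset a]].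
Proof.
rewrite /components; have -> : enum_fset [fset a] = [:: a].
  by apply: perm_small_eq => //; apply: uniq_perm => // x; rewrite !inE.
rewrite /= ; congr cons; apply/fsetP => x; rewrite !inE; case: eqP => //= ->.
by apply/asboolP.
Qed.

Lemma comps_of_comp S P : P \in components S -> components P = [:: P].
Proof.
move=> PS; apply/perm_small_eq => //; apply: uniq_perm => //; first exact: undup_uniq.
have PsubS := comps_sub PS; have clP := comps_closed PS.
have eP a : a \in P -> component P a = P.
  by move=> aP; rewrite (comp_closed_part PsubS clP aP) -(comps_eq adj_sym PS aP).
move=> Q; rewrite inE; apply/compsP/eqP => [[a aP ->]|->]; first exact: eP.
by have [a aP] := comps_neq0 PS; exists a; rewrite ?eP.
Qed.

Lemma perm_gens1 n S P : P \in components S -> perm_eq (gens n [:: P]) (components (iter n expand P)).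
Proof. by move=> PS; rewrite -(comps_of_comp PS) perm_gens_comps ?(comps_of_comp PS). Qed.

Lemma iter_expand_sub n P S : P `<=` S -> iter n expand P `<=` iter n expand S.
Proof. by move=> PS; elim: n => //= n; exact: expand_mono. Qed.

Lemma iter_expand_closed n P S : closed_in adj S P -> closed_in adj (iter n expand S) (iter n expand P).
Proof. by move=> PS; elim: n => //= n; exact: expand_closed. Qed.

(** * Translations of nodes *)

Definition translate t (S : {fset V}) : {fset V} := [fset (x + t)%R | x in S].

Lemma in_shift t S x : (x \in translate t S) = ((x - t)%R \in S).
Proof.
apply/(imfsetP _ _ _ _)/idP => [[y /= yS ->]|xS]; first by rewrite addrK.
by exists (x - t)%R => //; rewrite subrK.
Qed.

Lemma shift_shift t u S : translate t (translate u S) = translate (u + t)%R S.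
Proof. by apply/fsetP => x; rewrite !in_shift opprD addrAC addrA. Qed.

Lemma shift0 S : translate 0%R S = S.
Proof. by apply/fsetP => x; rewrite in_shift subr0. Qed.

Lemma shiftK t : cancel (translate t) (translate (- t)%R).
Proof. by move=> S; rewrite shift_shift subrr shift0. Qed.

Lemma card_shift t S : #|` translate t S| = #|` S|.
Proof. by rewrite card_imfset//; exact: addIr. Qed.

Lemma comp_shift_sub t S a : a \in S -> component (translate t S) (a + t)%R `<=` translate t (component S a).
Proof.
move=> aS; apply: comp_min; first by rewrite in_shift addrK mem_comp.
move=> x y; rewrite !in_shift => xS yS xy; apply: comp_closed xS yS _.
exact: adj_shift.
Qed.

Lemma comp_shift t S a : a \in S -> component (translate t S) (a + t)%R = translate t (component S a).
Proof.
move=> aS; apply/eqP; rewrite eqEfsubset comp_shift_sub//=.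
have : (a + t)%R \in translate t S by rewrite in_shift addrK.
move=> /(comp_shift_sub (- t)%R); rewrite shiftK addrK => /fsubsetP sub.
by apply/fsubsetP => x; rewrite in_shift => /sub; rewrite in_shift opprK subrK.
Qed.

Lemma perm_comps_shift t S : perm_eq (components (translate t S)) (map (translate t) (components S)).
Proof.
apply: uniq_perm; first exact: undup_uniq.
  by rewrite map_inj_uniq; [exact: undup_uniq|exact: can_inj (shiftK t)].
move=> P; apply/idP/mapP => [/compsP[a]|[Q /compsP[a aS ->] ->]].
  rewrite in_shift => aS ->; exists (component S (a - t)%R); first exact: mem_comps.
  by rewrite -comp_shift// subrK.
by rewrite -comp_shift//; apply: mem_comps; rewrite in_shift addrK.
Qed.

Lemma expand_shift t S : expand (translate t S) = translate (fA t) (expand S).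
Proof.
apply/fsetP => z; rewrite in_shift; apply/expandP/expandP => -[a [e [aS eD zE]]].
  rewrite in_shift in aS; exists (a - t)%R, e; split => //.
  by have := fAD (a - t)%R t; rewrite subrK => fa; rewrite zE fa addrAC addrK.
exists (a + t)%R, e; split => //; first by rewrite in_shift addrK.
by rewrite fAD addrAC -zE subrK.
Qed.

Lemma gens_shift n t p :
  perm_eq (gens n (map (translate t) p)) (map (translate (iter n fA t)) (gens n p)).
Proof.
elim: n => //= n IH.
apply: (@perm_trans _ (flatten (map children (map (translate (iter n fA t)) (gens n p))))).
  exact/perm_flatten/perm_map.
elim: (gens n p) => //= P q IHq; rewrite map_cat perm_cat//.
by rewrite /children expand_shift perm_comps_shift.
Qed.

Lemma mem_gens_shift n t P Q :
  (Q \in gens n [:: translate t P]) = (translate (- iter n fA t)%R Q \in gens n [:: P]).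
Proof.
rewrite (perm_mem (gens_shift n t [:: P])); apply/mapP/idP => [[R RP ->]|QP].
  by rewrite shiftK.
by exists (translate (- iter n fA t)%R Q) => //; rewrite shift_shift addNr shift0.
Qed.

(** * Recurrence in the orbit of the origin *)

Definition digit_sums n := iter n expand [fset 0%R].
Local Notation Z := digit_sums.

Definition node P := exists n, P \in components (Z n).

Hypothesis expand_inj : forall n a b e e', a \in Z n -> b \in Z n ->
  e \in D -> e' \in D -> (fA a + e = fA b + e')%R -> a = b /\ e = e'.
Variable W : {fset V}.
Hypothesis W_near : forall n a b c, a \in Z n -> b \in component (Z n) a -> adj b c ->
  (c - a)%R \in W.

Lemma card_expand n S : S `<=` Z n -> #|` expand S| = (#|` D| * #|` S|)%N.
Proof.
move=> /fsubsetP SZ.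
have -> : #|` expand S| = size [seq (fA a + e)%R | a <- enum_fset S, e <- enum_fset D].
  apply/perm_size/uniq_perm; first exact: fset_uniq.
    apply: allpairs_uniq; try exact: fset_uniq.
    move=> _ _ /allpairsP[[a e] [/= aS eD ->]] /allpairsP[[b e'] [/= bS e'D ->]] /= E.
    by have [-> ->] := expand_inj (SZ _ aS) (SZ _ bS) eD e'D E.
  move=> z; apply/expandP/allpairsP => [[a [e [aS eD ->]]]|[[a e] [/= aS eD ->]]].
    by exists (a, e).
  by exists a, e.
by rewrite size_allpairs mulnC.
Qed.

Lemma ZD n k x y : x \in Z n -> y \in Z k -> (iter k fA x + y)%R \in Z (k + n).
Proof.
move=> xZ; elim: k y => [|k IH] y /=; first by rewrite inE => /eqP ->; rewrite addr0.
by move=> /expandP[a [e [aZ eD ->]]]; apply/expandP; exists (iter k fA x + a)%R, e;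
  rewrite fAD addrA IH.
Qed.

Lemma node_child P Q : node P -> Q \in children P -> node Q.
Proof.
move=> [n PZ] QP; exists n.+1; rewrite /= -(perm_mem (perm_comps_expand _)).
by apply/flatten_mapP; exists P.
Qed.

Lemma card_le_W n P : P \in components (Z n) -> (#|` P| <= #|` W|)%N.
Proof.
move=> PZ; have [a aP] := comps_neq0 PZ.
have aZ := fsubsetP (comps_sub PZ) _ aP.
rewrite -(card_shift (- a)%R); apply: fsubset_leq_card; apply/fsubsetP => x.
rewrite in_shift opprK => xP; rewrite -[x](addrK a).
apply: (W_near aZ) (adj_refl _); first by rewrite -(comps_eq adj_sym PZ aP).
Qed.

(** The window [W] contains everything that can be adjacent to the component
    of [a], relatively to [a]. *)
Definition nbhd n a : {fset V} := [fset x in W | (x + a)%R \in Z n].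

(** The neighbourhood of [u] in [Z k], translated by the [k]-th image of any
    point [x] of [Z n], is contained in a neighbourhood in [Z (k + n)]. If the
    first is of maximal size the two are equal: nothing new touches the
    translated component of [u], which therefore is a component of [Z (k + n)],
    [k] levels below the component of [x]. *)
Lemma recurrent_component : exists k C, C \in components (Z k) /\
  forall P, node P -> exists t, translate t C \in gens k [:: P].
Proof.
have ex : exists s, `[< exists n a, a \in Z n /\ #|` nbhd n a| = s >].
  by exists #|` nbhd 0 0%R|; apply/asboolP; exists 0%N, 0%R; split; rewrite ?inE.
have bnd s : `[< exists n a, a \in Z n /\ #|` nbhd n a| = s >] -> (s <= #|` W|)%N.
  move=> /asboolP[n [a [_ <-]]]; apply: fsubset_leq_card.
  by apply/fsubsetP => x; rewrite in_sep => /andP[].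
have [s /asboolP[k [u [uZ us]]] s_max] := ex_maxnP ex bnd.
exists k, (component (Z k) u); split; first exact: mem_comps.
move=> P [n PZ]; have [x xP] := comps_neq0 PZ.
have xZ := fsubsetP (comps_sub PZ) _ xP.
set t := iter k fA x; exists t.
have nbhd_eq : nbhd k u = nbhd (k + n) (u + t)%R.
  apply/eqP; rewrite eqEfcard; apply/andP; split; last first.
    by rewrite us; apply: s_max; apply/asboolP; exists (k + n)%N, (u + t)%R; split => //;
      rewrite addrC ZD.
  apply/fsubsetP => y; rewrite !in_sep => /andP[-> yu] /=.
  by rewrite addrA addrC ZD.
have uPk : (u + t)%R \in iter k expand P.
  have : forall m y, y \in Z m -> (y + iter m fA x)%R \in iter m expand P.
    elim=> [|m IH] y /=; first by rewrite inE => /eqP ->; rewrite add0r.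
    move=> /expandP[a [e [aZ eD ->]]]; apply/expandP; exists (a + iter m fA x)%R, e.
    by rewrite fAD addrAC IH.
  exact.
rewrite (perm_mem (perm_gens1 k PZ)).
have -> : translate t (component (Z k) u) = component (iter k expand P) (u + t)%R; last exact: mem_comps.
have PZk : iter k expand P `<=` Z (k + n).
  by rewrite /digit_sums iterD; exact: iter_expand_sub (comps_sub PZ).
have clPZ : closed_in adj (Z (k + n)) (iter k expand P).
  by rewrite /digit_sums iterD; apply: iter_expand_closed; exact: comps_closed PZ.
rewrite (comp_closed_part PZk clPZ uPk).
apply/eqP; rewrite eqEfsubset; apply/andP; split.
  apply/fsubsetP => y; rewrite in_shift => yu.
  pose T := [fset z in Z k | (z + t)%R \in component (Z (k + n)) (u + t)%R].
  suff /fsubsetP /(_ _ yu) : component (Z k) u `<=` T by rewrite in_sep subrK => /andP[].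
  apply: comp_min; first by rewrite in_sep uZ mem_comp// (fsubsetP PZk).
  move=> z w; rewrite in_sep => /andP[zZ zc] wZ zw; rewrite in_sep wZ /=.
  by apply: comp_closed zc _ _; [rewrite addrC ZD|exact: adj_shift].
apply: comp_min; first by rewrite in_shift addrK mem_comp.
move=> y z; rewrite !in_shift => yc zZ yz.
have yz' := adj_shift (- t)%R yz.
have : (z - t - u)%R \in nbhd (k + n) (u + t)%R.
  by rewrite in_sep (W_near uZ yc yz') /= addrA subrK subrK.
rewrite -nbhd_eq in_sep subrK => /andP[_ zZk].
exact: comp_closed yc zZk yz'.
Qed.

Lemma node_gens d P Q : node P -> Q \in gens d [:: P] -> node Q.
Proof.
move=> nP; have : oks node [:: P] by exact: oks1.
by move=> /(oks_gens node_child (n := d)) h /h.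
Qed.

(** The good nodes are the descendants of translates of a recurrent component;
    their masses are those of the descendants of [C] itself. *)
Theorem node_splitting : D != fset0 ->
  exists2 L0, (0 < L0)%N & forall L, (0 < L)%N -> (L0 %| L)%N ->
  exists H c (Phi : seq {fset V} -> Prop), [/\ Phi (gens H [:: [fset 0%R]]),
    forall p, Phi p -> exists parts, [/\ size parts = (#|` D| ^ L)%N,
      forall q, q \in parts -> Phi q & perm_eq (flatten parts) (gens L p)],
    forall p, Phi p -> (0 < size p)%N &
    forall p, Phi p -> close_nodes children node c p].
Proof.
rewrite -cardfs_gt0 => D_gt0.
have [k [C [CZ recC]]] := recurrent_component.
pose m (P : {fset V}) := #|` P|.
have nC : node C by exists k.
have node_gt0 P : node P -> (0 < m P)%N.
  by move=> [n /comps_neq0[a aP]]; rewrite cardfs_gt0; apply/fset0Pn; exists a.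
have node_le P : node P -> (m P <= #|` W|)%N by move=> [n]; exact: card_le_W.
have mass_ch P : node P -> mass m (children P) = (#|` D| * m P)%N.
  move=> [n PZ]; rewrite /mass (sum_comps adj_sym) (card_expand (n := n))//.
  exact: comps_sub PZ.
have gens_neq0 d P : node P -> exists Q, Q \in gens d [:: P].
  move=> nP; have := mass_gens node_child mass_ch d (oks1 nP).
  case: (gens d [:: P]) => [/esym/eqP|Q q _]; last by exists Q; exact: mem_head.
  by rewrite /mass /= addn0 muln_eq0 expn_eq0 eqn0Ngt D_gt0 eqn0Ngt node_gt0.
pose good (P : {fset V}) := `[< exists d t, P \in gens d [:: translate t C] >].
have good_ch P Q : good P -> Q \in children P -> good Q.
  move=> /asboolP[d [t PC]] QP; apply/asboolP; exists d.+1, t => /=.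
  by apply/flatten_mapP; exists P.
pose value d v := v \in map m (gens d [:: C]).
pose vals := [seq v <- iota 0 #|` W|.+1 | `[< exists d, value d v >]].
have good_vals P : node P -> good P -> m P \in vals.
  move=> nP /asboolP[d [t]]; rewrite mem_gens_shift => PC.
  rewrite mem_filter mem_iota /= add0n ltnS node_le// andbT.
  by apply/asboolP; exists d; apply/mapP; exists (translate (- iter d fA t)%R P) => //; rewrite /m card_shift.
have value_shift d t v : value d v -> exists2 Q, Q \in gens d [:: translate t C] & m Q = v.
  move=> /mapP[Q QC ->]; exists (translate (iter d fA t) Q); last by rewrite /m card_shift.
  by rewrite mem_gens_shift shiftK.
(* from any descendant of [C], a translate of [C] is found [k] levels below,
   so a mass that occurs once recurs at all depths far enough; hence one depth
   [D1] serves for all the values *)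
have value_later d v e : (k <= e)%N -> value d v -> value (d + e)%N v.
  move=> ke dv; have [Q QC] := gens_neq0 (e - k)%N _ nC.
  have [t tC] := recC _ (node_gens nC QC).
  have tCe : translate t C \in gens e [:: C].
    by rewrite -(subnKC ke) gensD; apply/mem_gens; exists Q.
  have [R RC <-] := value_shift _ t _ dv; apply: map_f.
  by rewrite gensD; apply/mem_gens; exists (translate t C).
have [D1 D1v] : exists D1, forall v, v \in vals -> value D1 v.
  have : {in vals, forall v, exists d, value d v} by move=> v; rewrite mem_filter => /andP[/asboolP].
  suff : forall s : seq nat, {in s, forall v, exists d, value d v} ->
    exists d0, forall d v, (d0 <= d)%N -> v \in s -> value d v.
    by move=> /[apply] -[d0 h]; exists d0 => v; exact: h.
  elim=> [|v s IH] h; first by exists 0%N.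
  have [|d0 hd0] := IH; first by move=> x xs; apply: h; rewrite inE xs orbT.
  have [d1 hd1] := h v (mem_head _ _); exists (d0 + (d1 + k))%N => d x le_d.
  rewrite inE => /orP[/eqP -> |xs]; last by apply: hd0 => //; apply: leq_trans le_d; exact: leq_addr.
  have -> : d = (d1 + (d - d1))%N by lia.
  by apply: value_later => //; lia.
have vals_good P v : node P -> v \in vals ->
    exists Q, [/\ Q \in gens (D1 + k) [:: P], good Q & m Q = v].
  move=> nP /D1v D1v'; have [t tC] := recC _ nP.
  have [Q QC mQ] := value_shift _ t _ D1v'; exists Q; split => //.
    by rewrite gensD; apply/mem_gens; exists (translate t C).
  by apply/asboolP; exists D1, t.
have goodC : good C by apply/asboolP; exists 0%N, 0%R; rewrite shift0 mem_head.
have root_node : node [fset 0%R] by exists 0%N; rewrite comps1 mem_head.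
apply: (equal_splitting node_child node_gt0 node_le mass_ch good_ch good_vals
  vals_good (good_vals _ nC goodC) (node_gt0 _ nC) D_gt0 root_node).
by rewrite /m cardfs1.
Qed.

End Expansion.

(** * Powers of the inverse of an expanding matrix *)

Section Vanishing.
Variable R : realType.
Implicit Types (a b : nat -> R).

Definition vanishing a := forall e, 0 < e -> exists n0, forall n, (n0 <= n)%N -> a n < e.

Lemma geometric_vanishing (c rho : R) : 0 <= c -> 0 <= rho < 1 -> vanishing (fun n => c * rho ^+ n).
Proof.
move=> c0 /andP[rho0 rho1] e e0.
have : geometric c rho x @[x --> \oo] --> (0 : R) by apply: cvg_geometric; rewrite ger0_norm.
move=> /cvgr0Pnorm_lt /(_ e e0)[n0 _ h]; exists n0 => n nn0.
by apply: le_lt_trans (ler_norm _) _; exact: h.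
Qed.

Lemma contraction_vanishing (rho : R) a b : 0 <= rho < 1 -> (forall n, 0 <= a n) ->
  (forall n, a n.+1 <= rho * (a n + b n)) -> vanishing b -> vanishing a.
Proof.
move=> /andP[rho0 rho1] a0 ab bv e e0.
pose c := e / 2.
have c0 : 0 < c by rewrite divr_gt0.
have r1 : 0 < 1 - rho by rewrite subr_gt0.
have [n0 hn0] := bv (c * (1 - rho)) (mulr_gt0 c0 r1).
have step j : a (n0 + j)%N <= c + a n0 * rho ^+ j.
  elim: j => [|j IH]; first by rewrite addn0 expr0 mulr1 lerDr ltW.
  rewrite addnS; apply: le_trans (ab _) _.
  have bj := ltW (hn0 _ (leq_addr j n0)).
  apply: (@le_trans _ _ (rho * (c + a n0 * rho ^+ j + c * (1 - rho)))).
    by rewrite ler_wpM2l// lerD.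
  have -> : rho * (c + a n0 * rho ^+ j + c * (1 - rho)) =
      c + a n0 * rho ^+ j.+1 - c * (1 - rho) ^+ 2 by rewrite exprS; ring.
  by rewrite gerBl mulr_ge0 ?sqr_ge0// ltW.
have [|n1 hn1] := @geometric_vanishing (a n0) rho (a0 n0) _ c c0; first by rewrite rho0.
exists (n0 + n1)%N => n le_n; have {1}-> : n = (n0 + (n - n0))%N by lia.
apply: le_lt_trans (step _) _; rewrite [X in _ < X](splitr e) ltrD2l hn1//; lia.
Qed.

End Vanishing.

Section ComplexMatrix.
Variable R : realType.
Local Notation C := (R[i]).
Local Notation normc := (@Normc.normc R).

Lemma norm_normc (z : C) : `|z| = (normc z)%:C%C.
Proof. by []. Qed.

Lemma normc_ge0 (z : C) : 0 <= normc z.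
Proof. by case: z => x y; exact: sqrtr_ge0. Qed.

Lemma normcD (x y : C) : normc (x + y) <= normc x + normc y.
Proof. by have := ler_normD x y; rewrite !norm_normc -rmorphD lecR. Qed.

Variable d : nat.
Definition sumnorm (Y : 'M[C]_d.+1) : R := \sum_i \sum_j normc (Y i j).

Lemma sumnorm_ge0 Y : 0 <= sumnorm Y.
Proof. by do 2!(apply: sumr_ge0 => ? _); exact: normc_ge0. Qed.

Lemma sumnormD Y Z : sumnorm (Y + Z) <= sumnorm Y + sumnorm Z.
Proof.
rewrite /sumnorm -big_split ler_sum// => i _; rewrite -big_split ler_sum// => j _.
by rewrite mxE normcD.
Qed.

Lemma sumnormZ c Y : sumnorm (c *: Y) = normc c * sumnorm Y.
Proof.
rewrite /sumnorm mulr_sumr; apply: eq_bigr => i _; rewrite mulr_sumr.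
by apply: eq_bigr => j _; rewrite mxE Normc.normcM.
Qed.

(** Cayley-Hamilton kills the product of all the factors [A - r]; the factors
    are then removed one at a time, each by a contraction of ratio 1/|r|. *)
Lemma factors_vanishing (A : 'M[C]_d.+1) (rs : seq C) : A \is a GRing.unit ->
  all (fun r => 1 < normc r) rs ->
  vanishing (fun k => sumnorm (\prod_(r <- rs) (A - r%:M) * A^-1 ^+ k)) ->
  vanishing (fun k => sumnorm (A^-1 ^+ k)).
Proof.
move=> uA; elim: rs => [|r rs IH] /=.
  by move=> _ h e /h[n0 hn]; exists n0 => n /hn; rewrite big_nil mul1r.
move=> /andP[r1 hrs] van; apply: IH => //.
have r0 : 0 < normc r by apply: lt_trans r1.
have nr0 : r != 0 by apply: contraTneq r0 => ->; rewrite Normc.normc0 ltxx.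
set Y := fun k : nat => \prod_(j <- rs) (A - j%:M) * A^-1 ^+ k.
have comA : GRing.comm A (\prod_(j <- rs) (A - j%:M)).
  apply: commr_prod => x _; apply: commrB; first exact: commr_refl.
  exact/commr_sym/comm_scalar_mx.
have AY k : A * Y k.+1 = Y k.
  by rewrite /Y mulrA comA -mulrA exprS mulVKr.
set U := fun k : nat => (A - r%:M) * Y k.
have vU : vanishing (fun k => sumnorm (U k.+1)).
  move=> e /van[n0 hn]; exists n0 => n le_n; have := hn n.+1 (leqW le_n).
  by rewrite big_cons -mulrA.
apply: (contraction_vanishing (rho := (normc r)^-1) (b := fun k => sumnorm (U k.+1))) => //.
- by rewrite invr_ge0 ltW//= invf_lt1.
- by move=> k; exact: sumnorm_ge0.
move=> k; rewrite -[X in sumnorm X]/(Y k.+1).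
have -> : Y k.+1 = r^-1 *: (Y k + (-1) *: U k.+1).
  rewrite /U mulrBl AY scaleN1r opprB addrC subrK -[_%:M * _]/(_ *m _) mul_scalar_mx scalerA mulVf//.
  by rewrite scale1r.
rewrite sumnormZ Normc.normcV ler_wpM2l ?invr_ge0 ?(ltW r0)//.
apply: le_trans (sumnormD _ _) _; rewrite lerD2l sumnormZ.
by have -> : normc (-1) = 1; [rewrite /Normc.normc /= oppr0 sqrrN expr1n expr0n/= addr0 sqrtr1|rewrite mul1r].
Qed.

Lemma expanding_powers (A : 'M[C]_d.+1) :
  (forall r, eigenvalue A r -> 1 < normc r) ->
  [/\ A \is a GRing.unit, 1 < normc (\det A) & vanishing (fun k => sumnorm (A^-1 ^+ k))].
Proof.
move=> hA; have [rs] := closed_field_poly_normal (char_poly A).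
rewrite (eqP (char_poly_monic A)) scale1r => eA.
have hrs : all (fun r => 1 < normc r) rs.
  apply/allP => r rrs; apply: hA; rewrite eigenvalue_root_char eA.
  by rewrite root_prod_XsubC.
have detA : normc (\det A) = \prod_(r <- rs) normc r.
  have := char_poly_det A; rewrite eA -horner_coef0 horner_prod => /(congr1 normc).
  rewrite Normc.normcM.
  have -> : normc ((-1) ^+ d.+1) = 1.
    elim: d.+1 => [|n IH]; rewrite ?expr0 ?Normc.normc1// exprS Normc.normcM IH mulr1.
    by rewrite /Normc.normc /= oppr0 sqrrN expr1n expr0n/= addr0 sqrtr1.
  rewrite mul1r => <-; elim: rs {eA hrs} => [|r rs IH]; first by rewrite !big_nil Normc.normc1.
  rewrite !big_cons Normc.normcM IH; congr (_ * _).
  rewrite hornerXsubC sub0r; case: r => x y /=; by rewrite !sqrrN.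
have szrs : size rs = d.+1.
  by have := size_char_poly A; rewrite eA size_prod_XsubC => -[].
have det1 : 1 < normc (\det A).
  rewrite detA; case: rs szrs hrs {eA detA} => //= r rs _ /andP[r1 hrs]; rewrite big_cons.
  suff : 1 <= \prod_(j <- rs) normc j by move=> h; apply: lt_le_trans r1 _; rewrite ler_peMr ?normc_ge0.
  elim: rs hrs => [|s rs IH] /=; first by rewrite big_nil.
  by move=> /andP[s1 hrs]; rewrite big_cons; apply: mulr_ege1; [exact: ltW|exact: IH].
have uA : A \is a GRing.unit.
  rewrite -[_ \is a _]/(A \in unitmx) unitmxE unitfE.
  by apply: contraTneq det1 => ->; rewrite Normc.normc0 -leNgt ler01.
split => //; apply: (factors_vanishing uA hrs).
have := Cayley_Hamilton A; rewrite eA rmorph_prod /= => CH.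
have -> : \prod_(r <- rs) (A - r%:M) = 0.
  rewrite -[RHS]CH; apply: eq_bigr => r _.
  by rewrite rmorphB /= horner_mx_X horner_mx_C.
move=> e e0; exists 0%N => n _; rewrite mul0r /sumnorm big1// => i _.
by rewrite big1// => j _; rewrite mxE Normc.normc0.
Qed.

End ComplexMatrix.

Section RealMatrix.
Variables (R : realType) (d : nat).

(** Entrywise l1 norm; it bounds the operator norm for the sup norm. *)
Definition opsum (M : 'M[R]_d.+1) : R := \sum_i \sum_j `|M i j|.

Lemma opsum_ge0 M : 0 <= opsum M.
Proof. by do 2!(apply: sumr_ge0 => ? _). Qed.

Lemma coord_le_norm (x : 'cV[R]_d.+1) i : `|x i 0| <= `|x|.
Proof.
rewrite /Num.Def.normr /= mx_normrE.
exact: (le_bigmax _ (fun ij : _ * _ => `|x ij.1 ij.2|) (i, 0)).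
Qed.

Lemma norm_le_coord (x : 'cV[R]_d.+1) c : 0 <= c -> (forall i, `|x i 0| <= c) -> `|x| <= c.
Proof.
move=> c0 h; rewrite /Num.Def.normr /= mx_normrE; apply/bigmax_leP; split => // -[i j] _ /=.
by rewrite ord1.
Qed.

Lemma norm_mulmx (M : 'M[R]_d.+1) (x : 'cV[R]_d.+1) : `|M *m x| <= opsum M * `|x|.
Proof.
apply: norm_le_coord => [|i]; first by rewrite mulr_ge0// opsum_ge0.
rewrite mxE; apply: le_trans (ler_norm_sum _ _ _) _.
apply: (@le_trans _ _ ((\sum_j `|M i j|) * `|x|)).
  rewrite mulr_suml; apply: ler_sum => j _.
  by rewrite normrM ler_wpM2l// coord_le_norm.
rewrite ler_wpM2r// /opsum [leRHS](bigD1 i)//= lerDl.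
by do 2!(apply: sumr_ge0 => ? _).
Qed.

Variable A : 'M[int]_d.+1.
Hypothesis hA : expanding R A.
Local Notation AR := (rmx R A).

Lemma map_rmx : map_mx (real_complex R) AR = map_mx intr A.
Proof. by rewrite /rmx -map_mx_comp; apply/matrixP => i j; rewrite !mxE /= rmorph_int. Qed.

Lemma normc_real (x : R) : Normc.normc x%:C%C = `|x|.
Proof. by rewrite /Normc.normc /= expr0n/= addr0 sqrtr_sqr. Qed.

Let hA' : forall r, eigenvalue (map_mx (real_complex R) AR) r -> 1 < Normc.normc r.
Proof. by move=> r; rewrite map_rmx => /hA; rewrite norm_normc -[1]/(1%:C%C) ltcR. Qed.

Lemma expanding_unit : AR \is a GRing.unit.
Proof.
have [u _ _] := expanding_powers hA'.
by move: u; rewrite -[_ \is a _]/(_ \in unitmx) map_unitmx.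
Qed.

Lemma expanding_det : 1 < det_mod R A.
Proof.
have [_ h _] := expanding_powers hA'.
by move: h; rewrite det_map_mx normc_real.
Qed.

Lemma expanding_inv : vanishing (fun k => opsum (AR^-1 ^+ k)).
Proof.
have [_ _ van] := expanding_powers hA'.
move=> e /van[n0 hn]; exists n0 => n /hn.
suff -> : sumnorm ((map_mx (real_complex R) AR)^-1 ^+ n) = opsum (AR^-1 ^+ n) by [].
have -> : (map_mx (real_complex R) AR)^-1 ^+ n = map_mx (real_complex R) (AR^-1 ^+ n).
  rewrite rmorphXn /=; congr (_ ^+ n); exact/esym/map_invmx.
by apply: eq_bigr => i _; apply: eq_bigr => j _; rewrite mxE normc_real.
Qed.

End RealMatrix.

(** * Chains of small steps in a totally disconnected compact set *)

Section CompactUniformity.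
Variables (R : realType) (W : normedModType R).
Implicit Types (K X : set W).

(** The parameter of [Q] is at once the bound and the radius on which it is
    known, so that a single monotone quantity has to be minimized. *)
Lemma compact_uniform K (Q : R -> W -> Prop) : compact K ->
  (forall c c' x, c <= c' -> Q c' x -> Q c x) ->
  (forall x, K x -> exists2 e, 0 < e & forall y, K y -> `|x - y| < e -> Q e y) ->
  exists2 c, 0 < c & forall x, K x -> Q c x.
Proof.
move=> /compact_near_coveringP cK mono loc.
have H : \forall c \near (0 : R)^'+, K `<=` [set y | K y -> Q c y].
  apply: cK => x Kx; have [e e0 low] := loc x Kx.
  exists (ball x e, [set c' : R | c' <= e]); first split => /=.
  - exact: nbhsx_ballx.
  - exact: nbhs_right_le.
  - move=> [y c'] /= [xy c'c] Ky; apply: mono c'c _; apply: low => //.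
    by move: xy; rewrite -ball_normE.
have /filter_ex[c [c0 cf]] : \forall c \near (0 : R)^'+, 0 < c /\ K `<=` [set y | K y -> Q c y].
  by near=> c; split; [near: c; exact: nbhs_right_gt|near: c].
by exists c => // x Kx; apply: cf.
Unshelve. all: by end_near. Qed.

Lemma compact_closed_dist K (F : set W) : compact K -> closed F -> K `&` F = set0 ->
  exists2 c, 0 < c & forall x y, K x -> F y -> c <= `|x - y|.
Proof.
move=> cK cF KF0.
have [||c c0 h] := @compact_uniform K (fun c x => forall y, F y -> c <= `|x - y|) cK.
- by move=> c c' x cc' h y /h; exact: le_trans.
- move=> x Kx; have : nbhs x (~` F).
    apply: open_nbhs_nbhs; split; first exact: closed_openC.
    by move=> Fx; rewrite -[False]/(set0 x) -KF0.
  move=> /nbhs_ballP[e /= e0 he]; exists (e / 2); first by rewrite divr_gt0.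
  move=> y Ky xy z Fz; rewrite leNgt; apply/negP => yz.
  apply: (he z) => //; rewrite -ball_normE /= (splitr e).
  by rewrite -(subrK y x) -addrA; apply: le_lt_trans (ler_normD _ _) _; rewrite ltrD.
by exists c => // x y Kx; exact: h.
Qed.

Lemma nested_compact K (F : nat -> set W) : compact K ->
  (forall n, closed (F n)) -> (forall n, F n `<=` K) -> (forall n, F n !=set0) ->
  (forall n m, (n <= m)%N -> F m `<=` F n) -> exists p, forall n, F n p.
Proof.
move=> cK clF FK F0 mono.
have [u Fu] := choice F0.
have [|p [Kp clp]] := cK (u @ \oo) _.
  by exists 0%N => // n _ /=; apply: FK; exact: Fu.
exists p => n; apply: clF => B /(clp (F n)); apply.
by exists n => // m /= nm; apply: mono nm _ _; exact: Fu.
Qed.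

Section Chains.
Variable X : set W.
Hypothesis cX : compact X.
Let clX : closed X. Proof. exact: compact_closed (@norm_hausdorff _ _) cX. Qed.

(** [chain_set x e] is what chains from [x] in [X] with steps shorter than [e]
    can reach, described by minimality instead of by the chains. *)
Definition step_closed e (U : set W) := forall y z, U y -> X z -> `|y - z| < e -> U z.
Definition chain_set x e : set W := [set z | forall U, U x -> step_closed e U -> U z].

Lemma chain_set_refl x e : chain_set x e x. Proof. by []. Qed.

Lemma chain_set_sub x e : X x -> chain_set x e `<=` X.
Proof. by move=> Xx z; apply. Qed.

Lemma chain_set_step x e : step_closed e (chain_set x e).
Proof. by move=> y z xy Xz yz U Ux sU; apply: (sU y) => //; exact: xy. Qed.

Lemma chain_set_mono x e e' : e <= e' -> chain_set x e `<=` chain_set x e'.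
Proof.
move=> ee' z xz U Ux sU; apply: xz => // y t Uy Xt yt; apply: sU Uy Xt _.
exact: lt_le_trans ee'.
Qed.

Lemma chain_set_closed x e : X x -> 0 < e -> closed (chain_set x e).
Proof.
move=> Xx e0 p clp; have Xp : X p.
  by apply: clX => B /clp[q [/(chain_set_sub Xx) Xq Bq]]; exists q.
have [q [xq]] := clp _ (nbhsx_ballx p e e0); rewrite -ball_normE /= => pq.
by apply: chain_set_step xq Xp _; rewrite distrC.
Qed.

(** In a compact set, this is the connected component of [x]. *)
Definition quasi x : set W := \bigcap_n chain_set x n.+1%:R^-1.

Lemma quasi_meets x (M : set W) : X x -> closed M ->
  (forall e, 0 < e -> chain_set x e `&` M !=set0) -> quasi x `&` M !=set0.
Proof.
move=> Xx clM meets.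
have [|||| p hp] := @nested_compact X (fun n => chain_set x n.+1%:R^-1 `&` M) cX.
- by move=> n; apply: closedI => //; exact: chain_set_closed.
- by move=> n z [/(chain_set_sub Xx)].
- by move=> n; exact: meets.
- move=> n m nm z [xz Mz]; split => //; apply: chain_set_mono xz.
  by rewrite lef_pV2 ?posrE// ler_nat.
by exists p; split; [move=> n _; have [] := hp n|have [] := hp 0%N].
Qed.

Lemma quasi_closed x : X x -> closed (quasi x).
Proof. by move=> Xx; apply: closed_bigI => n _; exact: chain_set_closed. Qed.

Lemma quasi_sub x : X x -> quasi x `<=` X.
Proof. by move=> Xx z /(_ 0%N I); exact: chain_set_sub. Qed.

(** Two far apart closed parts of the quasi-component of [x] leave a gap, that
    chains of small steps would have to cross. *)
Lemma quasi_unsplittable x (P P' : set W) : X x -> closed P -> closed P' ->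
  P `&` P' = set0 -> quasi x = P `|` P' -> P x -> P' = set0.
Proof.
move=> Xx clP clP' PP' qE Px; apply/eqP; apply: contrapT => /negP/set0P[z P'z].
have cP : compact P.
  apply: (subclosed_compact clP cX) => y Py; apply: (quasi_sub Xx).
  by rewrite qE; left.
have [c c0 hc] := compact_closed_dist cP clP' PP'.
pose e0 := c / 3; have e00 : 0 < e0 by rewrite divr_gt0.
pose U := [set u : W | exists2 p, P p & `|u - p| < e0].
pose U' := [set u : W | exists2 p, P' p & `|u - p| < e0].
have openU (Q : set W) : open [set u : W | exists2 p, Q p & `|u - p| < e0].
  rewrite (_ : [set u | _] = \bigcup_(p in Q) ball p e0).
    by apply: bigcup_open => p _; exact: ball_open.
  by apply/seteqP; split=> u [p Qp up]; exists p => //; move: up; rewrite -ball_normE /= distrC.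
have [u [qu [nU nU']]] : quasi x `&` (~` U `&` ~` U') !=set0.
  apply: quasi_meets => //; first by apply: closedI; apply: open_closedC; exact: openU.
  move=> e e_gt0; apply: contrapT => no.
  pose e1 := Num.min e e0.
  have e10 : 0 < e1 by rewrite lt_min e_gt0.
  have sub1 : chain_set x e1 `<=` U `|` U'.
    move=> y xy; apply: contrapT => /not_orP[nU nU']; apply: no; exists y.
    by split => //; apply: chain_set_mono xy; rewrite ge_min lexx.
  have far u v : U u -> U' v -> `|u - v| < e0 -> False.
    move=> [p Pp up] [p' P'p' vp'] uv; have := hc _ _ Pp P'p'; rewrite leNgt => /negP; apply.
    have -> : p - p' = (p - u) + (u - v) + (v - p') by rewrite !addrA !subrK.
    apply: le_lt_trans (ler_normD _ _) _.
    apply: le_lt_trans (lerD (ler_normD _ _) (lexx _)) _.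
    by rewrite distrC; move: up uv vp'; rewrite /e0; lra.
  have Uz : U z.
    have : quasi x z by rewrite qE; right.
    have [|k kh] := @ltr_add_invr R 0 e1; first by [].
    rewrite add0r in kh.
    move=> /(_ k I) /(chain_set_mono (ltW kh)) /(_ (U `&` chain_set x e1)) [] //.
      by split; [exists x => //; rewrite subrr normr0|].
    move=> s t [Us xs] Xt st; have xt := chain_set_step xs Xt st; split => //.
    have [//|U't] := sub1 t xt; case: (far s t Us U't).
    by apply: lt_le_trans st _; rewrite ge_min lexx orbT.
  apply: (far z z Uz); last by rewrite subrr normr0.
  by exists z => //; rewrite subrr normr0.
move: qu; rewrite qE => -[Pu|P'u]; [apply: nU|apply: nU'];
  by exists u => //; rewrite subrr normr0.
Qed.

Lemma quasi_connected x : X x -> connected (quasi x).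
Proof.
move=> Xx B [b Bb] [G oG BG] [F cF BF].
have clq := quasi_closed Xx.
have clB : closed B by rewrite BF; exact: closedI.
have clB' : closed (quasi x `\` B).
  rewrite (_ : _ `\` _ = quasi x `&` ~` G); first by apply: closedI => //; exact: open_closedC.
  apply/seteqP; split => [z [qz nB]|z [qz nG]]; split => //; first by move=> Gz; apply: nB; rewrite BG.
  by rewrite BG => -[].
have Bq : B `<=` quasi x by rewrite BG => z [].
have qBB' : quasi x = B `|` (quasi x `\` B).
  apply/seteqP; split=> [z qz|z [/Bq|[]]] //.
  by have [Bz|nBz] := pselect (B z); [left|right].
have dis : B `&` (quasi x `\` B) = set0 by apply/seteqP; split => // z [Bz [_]].
have [Bx|nBx] := pselect (B x).
  have e := quasi_unsplittable Xx clB clB' dis qBB' Bx.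
  by rewrite [RHS]qBB' e setU0.
have B'x : (quasi x `\` B) x by split => // n _; exact: chain_set_refl.
have := quasi_unsplittable Xx clB' clB _ _ B'x; rewrite setIC setUC => /(_ dis qBB') B0.
by move: Bb; rewrite B0.
Qed.

Hypothesis tdX : totally_disconnected X.

(** In a totally disconnected compact set, chains of small enough steps stay
    in a small ball, uniformly in their origin. *)
Theorem totally_disconnected_chains r : 0 < r -> exists2 e, 0 < e &
  forall x, X x -> chain_set x e `<=` [set y | `|x - y| < r].
Proof.
move=> r0; apply: compact_uniform => //.
  by move=> c c' x cc' h y /(chain_set_mono cc')/h.
move=> x Xx.
have [e e0 he] : exists2 e, 0 < e & chain_set x e `<=` [set y | `|x - y| < r / 2].
  apply: contrapT => no.
  have [y [qy /= far]] : quasi x `&` [set y | r / 2 <= `|x - y|] !=set0.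
    apply: quasi_meets => //.
      rewrite (_ : [set y | _] = ~` ball x (r / 2)).
        by apply: open_closedC; apply: ball_open; rewrite divr_gt0.
      by apply/seteqP; split => y /=; rewrite -ball_normE /= leNgt => /negP.
    move=> e e0; apply: contrapT => no'; apply: no; exists e => // y xy /=.
    by rewrite ltNge; apply/negP => far; apply: no'; exists y.
  have : connected_component X x y.
    apply: (@connected_component_max _ _ (quasi x)) => //.
    - by move=> n _; exact: chain_set_refl.
    - exact: quasi_sub.
    - exact: quasi_connected.
  rewrite tdX// => /= yx; move: far; rewrite yx subrr normr0 leNgt.
  by rewrite divr_gt0.
exists (Num.min e (r / 2)); first by rewrite lt_min e0 divr_gt0.
move=> y Xy; rewrite lt_min => /andP[xye xyr] z yz /=.
have xz : chain_set x e z.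
  have xx : chain_set x e x by [].
  have xy : chain_set x e y by exact: (chain_set_step xx Xy xye).
  move=> U Ux sU; apply: yz; first exact: xy.
  by move=> s t Us Xt st; apply: sU Us Xt _; apply: lt_le_trans st _; rewrite ge_min lexx.
have := he z xz => /= xzr.
rewrite -(subrK x y) -addrA; apply: le_lt_trans (ler_normD _ _) _.
by rewrite distrC (splitr r) ltrD.
Qed.

End Chains.
End CompactUniformity.

(** * Integrals of functions without measurability *)

Section SphereNull.
Variables (R : realType).
Local Notation TR := (measurableTypeR R).

Lemma measurable_sqdist n (b : 'I_n -> R) :
  measurable_fun [set: n.-tuple TR] (fun t => \sum_(i < n) (b i - tnth t i) ^+ 2).
Proof.
apply: measurable_sum => i; apply: measurable_funX; apply: measurable_funB => //.
exact: measurable_tnth.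
Qed.

(** A line parallel to the first axis meets a sphere in at most two points. *)
Lemma sphere_null n (b : 'I_n.+1 -> R) :
  lebesgue_tuple R n.+1 [set t | \sum_(i < n.+1) (b i - tnth t i) ^+ 2 = 1] = 0%E.
Proof.
set S := [set t | _].
have mS : measurable S.
  rewrite (_ : S = setT `&` (fun t : n.+1.-tuple TR => \sum_(i < n.+1) (b i - tnth t i) ^+ 2) @^-1` [set 1]).
    by apply: measurable_sqdist => //; exact: measurable_set1.
  by rewrite setTI.
pose B : set (TR * n.-tuple TR) := @tuple_consT R n @^-1` S.
have mB : measurable B.
  by rewrite -[B]setTI; exact: (measurable_tuple_consT measurableT mS).
have -> : lebesgue_tuple R n.+1 S = (lebesgue_measure \x lebesgue_tuple R n)%E B by [].
rewrite (@product_measure_unique _ _ _ _ R lebesgue_measure (lebesgue_tuple R n)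
  (product_measure2 lebesgue_measure (lebesgue_tuple R n)))//; last first.
  by move=> X Y mX mY; exact: product_measure2E.
rewrite /product_measure2; apply: integral0_eq => t _ /=.
apply: countable_lebesgue_measure0.
pose c := 1 - \sum_(i < n) (b (lift ord0 i) - tnth t i) ^+ 2.
apply: (@sub_countable _ _ _ [set b ord0 - Num.sqrt c; b ord0 + Num.sqrt c]); last first.
  by apply: finite_set_countable; exact: finite_set2.
apply/subset_card_le => a; rewrite /ysection /= inE /B /S /= big_ord_recl.
have -> : tnth (tuple_consT (a, t)) ord0 = a by [].
rewrite (eq_bigr (fun i => (b (lift ord0 i) - tnth t i) ^+ 2)); last first.
  by move=> i _; rewrite tnthS.
move=> /(canRL (addrK _)); rewrite -/c => e.
have ec : Num.sqrt c = `|b ord0 - a| by rewrite -e sqrtr_sqr.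
rewrite ec; case: (ger0P (b ord0 - a)) => _; [left|right]; ring.
Qed.

End SphereNull.

(** The integral of a nonnegative function is a supremum over the simple
    functions below it, which gives monotonicity and the existence of plateaus
    for arbitrary functions. *)
Section RoughIntegral.
Context d (T : measurableType d) (R : realType).
Variable mu : {measure set T -> \bar R}.
Implicit Types f g : T -> R.
Import HBNNSimple.

Lemma le_integral_nonmeasurable f g : (forall t, 0 <= f t) -> (forall t, f t <= g t) ->
  (\int[mu]_t (f t)%:E <= \int[mu]_t (g t)%:E)%E.
Proof.
move=> f0 fg; have g0 t : 0 <= g t by apply: le_trans (f0 t) (fg t).
rewrite !ge0_integralTE//; try by move=> t; rewrite lee_fin.
apply: ereal_sup_le => _ [h /= hf <-]; exists h => //= t.
by apply: le_trans (hf t) _; rewrite lee_fin.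
Qed.

Lemma integral_gt0_plateau f : (forall t, 0 <= f t) -> (0 < \int[mu]_t (f t)%:E)%E ->
  exists S v, [/\ measurable S, 0 < v, (0 < mu S)%E & forall t, S t -> v <= f t].
Proof.
move=> f0; rewrite ge0_integralTE; last by move=> t; rewrite lee_fin.
move=> /ereal_sup_gt[_ [h /= hf <-]]; rewrite sintegralEnnsfun => pos.
apply: contrapT => no; move: pos; rewrite fsbig1 ?ltxx// => v /= v0.
suff -> : mu (h @^-1` [set v]) = 0%E by rewrite mule0.
apply/eqP; rewrite eq_le measure_ge0 andbT leNgt; apply/negP => muv.
apply: no; exists (h @^-1` [set v]), v; split => //.
by move=> t /= <-; rewrite -lee_fin.
Qed.

Lemma plateau_le_integral f S v : measurable S -> 0 <= v -> (forall t, 0 <= f t) ->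
  (forall t, S t -> v <= f t) -> (v%:E * mu S <= \int[mu]_t (f t)%:E)%E.
Proof.
move=> mS v0 f0 Sf.
have -> : (v%:E * mu S = \int[mu]_t (v * \1_S t)%:E)%E.
  under eq_integral do rewrite EFinM.
  rewrite ge0_integralZl_EFin//; first by rewrite integral_indic// setIT.
  by apply/measurable_EFinP; exact: measurable_indic.
apply: le_integral_nonmeasurable => t; rewrite indicE.
  by rewrite mulr_ge0.
by have [/set_mem tS|_] := boolP (t \in S); rewrite ?mulr1 ?mulr0// Sf.
Qed.

End RoughIntegral.

(** * The smoothed annulus *)

Section Smoothed.
Variables (R : realType) (d : nat) (A : 'M[int]_d.+1) (hA : expanding R A).
Variables (eps0 : R) (heps0 : 0 < eps0 < 1 / 2) (phi : 'cV[R]_d.+1 -> R).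
Hypothesis hphi : mollifier eps0 phi.
Local Notation AR := (rmx R A).
Local Notation V := (annulus A).
Local Notation h := (smoothed_annulus A phi).
Local Notation TR := (measurableTypeR R).
Local Notation mu := (lebesgue_tuple R d.+1).
Local Notation n := (d.+1%:R : R).

Definition sqlen (x : 'cV[R]_d.+1) : R := \sum_(i < d.+1) x i 0 ^+ 2.

Lemma sqlen_ge0 x : 0 <= sqlen x.
Proof. by apply: sumr_ge0 => i _; exact: sqr_ge0. Qed.

Lemma eucl_ball1E x : eucl_ball d.+1 1 x <-> sqlen x < 1.
Proof.
rewrite /eucl_ball /= -/(sqlen x); split => H.
  by rewrite -[sqlen x]sqr_sqrtr ?sqlen_ge0// expr_lt1// sqrtr_ge0.
by rewrite -sqrtr1 ltr_sqrt.
Qed.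

Lemma coord_sq_le (x : 'cV[R]_d.+1) i : x i 0 ^+ 2 <= sqlen x.
Proof. by rewrite /sqlen (bigD1 i)//= lerDl sumr_ge0// => j _; exact: sqr_ge0. Qed.

Lemma norm_lt1 (x : 'cV[R]_d.+1) : sqlen x <= 1 -> `|x| <= 1.
Proof.
move=> h1; apply: norm_le_coord => // i.
rewrite -(@expr_le1 _ 2)//; apply: le_trans h1.
by rewrite real_normK ?num_real//; exact: coord_sq_le.
Qed.

Lemma sqlen_le (x : 'cV[R]_d.+1) c : 0 <= c -> `|x| <= c -> sqlen x <= n * c ^+ 2.
Proof.
move=> c0 xc; rewrite /sqlen -[n]/((d.+1)%:R) mulr_natl -[X in _ *+ X](card_ord d.+1) -sumr_const.
apply: ler_sum => i _; rewrite -real_normK ?num_real//.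
by rewrite ler_sqr ?nnegrE// (le_trans (coord_le_norm _ _)).
Qed.

Lemma annulusE z : V z <-> sqlen (AR^-1 *m z) < 1 /\ 1 <= sqlen z.
Proof.
have uA := expanding_unit hA.
rewrite /annulus /setD /=; split.
  move=> [[v /eucl_ball1E v1 <-] nz]; split.
    by rewrite mulmxA -[_ *m AR]/(AR^-1 * AR) mulVr// mul1mx.
  by rewrite leNgt; apply/negP => /eucl_ball1E.
move=> [z1 z2]; split; last by move=> /eucl_ball1E; rewrite ltNge z2.
exists (AR^-1 *m z); first exact/eucl_ball1E.
by rewrite mulmxA -[AR *m _]/(AR * AR^-1) mulrV// mul1mx.
Qed.

Definition point_of (t : d.+1.-tuple TR) : 'cV[R]_d.+1 := \col_i tnth t i.
Definition integrand x (t : d.+1.-tuple TR) : R := \1_V (x - point_of t) * phi (point_of t).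

Lemma integrand_ge0 x t : 0 <= integrand x t.
Proof. by rewrite mulr_ge0// (mollifier_ge0 hphi). Qed.

Lemma integrand_le x t : integrand x t <= phi (point_of t).
Proof.
rewrite /integrand indicE; case: (_ \in _); rewrite ?mul1r// mul0r.
exact: mollifier_ge0 hphi _.
Qed.

Lemma smoothedE x : h x = fine (\int[mu]_t (integrand x t)%:E).
Proof. by []. Qed.

Lemma integral_phi : (\int[mu]_t (phi (point_of t))%:E = 1)%E.
Proof.
have := mollifier_int hphi; rewrite /integral_Rn /Rintegral -/(point_of _).
by case: (\int[_]_(_ in _) _)%E => [r /= ->//| /= /esym/eqP|/= /esym/eqP]; rewrite oner_eq0.
Qed.

Lemma integrand_le1 x : (\int[mu]_t (integrand x t)%:E <= 1)%E.
Proof.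
rewrite -integral_phi; apply: le_integral_nonmeasurable => t.
  exact: integrand_ge0.
exact: integrand_le.
Qed.

Lemma integrand_int_ge0 x : (0 <= \int[mu]_t (integrand x t)%:E)%E.
Proof. by apply: integral_ge0 => t _; rewrite lee_fin integrand_ge0. Qed.

Lemma smoothed_fin x : (\int[mu]_t (integrand x t)%:E)%E = (h x)%:E.
Proof.
rewrite smoothedE fineK// ge0_fin_numE ?integrand_int_ge0//.
exact: le_lt_trans (integrand_le1 x) (ltry _).
Qed.

Lemma smoothed_ge0 x : 0 <= h x.
Proof. by rewrite -lee_fin -smoothed_fin integrand_int_ge0. Qed.

Lemma smoothed_le1 x : h x <= 1.
Proof. by rewrite -lee_fin -smoothed_fin integrand_le1. Qed.

Lemma phi_supp y : phi y != 0 -> sqlen y < 1 / 4.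
Proof.
move=> py; have /(mollifier_supp hphi) : closure [set x | phi x != 0] y.
  exact: subset_closure.
rewrite /eucl_ball /= -/(sqlen y) => H; rewrite -[sqlen y]sqr_sqrtr ?sqlen_ge0//.
have /andP[e0 e1] := heps0.
have -> : 1 / 4 = (1 / 2 : R) ^+ 2 by lra.
rewrite ltr_sqr ?nnegrE ?sqrtr_ge0//; exact: lt_trans e1.
Qed.

(** If [h x] is not zero then [x - y] lies in the annulus for some [y] of
    Euclidean length less than 1/2. As [x - y] is in the image of the unit ball,
    [x] is bounded; as [x - y] is outside the unit ball, [x] cannot be close to
    the origin. *)
Lemma smoothed_supp : exists a b : R, 0 < a /\ forall x, h x != 0 -> a <= `|x| <= b.
Proof.
exists (1 / (4 * n)), (1 + opsum AR); split; first by rewrite divr_gt0// mulr_gt0.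
move=> x hx.
have [t] : exists t, integrand x t != 0.
  apply: contrapT => no; move/eqP: hx; apply; rewrite smoothedE.
  rewrite integral0_eq// => t _; congr EFin; apply/eqP; apply: contrapT => /negP ne.
  by apply: no; exists t.
rewrite /integrand mulf_eq0 negb_or indicE => /andP[+ /phi_supp y1].
have [/set_mem/annulusE[z1 z2] _|_] := boolP (_ \in _); last by rewrite eqxx.
set y := point_of t in y1 z1 z2 *.
have y11 : `|y| <= 1 by apply: norm_lt1; apply: ltW (lt_le_trans y1 _); lra.
apply/andP; split; last first.
  have -> : x = y + AR *m (AR^-1 *m (x - y)).
    rewrite mulmxA -[AR *m _]/(AR * AR^-1) mulrV ?expanding_unit// mul1mx addrC; apply/esym; exact: subrK.
  apply: le_trans (ler_normD _ _) _; apply: lerD => //.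
  apply: le_trans (norm_mulmx _ _) _; rewrite -[leRHS]mulr1 ler_wpM2l ?opsum_ge0//.
  by apply: norm_lt1; exact: ltW.
rewrite leNgt; apply/negP => xa; move: z2; rewrite leNgt => /negP; apply.
set a := 1 / (4 * n) in xa.
have n0 : 0 < n by [].
have n1 : 1 <= n by rewrite ler1n.
have a0 : 0 < a by rewrite divr_gt0// mulr_gt0.
have na : n * a = 1 / 4 by rewrite /a !div1r invfM mulrCA mulfV ?gt_eqF// mulr1.
have sx := sqlen_le (ltW a0) (ltW xa).
have -> : sqlen (x - y) = sqlen x + sqlen y - 2 * \sum_(i < d.+1) x i 0 * y i 0.
  rewrite /sqlen mulr_sumr -big_split -sumrB /=; apply: eq_bigr => i _.
  rewrite !mxE; ring.
have : - (\sum_(i < d.+1) x i 0 * y i 0) <= n * a.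
  rewrite -sumrN /n mulr_natl -[X in _ *+ X](card_ord d.+1) -sumr_const.
  apply: ler_sum => i _; apply: le_trans (ler_norm _) _; rewrite normrN normrM.
  rewrite -[leRHS]mulr1 ler_pM//; first exact: le_trans (coord_le_norm _ _) (ltW xa).
  exact: le_trans (coord_le_norm _ _) y11.
rewrite na.
have : n * a ^+ 2 <= 1/16.
  have -> : n * a ^+ 2 = a / 4 by rewrite expr2 mulrA na; ring.
  have : a <= 1 / 4 by rewrite -na ler_peMl// ltW.
  lra.
lra.
Qed.

Lemma sqlen_perturb (u v : 'cV[R]_d.+1) M e : `|u| <= M -> `|v| <= e ->
  `|sqlen (u + v) - sqlen u| <= n * (2 * M * e + e ^+ 2).
Proof.
move=> uM ve; rewrite /sqlen -sumrB; apply: le_trans (ler_norm_sum _ _ _) _.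
rewrite /n [leRHS]mulr_natl -[X in _ *+ X](card_ord d.+1) -sumr_const.
apply: ler_sum => i _; rewrite mxE.
have -> : (u i 0 + v i 0) ^+ 2 - u i 0 ^+ 2 = 2 * u i 0 * v i 0 + v i 0 ^+ 2 by ring.
have ui := le_trans (coord_le_norm u i) uM; have vi := le_trans (coord_le_norm v i) ve.
apply: le_trans (ler_normD _ _) _; rewrite normrX 2!normrM (ger0_norm (ler0n _ 2)).
apply: lerD; first by rewrite ler_pM// ?mulr_ge0// ler_wpM2l.
by rewrite lerXn2r ?nnegrE// (le_trans _ vi).
Qed.

Lemma measurable_sqlen_mul (B : 'M[R]_d.+1) x :
  measurable_fun [set: d.+1.-tuple TR] (fun t => sqlen (B *m (x - point_of t))).
Proof.
apply: measurable_sum => i; apply: measurable_funX.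
rewrite (_ : (fun _ => _) = fun t : d.+1.-tuple TR => \sum_j B i j * (x j 0 - tnth t j)); last first.
  by apply/funext => t; rewrite mxE; apply: eq_bigr => j _; rewrite !mxE.
apply: measurable_sum => j; apply: measurable_funM => //.
by apply: measurable_funB => //; exact: measurable_tnth.
Qed.

(** Positivity of [h] is an open condition, with a uniform lower bound: the
    points that contribute to [h x] may be taken at a positive distance from
    the boundary of the annulus, the unit sphere being negligible. *)
Lemma smoothed_lower_bound x : 0 < h x ->
  exists c e, [/\ 0 < c, 0 < e & forall x', `|x' - x| <= e -> c <= h x'].
Proof.
move=> hx; have : (0 < \int[mu]_t (integrand x t)%:E)%E by rewrite smoothed_fin lte_fin.
move=> /(integral_gt0_plateau (integrand_ge0 x))[S [v [mS v0 muS Sv]]].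
pose F1 t := sqlen (x - point_of t); pose F2 t := sqlen (AR^-1 *m (x - point_of t)).
have mF1 : measurable_fun setT F1.
  by have := measurable_sqlen_mul 1%:M x; under eq_fun do rewrite mul1mx.
have mF2 : measurable_fun setT F2 by exact: measurable_sqlen_mul.
have SV t : S t -> [/\ F2 t < 1, 1 <= F1 t & v <= phi (point_of t)].
  move=> /Sv vt; have vp := le_trans vt (integrand_le x t).
  move: vt; rewrite /integrand indicE.
  have [/set_mem/annulusE[z1 z2] _|_] := boolP (_ \in _); first by [].
  by rewrite mul0r leNgt v0.
pose S_ k := S `&` (F1 @^-1` `[1 + k.+1%:R^-1, +oo[ `&` F2 @^-1` `]-oo, 1 - k.+1%:R^-1]).
have mS_ k : measurable (S_ k).
  apply: measurableI => //; apply: measurableI.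
    by rewrite -[X in measurable X]setTI; exact: mF1.
  by rewrite -[X in measurable X]setTI; exact: mF2.
have [k muk] : exists k, (0 < mu (S_ k))%E.
  apply: contrapT => no; move: muS; apply/negP; rewrite -leNgt.
  have mu0 k : mu (S_ k) = 0%E.
    apply/eqP; rewrite eq_le measure_ge0 andbT leNgt; apply/negP => ?; apply: no; by exists k.
  have neg : mu.-negligible S.
    apply: (@negligibleS _ _ _ mu ([set t : d.+1.-tuple TR | \sum_(i < d.+1) (x i 0 - tnth t i) ^+ 2 = 1] `|` \bigcup_k S_ k)).
      move=> t St; have [f2 f1 _] := SV t St.
      have [e1|ne1] := eqVneq (F1 t) 1.
        by left; rewrite /= -{}e1; apply: eq_bigr => i _; rewrite !mxE.
      right; have f1' : 1 < F1 t by rewrite lt_neqAle eq_sym ne1.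
      have [|k kh] := @ltr_add_invr R 0 (Num.min (F1 t - 1) (1 - F2 t)).
        by rewrite lt_min !subr_gt0 f1'.
      move: kh; rewrite add0r lt_min => /andP[k1 k2].
      exists k => //; split => //; split; rewrite /= in_itv /= ?andbT.
        by rewrite addrC -lerBrDr ltW.
      by rewrite lerBrDr addrC -lerBrDr ltW.
    apply: negligibleU; last by apply: negligible_bigcup => k; exists (S_ k); split => //; exact: mu0.
    apply/negligibleP; last exact: sphere_null (fun i => x i 0).
    rewrite -[X in measurable X]setTI.
    exact: (measurable_sqdist (fun i => x i 0) measurableT (measurable_set1 (1 : R))).
  by rewrite (measure_negligible mS neg).
pose g : R := k.+1%:R^-1.
have SkE t : S_ k t -> [/\ S t, 1 + g <= F1 t & F2 t <= 1 - g].
  by move=> [St []]; rewrite /= !in_itv /= andbT.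
have g0 : 0 < g by rewrite invr_gt0.
have g1 : g <= 1 by rewrite invf_le1// ler1n.
have n1 : 1 <= n by rewrite ler1n.
have n0 : 0 < n by [].
have [B0 b0] := (opsum_ge0 AR, opsum_ge0 AR^-1).
set B := opsum AR in B0; set b := opsum AR^-1 in b0.
have q0 : 0 < 1 + B + b by lra.
pose e := g / (4 * n * (1 + B + b)).
have e0 : 0 < e by rewrite divr_gt0// !mulr_gt0.
have ne : n * e * (1 + B + b) = g / 4.
  have nn0 := lt0r_neq0 n0; move: nn0; rewrite /e; move: n => m nn0.
  by field; rewrite nn0 lt0r_neq0.
have ne' : n * e * 1 + n * e * B + n * e * b = g / 4 by rewrite -ne; ring.
have ne0 : 0 < n * e by rewrite mulr_gt0.
have neB : 0 <= n * e * B by rewrite mulr_ge0// ltW.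
have neb : 0 <= n * e * b by rewrite mulr_ge0// ltW.
have le_e : e <= 1 by apply: le_trans (ler_peMl (ltW e0) n1) _; lra.
have le_be : b * e <= 1.
  apply: le_trans (ler_peMl (mulr_ge0 b0 (ltW e0)) n1) _.
  by rewrite [b * e]mulrC mulrA; lra.
have ck : (v%:E * mu (S_ k) <= (h x)%:E)%E.
  rewrite -smoothed_fin; apply: plateau_le_integral => //; first exact: ltW.
    exact: integrand_ge0.
  by move=> t /SkE[St _ _]; exact: Sv.
have ckf : (v%:E * mu (S_ k))%E \is a fin_num.
  rewrite ge0_fin_numE ?mule_ge0 ?lee_fin ?(ltW v0)//.
  exact: le_lt_trans ck (ltry _).
exists (fine (v%:E * mu (S_ k))%E), e; split; [|exact: e0|].
  by rewrite fine_gt0// mule_gt0 ?lte_fin//= -ge0_fin_numE ?mule_ge0 ?lee_fin ?(ltW v0).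
move=> x' x'x; rewrite -lee_fin (fineK ckf) -(smoothed_fin x').
apply: plateau_le_integral => //; [exact: ltW|exact: integrand_ge0|].
move=> t /SkE[St f1 f2]; have [_ _ vp] := SV t St.
suff Vt : V (x' - point_of t) by rewrite /integrand indicE mem_set// mul1r.
have eqx : x' - point_of t = (x - point_of t) + (x' - x) by rewrite addrAC [x + _]addrC subrK.
have nAx : `|AR^-1 *m (x - point_of t)| <= 1 by apply: norm_lt1; apply: le_trans f2 _; lra.
have nx : `|x - point_of t| <= B.
  rewrite -[x - point_of t]mul1mx -[1%:M](mulrV (expanding_unit hA)) -[_ * _]/(_ *m _) -mulmxA.
  apply: le_trans (norm_mulmx _ _) _.
  by rewrite -[leRHS]mulr1 ler_wpM2l.
apply/annulusE; rewrite eqx; split.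
  rewrite mulmxDr.
  have := sqlen_perturb nAx (le_trans (norm_mulmx _ _) (ler_wpM2l b0 x'x)).
  rewrite -/(F2 t); move/(le_trans (ler_norm _)); rewrite lerBlDr => /le_lt_trans; apply.
  have h1 : (b * e) ^+ 2 <= b * e by rewrite expr2 ler_piMl// mulr_ge0// ltW.
  have h2 : n * (2 * 1 * (b * e) + (b * e) ^+ 2) <= 3 * (n * e * b).
    apply: le_trans (ler_wpM2l (ltW n0) (lerD (lexx _) h1)) _.
    by rewrite le_eqVlt; apply/orP; left; apply/eqP; ring.
  lra.
have := sqlen_perturb nx x'x.
rewrite -/(F1 t) distrC => /(le_trans (ler_norm _)).
have h1 : e ^+ 2 <= e by rewrite expr2 ler_piMl// ltW.
have h2 : n * (2 * B * e + e ^+ 2) <= 2 * (n * e * B) + n * e * 1.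
  apply: le_trans (ler_wpM2l (ltW n0) (lerD (lexx _) h1)) _.
  by rewrite le_eqVlt; apply/orP; left; apply/eqP; ring.
move: h2; set z := n * (_ + _); set y := sqlen _; lra.
Qed.

End Smoothed.

(** * Bounds for the pseudo-norm on shells *)

Lemma esumZl (R : realType) (T : choiceType) (S : set T) (r : R) (a : T -> \bar R) :
  0 < r -> (forall i, (0 <= a i)%E) ->
  (\esum_(i in S) (r%:E * a i) = r%:E * \esum_(i in S) a i)%E.
Proof.
move=> r0 a0; rewrite /esum -ereal_sup_pZl//; congr ereal_sup.
apply/seteqP; split => [_ [X XS <-]|_ [_ [X XS <-] <-]] /=.
  by exists (\sum_(i \in X) a i)%E; [exists X|rewrite ge0_mule_fsumr].
by exists X => //; rewrite ge0_mule_fsumr.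
Qed.

Lemma fineZl (R : realType) (r : R) (x : \bar R) : 0 < r ->
  fine (r%:E * x) = r * fine x.
Proof.
by move=> r0; case: x => [x||] //=; rewrite ?gt0_muley ?gt0_muleNy ?lte_fin ?mulr0.
Qed.

Lemma compact_lower_bound (R : realType) (W : normedModType R) (K : set W) (f : W -> R) :
  compact K ->
  (forall x, K x -> exists c e, [/\ 0 < c, 0 < e & forall y, K y -> `|x - y| < e -> c <= f y]) ->
  exists2 c, 0 < c & forall x, K x -> c <= f x.
Proof.
move=> cK loc; apply: (compact_uniform (Q := fun c y => c <= f y)) => //.
  by move=> c c' x cc' /(le_trans cc').
move=> x Kx; have [c [e [c0 e0 low]]] := loc x Kx.
exists (Num.min c e); first by rewrite lt_min c0.
by move=> y Ky; rewrite lt_min => /andP[_ xy]; rewrite ge_min low.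
Qed.

Lemma norm_trmx (R : realType) n (x : 'rV[R]_n.+1) : `|x^T| = `|x|.
Proof.
rewrite /Num.Def.normr /= !mx_normrE; apply/le_anti/andP; split; apply/bigmax_leP; split.
- by apply/bigmax_ge_id.
- by move=> [i j] _ /=; rewrite mxE; exact: (le_bigmax _ (fun ij : _ * _ => `|x ij.1 ij.2|) (j, i)).
- by apply/bigmax_ge_id.
- move=> [i j] _ /=; have -> : x i j = x^T j i by rewrite mxE.
  exact: (le_bigmax _ (fun ij : _ * _ => `|x^T ij.1 ij.2|) (j, i)).
Qed.

Lemma compact_shell (R : realType) n (a b : R) :
  compact [set x : 'rV[R]_n.+1 | a <= `|x| <= b].
Proof.
apply: bounded_closed_compact.
  exists b; split; first exact: num_real.
  by move=> c bc x /= /andP[_ xb]; apply: le_trans xb (ltW bc).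
rewrite (_ : [set x | _] = (fun x : 'rV[R]_n.+1 => `|x|) @^-1` `[a, b]); last first.
  by apply/seteqP; split => x /=; rewrite in_itv.
apply: closed_comp; last exact: itv_closed.
by move=> x _; exact: norm_continuous.
Qed.

Section PseudoNorm.
Variables (R : realType) (d : nat) (A : 'M[int]_d.+1) (hA : expanding R A).
Variables (eps0 : R) (heps0 : 0 < eps0 < 1 / 2) (phi : 'cV[R]_d.+1 -> R).
Hypothesis hphi : mollifier eps0 phi.
Local Notation AR := (rmx R A).
Local Notation w := (pseudo_norm A phi).
Local Notation h := (smoothed_annulus A phi).
Local Notation q := (det_mod R A).
Hypothesis hw : forall x, w x = 0 -> x = 0.

Definition series_coef (k : int) : R := q `^ (- (k%:~R / d.+1%:R)).
Definition ratio : R := q `^ (- (d.+1%:R)^-1).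
Definition series_term x (k : int) : \bar R := (series_coef k * h (AR ^ k *m x))%:E.

Lemma q_gt1 : 1 < q. Proof. exact: expanding_det. Qed.
Lemma q_gt0 : 0 < q. Proof. exact: lt_trans q_gt1. Qed.

Lemma coef_gt0 k : 0 < series_coef k. Proof. by rewrite powR_gt0// q_gt0. Qed.
Lemma ratio_gt0 : 0 < ratio. Proof. by rewrite powR_gt0// q_gt0. Qed.
Lemma ratio_lt1 : ratio < 1.
Proof.
rewrite /ratio powRN invf_lt1 ?powR_gt0 ?q_gt0//.
rewrite -[ltLHS](congr1 (fun f => f (d.+1%:R)^-1) (powR1 R)).
by rewrite gt0_ltr_powR ?invr_gt0 ?nnegrE// ?(ltW q_gt0)// q_gt1.
Qed.

Lemma term_ge0 x k : (0 <= series_term x k)%E.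
Proof. by rewrite lee_fin mulr_ge0 ?(ltW (coef_gt0 _))//; exact: smoothed_ge0 hphi _. Qed.

Lemma coefS k : series_coef (k + 1) = ratio * series_coef k.
Proof.
rewrite /series_coef /ratio -powRD; last by apply/implyP => _; rewrite gt_eqF ?q_gt0.
by congr (_ `^ _); rewrite intrD mulrDl mul1r opprD addrC.
Qed.

Lemma pseudo_norm_ge0 x : 0 <= w x.
Proof. by apply: fine_ge0; apply: esum_ge0 => k _; exact: term_ge0. Qed.

Lemma pseudo_norm_scale x : w x = ratio * w (AR *m x).
Proof.
have uA := expanding_unit hA.
have -> : w (AR *m x) = fine (ratio^-1%:E * \esum_(n in [set: int]) series_term x n)%E.
  congr fine.
  rewrite [X in _ = (_ * X)%E](@reindex_esum _ _ _ setT setT (fun k : int => k + 1) (series_term x)); last first.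
    split => //; first by move=> k l _ _; exact: addIr.
    by move=> k _; exists (k - 1) => //; rewrite subrK.
  rewrite -esumZl ?invr_gt0 ?ratio_gt0//; last by move=> k; exact: term_ge0.
  apply: eq_esum => k _; rewrite /series_term -EFinM coefS; congr EFin.
  rewrite mulmxA -[_ *m AR]/(AR ^ k * AR) exprzDr// expr1z.
  by rewrite !mulrA mulVf ?mul1r// gt_eqF// ratio_gt0.
rewrite fineZl ?invr_gt0 ?ratio_gt0// mulrA mulfV ?mul1r// gt_eqF//.
exact: ratio_gt0.
Qed.

Lemma norm_le_pow (x : 'cV[R]_d.+1) k : `|x| <= opsum (AR^-1 ^+ k) * `|AR ^+ k *m x|.
Proof.
have uA := expanding_unit hA.
have {1}-> : x = AR^-1 ^+ k *m (AR ^+ k *m x).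
  by rewrite mulmxA -[_ *m AR ^+ k]/(_ * _) exprVn mulVr ?unitrX// mul1mx.
exact: norm_mulmx.
Qed.

(** A nonzero term puts [A ^ k x] in the shell that supports [h]. For large
    positive [k] this makes [x] too small, for large negative [k] it makes [x]
    too large. *)
Lemma finitely_many_terms (delta r : R) : 0 < delta -> exists m : nat, forall x (k : int),
  delta <= `|x| <= r -> (m <= `|k|)%N -> h (AR ^ k *m x) = 0.
Proof.
move=> delta0; have [a [b [a0 supp]]] := smoothed_supp hA heps0 hphi.
pose e := Num.min (delta / (`|b| + 1)) (a / (`|r| + 1)).
have e0 : 0 < e by rewrite lt_min !divr_gt0// ltr_wpDl.
have [n0 hn0] := expanding_inv hA e0.
exists n0 => x k /andP[xd xr] hk; apply: contrapT => /eqP /supp /andP[la lb].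
have := hn0 _ hk; rewrite lt_min => /andP[h1 h2].
have [b1 r1] : 0 < `|b| + 1 /\ 0 < `|r| + 1 by split; rewrite ltr_wpDl.
rewrite ltr_pdivlMr// in h1; rewrite ltr_pdivlMr// in h2.
case: k hk la lb h1 h2 => k _ la lb h1 h2.
  have := norm_le_pow x k; apply/negP; rewrite -ltNge.
  apply: lt_le_trans xd; apply: le_lt_trans h1; rewrite ler_wpM2l ?opsum_ge0//.
  by apply: le_trans lb _; apply: le_trans (ler_norm _) _; rewrite lerDl.
move: la; rewrite -[AR ^ Negz k]/(AR ^- k.+1) -exprVn leNgt => /negP; apply.
apply: le_lt_trans (norm_mulmx _ _) _; apply: le_lt_trans h2.
rewrite ler_wpM2l ?opsum_ge0//.
by apply: le_trans xr _; apply: le_trans (ler_norm _) _; rewrite lerDl.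
Qed.

Lemma small_ints_finite (m : nat) : finite_set [set k : int | (`|k| < m)%N].
Proof.
apply: (@sub_finite_set _ _ ((Posz @` `I_m) `|` ((fun i => - Posz i) @` `I_m))).
  move=> k /= km; case: k km => k km; first by left; exists k.
  by right; exists k.+1 => //; rewrite NegzE.
by rewrite finite_setU; split; apply: finite_image; exact: finite_II.
Qed.

Lemma pseudo_norm_upper (delta r : R) : 0 < delta -> exists2 C, 0 < C &
  forall x, delta <= `|x| <= r ->
    (\esum_(k in [set: int]) series_term x k <= C%:E)%E.
Proof.
move=> delta0; have [m hm] := finitely_many_terms r delta0.
set F := [set k : int | (`|k| < m)%N].
have finF : finite_set F by exact: small_ints_finite.
exists (\sum_(k \in F) series_coef k + 1).
  by rewrite ltr_wpDl//; apply: fsumr_ge0 => k _; exact: ltW (coef_gt0 k).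
move=> x xr; apply: (@le_trans _ _ (\esum_(k in F) (series_coef k)%:E)%E).
  rewrite (esum_mkcond F); apply: le_esum => k _; case: ifPn => [_|kF].
    by rewrite lee_fin; apply: ler_piMr; [exact: ltW (coef_gt0 k)|exact: (smoothed_le1 A hphi)].
  rewrite lee_fin hm// ?mulr0// leqNgt; apply: contra kF => kF; exact/mem_set.
rewrite esum_fset//; last by move=> k _; rewrite lee_fin (ltW (coef_gt0 _)).
by rewrite fsumEFin// lee_fin lerDl.
Qed.

Lemma pseudo_norm_fin (delta r : R) x : 0 < delta -> delta <= `|x| <= r ->
  ((w x)%:E = \esum_(k in [set: int]) series_term x k)%E.
Proof.
move=> delta0 xr; have [C C0 hC] := pseudo_norm_upper r delta0.
rewrite fineK// ge0_fin_numE; first exact: le_lt_trans (hC x xr) (ltry _).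
by apply: esum_ge0 => k _; exact: term_ge0.
Qed.

Lemma pseudo_norm_ge_term (delta r : R) x k : 0 < delta -> delta <= `|x| <= r ->
  series_coef k * h (AR ^ k *m x) <= w x.
Proof.
move=> delta0 xr; rewrite -lee_fin (pseudo_norm_fin delta0 xr).
apply: esum_ge; exists [set k]; first by split.
by rewrite fsbig_set1.
Qed.

(** Definiteness provides a positive term at each point of the shell, and this
    term stays bounded below near that point. *)
Theorem pseudo_norm_shell (delta r : R) : 0 < delta -> exists c C, [/\ 0 < c, 0 < C &
  forall x, delta <= `|x| <= r -> c <= w x <= C].
Proof.
move=> delta0; have [C C0 hC] := pseudo_norm_upper r delta0.
have [|c c0 hc] := @compact_lower_bound R ('rV[R]_d.+1) _ (fun y => w y^T)
  (@compact_shell R d delta r).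
  move=> y /= yr; set x := y^T; have xr : delta <= `|x| <= r by rewrite norm_trmx.
  have x0 : x != 0 by rewrite -normr_gt0 (lt_le_trans delta0)//; case/andP: xr.
  have [k hk] : exists k, 0 < h (AR ^ k *m x).
    apply: contrapT => no; move/eqP: x0; apply; apply: hw.
    rewrite /pseudo_norm esum1// => k _; congr EFin.
    have -> : h (AR ^ k *m x) = 0; last by rewrite mulr0.
    apply/eqP; rewrite eq_le (smoothed_ge0 A hphi) andbT leNgt; apply/negP => ?.
    by apply: no; exists k.
  have [c [e [c0 e0 low]]] := smoothed_lower_bound hA hphi hk.
  pose b := opsum (AR ^ k) + 1.
  have b0 : 0 < b by rewrite ltr_wpDl ?opsum_ge0.
  exists (series_coef k * c), (e / b); split.
  - by rewrite mulr_gt0// coef_gt0.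
  - by rewrite divr_gt0.
  move=> z zr yz; have zr' : delta <= `|z^T| <= r by rewrite norm_trmx.
  apply: le_trans (pseudo_norm_ge_term k delta0 zr').
  apply: ler_wpM2l; first exact: ltW (coef_gt0 k).
  apply: low.
  rewrite -mulmxBr; apply: le_trans (norm_mulmx _ _) _.
  have : `|z^T - x| <= e / b.
    rewrite /x -linearB /= norm_trmx -normrN opprB.
    exact: ltW.
  rewrite ler_pdivlMr// mulrC => /(le_trans _); apply.
  by rewrite ler_wpM2r// lerDl.
exists c, C; split => // x xr; apply/andP; split.
  have e : `|x^T| = `|x| by rewrite -(norm_trmx x^T) trmxK.
  by have := hc x^T; rewrite /= e trmxK; apply.
by rewrite -lee_fin (pseudo_norm_fin delta0 xr) hC.
Qed.

End PseudoNorm.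

(** * Codings and Lipschitz equivalence *)

Section Codings.
Variables (R : realType) (V : zmodType) (w : V -> R).

(** [tau] identifies [K] with the sequences over [Q] letters, and [w] with the
    standard ultrametric of ratio [rho], up to constants. *)
Definition coding (rho : R) (Q : nat) (K : set V) (tau : V -> nat -> nat) :=
  [/\ forall x k, K x -> (tau x k < Q)%N,
      forall u, (forall k, (u k < Q)%N) -> exists2 x, K x & tau x =1 u,
      forall x y, K x -> K y -> tau x =1 tau y -> x = y &
      exists c C, [/\ 0 < c, 0 < C & forall x y k, K x -> K y ->
        (forall i, (i < k)%N -> tau x i = tau y i) -> tau x k != tau y k ->
        c * rho ^+ k <= w (x - y) <= C * rho ^+ k]].

Lemma first_difference (u v : nat -> nat) : ~ u =1 v ->
  exists2 k, u k != v k & forall i, (i < k)%N -> u i = v i.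
Proof.
move=> uv; have ex : exists k, u k != v k.
  apply: contrapT => no; apply: uv => k; apply/eqP; apply: contrapT => /negP ne.
  by apply: no; exists k.
exists (ex_minn ex); first by case: ex_minnP.
case: ex_minnP => k _ kmin i ik; apply/eqP; apply: contrapT => /negP /kmin.
by rewrite leqNgt ik.
Qed.

Lemma lipschitz_equiv_sym K K' : w_lipschitz_equiv w K K' -> w_lipschitz_equiv w K' K.
Proof.
move=> [s [[sK sinj ssurj] [C C0 lip]]].
have [t tE] : exists t : V -> V, forall y, K' y -> K (t y) /\ s (t y) = y.
  have [y|t ht] := choice (P := fun y x => K' y -> K x /\ s x = y); last by exists t.
  have [K'y|nKy] := pselect (K' y); last by exists y.
  by have [x Kx <-] := ssurj y K'y; exists x.
exists t; split.
  split.
  - by move=> y /tE[].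
  - move=> y y' /set_mem K'y /set_mem K'y' e.
    by rewrite -(tE y K'y).2 e (tE y' K'y').2.
  - move=> x Kx; exists (s x); first exact: sK.
    have [Kt st] := tE (s x) (sK x Kx).
    by apply: sinj => //; exact: mem_set.
exists C => // y y' K'y K'y'.
have [[Kt st] [Kt' st']] := (tE y K'y, tE y' K'y').
have /andP[] := lip _ _ Kt Kt'; rewrite st st' => l u.
by rewrite ler_pdivrMl// u /= -ler_pdivrMl.
Qed.

Hypothesis w_ge0 : forall x, 0 <= w x.

Lemma coding_equiv rho Q K K' tau tau' : 0 < rho ->
  coding rho Q K tau -> coding rho Q K' tau' -> w_lipschitz_equiv w K K'.
Proof.
move=> rho0 [lt1 onto1 inj1 [c [C [c0 C0 w1]]]] [lt2 onto2 inj2 [c' [C' [c'0 C'0 w2]]]].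
have [s sE] : exists s : V -> V, forall x, K x -> K' (s x) /\ tau' (s x) =1 tau x.
  have [x|s hs] := choice (P := fun x y => K x -> K' y /\ tau' y =1 tau x); last by exists s.
  have [Kx|nKx] := pselect (K x); last by exists x.
  by have [y K'y ty] := onto2 (tau x) (lt1 x ^~ Kx); exists y.
exists s; split.
  split.
  - by move=> x /sE[].
  - move=> x y /set_mem Kx /set_mem Ky sxy; apply: inj1 => // k.
    by rewrite -(sE x Kx).2 sxy (sE y Ky).2.
  - move=> y K'y; have [x Kx tx] := onto1 (tau' y) (lt2 y ^~ K'y).
    exists x => //; apply: inj2 => //; first exact: (sE x Kx).1.
    by move=> k; rewrite (sE x Kx).2.
pose M := 1 + C' / c + C / c'.
have [q1 q2] : 0 < C' / c /\ 0 < C / c' by rewrite !divr_gt0.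
have M0 : 0 < M by rewrite /M; lra.
exists M => // x y Kx Ky.
have [e|ne] := pselect (tau x =1 tau y).
  rewrite (inj1 _ _ Kx Ky e) !subrr; have := w_ge0 0.
  rewrite le_eqVlt => /orP[/eqP <-|w0]; first by rewrite !mulr0 lexx.
  have M1 : 1 <= M by rewrite /M; lra.
  by rewrite ler_piMl ?ler_peMl ?(ltW w0)// invf_le1.
have [k nek eqk] := first_difference ne.
have [[K'sx tsx] [K'sy tsy]] := (sE x Kx, sE y Ky).
have /andP[l1 u1] := w1 x y k Kx Ky eqk nek.
have ne2 : tau' (s x) k != tau' (s y) k by rewrite tsx tsy.
have /andP[l2 u2] := w2 (s x) (s y) k K'sx K'sy
   (fun i ik => etrans (tsx i) (etrans (eqk i ik) (esym (tsy i)))) ne2.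
have r0 : 0 < rho ^+ k by rewrite exprn_gt0.
apply/andP; split.
  rewrite ler_pdivrMl//; apply: le_trans u1 _.
  apply: (@le_trans _ _ (C / c' * (c' * rho ^+ k))).
    by rewrite mulrA divfK// gt_eqF.
  apply: ler_pM; [exact: ltW|by rewrite mulr_ge0 ?ltW|by rewrite /M; lra|exact: l2].
apply: le_trans u2 _; apply: (@le_trans _ _ (C' / c * (c * rho ^+ k))).
  by rewrite mulrA divfK// gt_eqF.
by apply: ler_pM; [exact: ltW|rewrite mulr_ge0 ?ltW|rewrite /M; lra|exact: l1].
Qed.

(** Counting the words of length [k]: points with distinct codes are separated
    at scale [rho ^ k], so their images have distinct codes of length [k + m]. *)
Lemma coding_le rho Q Q' K K' tau tau' : 0 < rho < 1 -> (0 < Q)%N ->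
  coding rho Q K tau -> coding rho Q' K' tau' -> w_lipschitz_equiv w K K' -> (Q <= Q')%N.
Proof.
move=> /andP[rho0 rho1] Q0 [lt1 onto1 inj1 [c [C [c0 C0 w1]]]] [lt2 onto2 inj2 [c' [C' [c'0 C'0 w2]]]].
move=> [s [[sK sinj _] [M M0 lip]]].
have [m hm] : exists m : nat, C' * rho ^+ m < M^-1 * c.
  have q0 : 0 < M^-1 * c by rewrite mulr_gt0 ?invr_gt0.
  have : geometric C' rho x @[x --> \oo] --> (0 : R) by apply: cvg_geometric; rewrite ger0_norm// ltW.
  move=> /cvgr0Pnorm_lt /(_ _ q0)[m _ h]; exists m.
  by apply: le_lt_trans (ler_norm _) _; exact: h (leqnn m).
have card k : (Q ^ k <= Q' ^ (k + m))%N.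
  pose ext (u : {ffun 'I_k -> 'I_Q}) i : nat := if insub i is Some j then u j else 0%N.
  have ext_lt u i : (ext u i < Q)%N by rewrite /ext; case: insubP => // *; exact: ltn_ord.
  have extE u (j : 'I_k) : ext u j = u j.
    by rewrite /ext; case: insubP => [j' _ e|]; [congr (val (u _)); exact: val_inj|rewrite ltn_ord].
  have [x xE] := choice (fun u => let: ex_intro2 x Kx e := onto1 (ext u) (ext_lt u) in
     ex_intro (fun x => K x /\ tau x =1 ext u) x (conj Kx e)).
  have Q'0 : (0 < Q')%N by apply: leq_ltn_trans (leq0n _) (lt2 (s (x [ffun=> Ordinal Q0])) 0%N _); apply: sK; exact: (xE _).1.
  pose code u : {ffun 'I_(k + m) -> 'I_Q'} := [ffun j : 'I_(k + m) => insubd (Ordinal Q'0) (tau' (s (x u)) j)].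
  have code_inj : injective code.
    move=> u v e; apply/ffunP => j; apply/val_inj; rewrite /= -!extE.
    have [Kxu txu] := xE u; have [Kxv txv] := xE v.
    apply/eqP; apply: contrapT => /negP ne.
    have ne' : ~ tau (x u) =1 tau (x v) by move=> /(_ j); rewrite txu txv => /eqP; rewrite (negbTE ne).
    have [i nei eqi] := first_difference ne'.
    have ik : (i < k)%N.
      rewrite ltnNge; apply/negP => ki; move/eqP: ne; apply.
      by rewrite -txu -txv eqi// (leq_trans (ltn_ord j)).
    have /andP[l1 _] := w1 _ _ i Kxu Kxv eqi nei.
    have /andP[l2 _] := lip _ _ Kxu Kxv.
    have wpos : M^-1 * (c * rho ^+ i) <= w (s (x u) - s (x v)).
      by apply: le_trans l2; rewrite ler_wpM2l// invr_ge0 ltW.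
    have nes : ~ tau' (s (x u)) =1 tau' (s (x v)).
      move=> eqs; have /sinj := inj2 _ _ (sK _ Kxu) (sK _ Kxv) eqs.
      by move=> /(_ (mem_set Kxu) (mem_set Kxv)) xuv; apply: ne'; rewrite xuv.
    have [l nel eql] := first_difference nes.
    have /andP[_ u2] := w2 _ _ l (sK _ Kxu) (sK _ Kxv) eql nel.
    have lim : (l < i + m)%N.
      rewrite ltnNge; apply/negP => il; have := le_trans wpos u2; apply/negP; rewrite -ltNge.
      apply: (@le_lt_trans _ _ (C' * rho ^+ (i + m))).
        by rewrite ler_pM2l// ler_wiXn2l// ltW.
      by rewrite addnC exprD mulrA mulrA ltr_pM2r// exprn_gt0.
    have lk : (l < k + m)%N by apply: leq_trans lim _; rewrite leq_add2r ltnW.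
    move: nel => /negP; apply; move/ffunP : e => /(_ (Ordinal lk)) /(congr1 val).
    by rewrite !ffunE !val_insubd /= !lt2 ?sK//; [move=> ->|exact: sK|exact: sK].
  by have := leq_card code code_inj; rewrite !card_ffun !card_ord.
rewrite leqNgt; apply/negP => QQ'.
have Q'0 : (0 < Q')%N.
  have [x Kx _] := onto1 (fun _ => 0%N) (fun _ => Q0).
  by apply: leq_ltn_trans (leq0n _) (lt2 (s x) 0%N (sK _ Kx)).
have [k hk] := pow_gap Q' (Q' ^ m).+1.
have h1 : (Q'.+1 ^ k <= Q ^ k)%N by case: k {hk} => // k; rewrite leq_exp2r.
have := leq_trans hk (leq_trans h1 (card k)).
by rewrite mulSn expnD mulnC -[leqRHS]add0n leq_add2r leqn0 expn_eq0 eqn0Ngt Q'0.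
Qed.
End Codings.

(** * Tiles of an integral self-affine set *)

Section System.
Variables (R : realType) (d : nat) (A : 'M[int]_d.+1) (hA : expanding R A).
Variables (D : {fset 'cV[int]_d.+1}) (hD : D != fset0) (K : set 'cV[R]_d.+1).
Hypotheses (hK : self_affine_set A D K) (hO : open_set_condition R A D).
Hypothesis hKd : totally_disconnected K.
Local Notation AR := (rmx R A).
Local Notation ZV := 'cV[int]_d.+1.
Local Notation r := (rmx R).
Local Notation fA := (fun x : ZV => A *m x).
Implicit Types (a b e : ZV) (k x y : 'cV[R]_d.+1).

Let uA : AR \is a GRing.unit := expanding_unit hA.

Lemma rmxD a b : r (a + b) = r a + r b. Proof. by rewrite /rmx map_mxD. Qed.
Lemma rmxB a b : r (a - b) = r a - r b. Proof. by rewrite /rmx map_mxB. Qed.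
Lemma rmx0 : r (0 : ZV) = 0. Proof. by rewrite /rmx map_mx0. Qed.
Lemma rmxM a : r (A *m a) = AR *m r a. Proof. by rewrite /rmx map_mxM. Qed.

Lemma AVK x : AR *m (AR^-1 *m x) = x.
Proof. by rewrite mulmxA -[AR *m _]/(AR * AR^-1) mulrV// mul1mx. Qed.

Lemma AKV x : AR^-1 *m (AR *m x) = x.
Proof. by rewrite mulmxA -[_ *m AR]/(AR^-1 * AR) mulVr// mul1mx. Qed.

Lemma AnVK n x : AR ^+ n *m (AR^-1 ^+ n *m x) = x.
Proof. by rewrite mulmxA -[AR ^+ n *m _]/(_ * _) exprVn mulrV ?unitrX// mul1mx. Qed.

Lemma AnKV n x : AR^-1 ^+ n *m (AR ^+ n *m x) = x.
Proof. by rewrite mulmxA -[_ *m AR ^+ n]/(_ * _) exprVn mulVr ?unitrX// mul1mx. Qed.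

Lemma AnS n x : AR ^+ n.+1 *m x = AR *m (AR ^+ n *m x).
Proof. by rewrite exprS -[_ * _]/(_ *m _) mulmxA. Qed.

Lemma AnD m n x : AR ^+ (m + n) *m x = AR ^+ m *m (AR ^+ n *m x).
Proof. by rewrite exprD -[_ * _]/(_ *m _) mulmxA. Qed.

Lemma ifs_mapE e x : ifs_map A e x = AR^-1 *m (x + r e).
Proof. by []. Qed.

Lemma K_neq0 : K !=set0. Proof. by case: hK. Qed.
Lemma K_compact : compact K. Proof. by case: hK. Qed.
Lemma K_closed : closed K.
Proof. exact: compact_closed (@norm_hausdorff _ _) K_compact. Qed.

Lemma K_contract x e : K x -> e \in D -> K (AR^-1 *m (x + r e)).
Proof. by move=> Kx eD; case: hK => _ _ ->; exists x, e. Qed.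

Lemma K_expand x : K x -> exists2 e, e \in D & K (AR *m x - r e).
Proof.
case: hK => _ _ KE; rewrite {1}KE => -[y [e [Ky eD ->]]]; exists e => //.
by rewrite ifs_mapE AVK addrK.
Qed.

Lemma K_bounded : exists2 B, 0 < B & forall x, K x -> `|x| <= B.
Proof.
have [M [_ hM]] := compact_bounded K_compact.
exists (Num.max M 0 + 1); first by rewrite ltr_wpDl// le_max lexx orbT.
move=> x Kx; apply: hM Kx; by rewrite ltr_pwDr// le_max lexx.
Qed.

(** The tiles [K + a] and [K + b] meet. *)
Definition adj a b : Prop := exists k k', [/\ K k, K k' & r a - r b = k - k'].

Lemma adj_refl a : adj a a.
Proof. by have [k Kk] := K_neq0; exists k, k; rewrite !subrr. Qed.

Lemma adj_sym a b : adj a b -> adj b a.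
Proof. by move=> [k [k' [Kk Kk' e]]]; exists k', k; split=> //; rewrite -opprB e opprB. Qed.

Lemma adj_shift a b t : adj a b -> adj (a + t) (b + t).
Proof.
move=> [k [k' [Kk Kk' e]]]; exists k, k'; split=> //.
by rewrite !rmxD opprD addrACA subrr addr0.
Qed.

Lemma adj_expand a b e e' : e \in D -> e' \in D ->
  adj (A *m a + e) (A *m b + e') -> adj a b.
Proof.
move=> eD e'D [k [k' [Kk Kk' E]]].
exists (AR^-1 *m (k + r e')), (AR^-1 *m (k' + r e)); split; try exact: K_contract.
rewrite -mulmxBr; apply: (can_inj AKV); rewrite AVK mulmxBr -!rmxM.
rewrite !rmxD in E; apply/eqP; rewrite -subr_eq0; apply/eqP.
move: E => /eqP; rewrite -subr_eq0 => /eqP <-.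
by rewrite !opprD !opprK !addrA; apply/matrixP => i j; rewrite !mxE; ring.
Qed.

Local Notation expand := (expand fA D).
Local Notation Z := (digit_sums fA D).
Local Notation components := (components adj).
Local Notation component := (component adj).
Local Notation children := (children fA D adj).
Local Notation gens := (gens children).
Local Notation node := (node fA D adj).

Lemma fA_morph : {morph fA : x y / x + y}.
Proof. by move=> x y; rewrite mulmxDr. Qed.

Lemma expand_contract (S : {fset ZV}) x z : z \in expand S -> K (AR *m x - r z) ->
  exists2 a, a \in S & K (x - r a).
Proof.
move=> /expandP[a [e [aS eD ->]]] Kx; exists a => //.
have := K_contract Kx eD; rewrite rmxD rmxM opprD addrA subrK.
by rewrite mulmxBr !AKV.
Qed.

Lemma expand_cover (S : {fset ZV}) x a : a \in S -> K (x - r a) ->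
  exists2 z, z \in expand S & K (AR *m x - r z).
Proof.
move=> aS /K_expand[e eD Kx]; exists (A *m a + e); first by apply/expandP; exists a, e.
by rewrite rmxD rmxM opprD addrA -mulmxBr.
Qed.

Lemma Z_cover n x : K x -> exists2 a, a \in Z n & K (AR ^+ n *m x - r a).
Proof.
move=> Kx; elim: n => [|n [a aZ Ka]].
  by exists 0; rewrite ?inE// rmx0 subr0 expr0 mul1mx.
by have [z zl Kz] := expand_cover aZ Ka; exists z => //; rewrite AnS.
Qed.

Lemma Z_inside n k a : K k -> a \in Z n -> K (AR^-1 ^+ n *m (k + r a)).
Proof.
move=> Kk; elim: n k a Kk => [|n IH] k a Kk.
  by rewrite inE => /eqP ->; rewrite rmx0 addr0 expr0 mul1mx.
move=> /expandP[b [e [bZ eD ->]]]; have := IH _ b (K_contract Kk eD) bZ.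
rewrite rmxD rmxM exprSr -[AR^-1 ^+ n * _]/(_ *m _) -mulmxA.
have -> : AR^-1 *m (k + (AR *m r b + r e)) = AR^-1 *m (k + r e) + r b.
  by rewrite [AR *m _ + _]addrC addrA mulmxDr AKV.
by [].
Qed.

(** If [G] is the open set of the condition, the translates of [G] by the points
    of [Z n] are disjoint, by induction on [n]: two that meet have the same
    parent, because their images under the contractions meet too, and then the
    same last digit. A point common to the translates of [G] at [A a + e] and
    [A b + e'] then yields the claim. *)
Lemma Z_expand_inj n a b e e' : a \in Z n -> b \in Z n -> e \in D -> e' \in D ->
  A *m a + e = A *m b + e' -> a = b /\ e = e'.
Proof.
have [G [_ _ [p0 Gp] Gsub Gdis]] := hO.
have down z c f : f \in D -> G (z - r (A *m c + f)) -> G (AR^-1 *m z - r c).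
  move=> fD Gz; apply: (Gsub f fD); exists (z - r (A *m c + f)) => //.
  by rewrite ifs_mapE rmxD rmxM opprD addrA subrK mulmxBr AKV.
have same c f f' z : f \in D -> f' \in D ->
    G (z - r (A *m c + f)) -> G (z - r (A *m c + f')) -> f = f'.
  move=> fD f'D Gf Gf'; apply: contrapT => ff'.
  have := Gdis _ _ fD f'D ff' => E; rewrite -[False]/(set0 (AR^-1 *m (z - AR *m r c))) -E; split.
    exists (z - r (A *m c + f)) => //.
    by rewrite ifs_mapE rmxD rmxM opprD addrA subrK.
  exists (z - r (A *m c + f')) => //.
  by rewrite ifs_mapE rmxD rmxM opprD addrA subrK.
have disj : forall a b z, a \in Z n -> b \in Z n -> G (z - r a) -> G (z - r b) -> a = b.
  elim: n => [|n IH] {}a {}b z; first by rewrite !inE => /eqP -> /eqP ->.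
  move=> /expandP[a1 [f [a1Z fD ->]]] /expandP[b1 [f' [b1Z f'D ->]]] Ga Gb.
  have ab := IH _ _ _ a1Z b1Z (down _ _ _ fD Ga) (down _ _ _ f'D Gb).
  by rewrite ab in Ga *; rewrite (same _ _ _ _ fD f'D Ga Gb).
move=> aZ bZ eD e'D E; pose z := p0 + r (A *m a + e).
have Ga : G (z - r (A *m a + e)) by rewrite /z addrK.
have Gb : G (z - r (A *m b + e')) by rewrite -E.
have ab := disj _ _ _ aZ bZ (down _ _ _ eD Ga) (down _ _ _ e'D Gb).
by split => //; rewrite ab in Ga; exact: same eD e'D Ga Gb.
Qed.

(** * Local finiteness and separation of tiles *)

Lemma lattice_box (c : R) : exists F : {fset ZV}, forall a, `|r a| <= c -> a \in F.
Proof.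
have [T cT] : exists T : nat, c < T%:R.
  by exists (Num.truncn `|c|).+1; apply: le_lt_trans (ler_norm c) _; exact: truncnS_gt.
pose g (f : {ffun 'I_d.+1 -> 'I_(T + T).+1}) : ZV := \col_i ((f i : nat)%:Z - T%:Z).
exists [fset g f | f : {ffun 'I_d.+1 -> 'I_(T + T).+1}]%fset => a ac.
have ai i : (`|(a i 0)%R|%N <= T)%N.
  have := le_trans (coord_le_norm (r a) i) ac; rewrite mxE => h.
  have := le_lt_trans h cT; rewrite -intr_norm -[T%:R]/(T%:Z%:~R) ltr_int.
  by rewrite -abszE ltz_nat => /ltnW.
apply/imfsetP; exists [ffun i => inord `|(a i 0 + T%:Z)%R|%N] => //.
apply/matrixP => i j; rewrite !mxE !ord1 ffunE inordK; last by have := ai i; lia.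
have u0 : 0 <= a i 0 + T%:Z by have := ai i; lia.
by rewrite (gez0_abs u0) addrK.
Qed.

Lemma fset_uniform (T : choiceType) (S : {fset T}) (Q : T -> R -> Prop) :
  (forall t c c', c <= c' -> Q t c' -> Q t c) ->
  (forall t, t \in S -> exists2 c, 0 < c & Q t c) ->
  exists2 c, 0 < c & forall t, t \in S -> Q t c.
Proof.
move=> mono; have -> : (forall t, t \in S -> exists2 c, 0 < c & Q t c) =
   (forall t, t \in enum_fset S -> exists2 c, 0 < c & Q t c) by [].
have -> : (fun c => forall t, t \in S -> Q t c) = (fun c => forall t, t \in enum_fset S -> Q t c) by [].
elim: (enum_fset S) => [|t s IH] h; first by exists 1.
have [|c c0 hc] := IH; first by move=> u us; apply: h; rewrite inE us orbT.
have [c' c'0 hc'] := h t (mem_head _ _).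
exists (Num.min c c'); first by rewrite lt_min c0.
move=> u; rewrite inE => /orP[/eqP -> |us].
  by apply: mono hc'; rewrite ge_min lexx orbT.
by apply: mono (hc u us); rewrite ge_min lexx.
Qed.

(** Up to translation only finitely many pairs of tiles are close to each other,
    and two disjoint tiles are compact. *)
Lemma separation : exists2 delta, 0 < delta & forall a b x y, ~ adj a b ->
  K (x - r a) -> K (y - r b) -> delta <= `|x - y|.
Proof.
have [B B0 hB] := K_bounded.
(* tiles translated by more than [2 * B + 1] from each other are 1 apart *)
have [F hF] := lattice_box (2 * B + 1).
have [||c c0 hc] := @fset_uniform _ F (fun g c => ~ adj g 0 -> forall k k', K k -> K k' -> c <= `|k - k' + r g|).
- by move=> g c c' cc' h ng k k' Kk Kk'; apply: le_trans cc' _; exact: h.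
- move=> g _; have [ag|ng] := pselect (adj g 0); first by exists 1.
  have [| |c c0 hc] := @compact_closed_dist R _ K [set y | K (y + r g)] K_compact.
  + rewrite (_ : [set y | _] = (fun y => y + r g) @^-1` K) //.
    apply: closed_comp; last exact: K_closed.
    by move=> y _; apply: (@continuousD _ _ _ (fun y => y) (fun _ => r g)); [|exact: cst_continuous].
  + apply/seteqP; split => // k [Kk /= Kg]; apply: ng; exists (k + r g), k; split=> //.
    by rewrite rmx0 subr0 addrAC subrr add0r.
  exists c => // _ k k' Kk Kk'.
  have := hc k (k' - r g) Kk; rewrite /= subrK => /(_ Kk').
  by have -> : k - (k' - r g) = k - k' + r g by apply/matrixP => i j; rewrite !mxE; ring.
exists (Num.min c 1); first by rewrite lt_min c0 ltr01.
move=> a b x y nab Kx Ky.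
have exy : x - y = (x - r a) - (y - r b) + r (a - b).
  by rewrite rmxB; apply/matrixP => i j; rewrite !mxE; ring.
have [le_B|gt_B] := leP `|r (a - b)| (2 * B + 1).
  rewrite ge_min exy hc//; first exact: hF.
  by move=> /(adj_shift b); rewrite subrK add0r.
rewrite ge_min; apply/orP; right.
have -> : x - y = r (a - b) - ((y - r b) - (x - r a)).
  by rewrite rmxB; apply/matrixP => i j; rewrite !mxE; ring.
apply: le_trans (lerB_dist _ _); rewrite lerBrDr.
apply: le_trans (ltW gt_B); rewrite addrC lerD2r.
apply: le_trans (ler_normB _ _) _; have := hB _ Kx; have := hB _ Ky; lra.
Qed.

Lemma continuous_mulmx (M : 'M[R]_d.+1) : continuous (fun x => M *m x).
Proof.
move=> x B /nbhs_ballP[e /= e0 eB].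
have b0 : 0 < opsum M + 1 by rewrite ltr_wpDl ?opsum_ge0.
apply/nbhs_ballP; exists (e / (opsum M + 1)) => /=; first by rewrite divr_gt0.
move=> y; rewrite -ball_normE /= => xy; apply: eB; rewrite -ball_normE /= -mulmxBr.
apply: le_lt_trans (norm_mulmx _ _) _.
apply: (@le_lt_trans _ _ ((opsum M + 1) * `|x - y|)); first by rewrite ler_wpM2r// lerDl.
by rewrite mulrC -ltr_pdivlMr.
Qed.

Lemma continuous_shiftl (M : 'M[R]_d.+1) c : continuous (fun x => M *m x + c).
Proof.
move=> x; apply: (@continuousD _ _ _ (fun y => M *m y) (fun _ => c)); first exact: continuous_mulmx.
exact: cst_continuous.
Qed.

(** * Bounded components *)

Definition patch_set (F : {fset ZV}) : set 'cV[R]_d.+1 :=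
  [set y | exists2 f, f \in F & K (y - r f)].

Lemma closed_patch (s : seq ZV) (M : 'M[R]_d.+1) :
  closed [set y | exists2 f, f \in s & K (M *m y - r f)].
Proof.
elim: s => [|f s IH].
  by rewrite (_ : [set y | _] = set0); [exact: closed0|apply/seteqP; split => // y [f]].
rewrite (_ : [set y | _] = (fun y => M *m y - r f) @^-1` K `|`
    [set y | exists2 f, f \in s & K (M *m y - r f)]).
  apply: closedU => //; apply: closed_comp; last exact: K_closed.
  by move=> y _; exact: continuous_shiftl.
apply/seteqP; split => y /=.
  by move=> [g]; rewrite inE => /orP[/eqP -> Kf|gs Kg]; [left|right; exists g].
by move=> [Kf|[g gs Kg]]; [exists f => //; exact: mem_head|exists g => //; rewrite inE gs orbT].
Qed.

(** A patch whose translate lies in an orbit sits in an expanded copy of [K],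
    from which it inherits compactness and total disconnectedness. *)
Lemma patch_in_copy n a (F : {fset ZV}) y : (forall f, f \in F -> f + a \in Z n) ->
  patch_set F y -> K (AR^-1 ^+ n *m (y + r a)).
Proof.
move=> FZ [f fF Kf]; have := Z_inside Kf (FZ _ fF).
by rewrite rmxD addrA subrK.
Qed.

Lemma patch_compact n a (F : {fset ZV}) : (forall f, f \in F -> f + a \in Z n) ->
  compact (patch_set F).
Proof.
move=> FZ; apply: (@subclosed_compact _ _ ((fun x => AR ^+ n *m x - r a) @` K)).
- rewrite (_ : patch_set F = [set y | exists2 f, f \in enum_fset F & K (1%:M *m y - r f)]).
    exact: closed_patch.
  by apply/seteqP; split => y [f fF]; rewrite ?mul1mx => Kf; exists f => //; rewrite mul1mx.
- apply: continuous_compact K_compact; apply: continuous_subspaceT.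
  exact: continuous_shiftl.
- move=> y /(patch_in_copy FZ) Ky; exists (AR^-1 ^+ n *m (y + r a)) => //.
  by rewrite AnVK addrK.
Qed.

Lemma patch_td n a (F : {fset ZV}) : (forall f, f \in F -> f + a \in Z n) ->
  totally_disconnected (patch_set F).
Proof.
move=> FZ y Fy; apply/seteqP; split; last by move=> _ ->; exact: connected_component_refl.
move=> z [C [Cy CF conC] Cz] /=.
pose g x := AR^-1 ^+ n *m x + AR^-1 ^+ n *m r a.
have gE x : g x = AR^-1 ^+ n *m (x + r a) by rewrite /g mulmxDr.
have congC : connected (g @` C).
  by apply: connected_continuous_connected => //; apply: continuous_subspaceT; exact: continuous_shiftl.
have gCK : g @` C `<=` K by move=> _ [x Cx <-]; rewrite gE; apply: (patch_in_copy FZ); exact: CF.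
have gy : (g @` C) (g y) by exists y.
have gz : connected_component K (g y) (g z).
  by apply: (connected_component_max gy gCK congC); exists z.
have : g z = g y by move: gz; rewrite hKd //; exact: gCK.
rewrite !gE => /(congr1 (fun x => AR ^+ n *m x)); rewrite !AnVK.
exact: addIr.
Qed.

(** Contracted by [A ^- m], the tiles of a component at level [m + n] become
    smaller than [e], so the component becomes a chain of steps shorter than [e]
    inside tiles of level [n]. Near its origin this chain runs in one of
    finitely many patches, compact and totally disconnected, where chains with
    steps shorter than a suitable [e] never go further than 1: the chain stays
    within 1 of its origin, and the component within the corresponding distance
    [m] levels below. Levels lower than [m] are finite in number. *)
Lemma component_bounded : exists c, forall n a b, a \in Z n -> b \in component (Z n) a ->
  `|r b - r a| <= c.
Proof.
have [B B0 hB] := K_bounded.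
(* tiles that come within 2 of a point of the tile at [a0] are at [f + a0], |f| <= [T] *)
pose T := 2 * B + 2.
have [box hbox] := lattice_box T.
pose is_patch (F : {fset ZV}) := exists n a, forall f, f \in F -> f + a \in Z n.
have [||e e0 he] := @fset_uniform _ (fpowerset box) (fun F c => is_patch F ->
    forall x, patch_set F x -> chain_set (patch_set F) x c `<=` [set y | `|x - y| < 1]).
- move=> F c c' cc' h pF x Fx; apply: subset_trans (h pF x Fx); exact: chain_set_mono.
- move=> F _; have [[n [a FZ]]|nF] := pselect (is_patch F); last by exists 1.
  have [c c0 hc] := totally_disconnected_chains (patch_compact FZ) (patch_td FZ) ltr01.
  by exists c.
pose e1 := Num.min e 1.
have e10 : 0 < e1 by rewrite lt_min e0 ltr01.
have BB : 0 < 2 * B by rewrite mulr_gt0.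
have [m hm] := expanding_inv hA (divr_gt0 e10 BB).
have small k k' : K k -> K k' -> `|AR^-1 ^+ m *m (k - k')| < e1.
  move=> Kk Kk'; apply: le_lt_trans (norm_mulmx _ _) _.
  have := hm m (leqnn m); rewrite ltr_pdivlMr//; apply: le_lt_trans.
  rewrite ler_wpM2l ?opsum_ge0//; apply: le_trans (ler_normB _ _) _.
  by have := hB _ Kk; have := hB _ Kk'; lra.
pose c1 := opsum (AR ^+ m) + 2 * B.
have deep n a b : a \in Z (m + n) -> b \in component (Z (m + n)) a -> `|r b - r a| <= c1.
  move=> aZ bC; have [k0 Kk0] := K_neq0.
  pose y0 := AR^-1 ^+ m *m (k0 + r a).
  have descend k c : K k -> c \in Z (m + n) ->
      exists2 f, f \in Z n & K (AR^-1 ^+ m *m (k + r c) - r f).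
    move=> Kk /(Z_inside Kk) /(Z_cover n)[f fZ].
    by rewrite addnC exprD -[_ * _]/(_ *m _) -mulmxA AnVK; exists f.
  have [a0 a0Z Ky0] := descend k0 a Kk0 aZ; rewrite -/y0 in Ky0.
  pose F := [fset f in box | (f + a0)%R \in Z n]%fset.
  have FZ f : f \in F -> f + a0 \in Z n by rewrite in_sep => /andP[].
  have Fbox : F \in fpowerset box.
    by rewrite fpowersetE; apply/fsubsetP => f; rewrite in_sep => /andP[].
  have inF k c : K k -> c \in Z (m + n) -> `|AR^-1 ^+ m *m (k + r c) - y0| <= 2 ->
      patch_set F (AR^-1 ^+ m *m (k + r c) - r a0).
    move=> Kk cZ near2; have [f fZ Kf] := descend k c Kk cZ.
    exists (f - a0); last by rewrite rmxB opprB addrA subrK.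
    rewrite in_sep subrK fZ andbT; apply: hbox; rewrite rmxB.
    set x := AR^-1 ^+ m *m (k + r c) in near2 Kf *.
    have -> : r f - r a0 = (x - y0) + (y0 - r a0) - (x - r f).
      by apply/matrixP => i j; rewrite !mxE; ring.
    apply: le_trans (ler_normB _ _) _; apply: le_trans (lerD (ler_normD _ _) (lexx _)) _.
    have := hB _ Ky0; have := hB _ Kf; rewrite /T; lra.
  pose U := chain_set (patch_set F) (y0 - r a0) e.
  have Fy0 : patch_set F (y0 - r a0) by apply: inF => //; rewrite subrr normr0.
  have U1 y : U y -> `|(y0 - r a0) - y| < 1.
    by apply: (he F Fbox) => //; exists n, a0.
  pose C := [fset c in Z (m + n) |
    `[< exists2 k, K k & U (AR^-1 ^+ m *m (k + r c) - r a0) >]]%fset.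
  have aC : a \in C.
    by rewrite in_sep aZ /=; apply/asboolP; exists k0.
  have clC : closed_in adj (Z (m + n)) C.
    move=> c c'; rewrite !in_sep => /andP[cZ /asboolP[k Kk Uk]] c'Z [k1 [k2 [Kk1 Kk2 cc']]].
    rewrite c'Z /=; apply/asboolP; exists k1 => //.
    have -> : k1 + r c' = k2 + r c.
      rewrite -[k1](subrK k2) -cc'; apply/matrixP => i j; rewrite !mxE; ring.
    have step : `|AR^-1 ^+ m *m (k + r c) - r a0 - (AR^-1 ^+ m *m (k2 + r c) - r a0)| < e1.
      rewrite opprB addrA subrK -mulmxBr.
      have -> : k + r c - (k2 + r c) = k - k2 by rewrite opprD addrACA subrr addr0.
      exact: small.
    have Ux := U1 _ Uk.
    apply: chain_set_step Uk _ _; last by apply: lt_le_trans step _; rewrite ge_min lexx.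
    apply: inF => //.
    set x := AR^-1 ^+ m *m (k + r c) in Ux step; set x' := AR^-1 ^+ m *m (k2 + r c) in step *.
    have -> : x' - y0 = - (x - r a0 - (x' - r a0)) - ((y0 - r a0) - (x - r a0)).
      by apply/matrixP => i j; rewrite !mxE; ring.
    apply: le_trans (ler_normB _ _) _; rewrite normrN.
    have := Ux; have : e1 <= 1 by rewrite ge_min lexx orbT.
    by move: step; lra.
  have := fsubsetP (comp_min aC clC) b bC; rewrite in_sep => /andP[_ /asboolP[k Kk /U1]].
  rewrite opprB addrA subrK /y0 -mulmxBr => lt1.
  have h1 : `|k0 + r a - (k + r b)| <= opsum (AR ^+ m).
    rewrite -[X in `|X|](AnVK m); apply: le_trans (norm_mulmx _ _) _.
    by rewrite -[leRHS]mulr1 ler_wpM2l ?opsum_ge0// ltW.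
  have -> : r b - r a = (k0 - k) - (k0 + r a - (k + r b)).
    by apply/matrixP => i j; rewrite !mxE; ring.
  apply: le_trans (ler_normB _ _) _; have := ler_normB k0 k; have := hB _ Kk; have := hB _ Kk0.
  by rewrite /c1; lra.
pose c2 := \sum_(n < m) \sum_(a <- enum_fset (Z n)) `|r a|.
have shallow n a : (n < m)%N -> a \in Z n -> `|r a| <= c2.
  move=> nm aZ; rewrite /c2 (bigD1 (Ordinal nm))//= (big_rem a)//= -addrA.
  by rewrite lerDl addr_ge0// sumr_ge0// => *; rewrite sumr_ge0.
exists (c1 + 2 * c2) => n a b aZ bC.
have c20 : 0 <= c2 by apply: sumr_ge0 => i _; exact: sumr_ge0.
have c10 : 0 <= c1 by rewrite addr_ge0 ?opsum_ge0// ltW.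
have [nm|mn] := ltnP n m.
  have bZ := fsubsetP (comp_sub _ _ _) b bC.
  apply: le_trans (ler_normB _ _) _; have := shallow n a nm aZ; have := shallow n b nm bZ.
  lra.
apply: le_trans (deep (n - m)%N a b _ _) _; rewrite ?subnKC//; lra.
Qed.

Lemma near_set : exists W : {fset ZV}, forall n a b c,
  a \in Z n -> b \in component (Z n) a -> adj b c -> c - a \in W.
Proof.
have [B B0 hB] := K_bounded; have [c0 hc0] := component_bounded.
have [W hW] := lattice_box (c0 + 2 * B); exists W => n a b c aZ bC [k [k' [Kk Kk' E]]].
apply: hW; have -> : r (c - a) = (r b - r a) - (k - k').
  by rewrite -E rmxB; apply/matrixP => i j; rewrite !mxE; ring.
apply: le_trans (ler_normB _ _) _; have := ler_normB k k'.
have := hB _ Kk; have := hB _ Kk'; have := hc0 _ _ _ aZ bC; lra.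
Qed.

(** * The part of a self-affine set carried by a list of nodes *)

Definition cell n (p : seq {fset ZV}) : set 'cV[R]_d.+1 :=
  [set x | K x /\ exists P a, [/\ P \in p, a \in P & K (AR ^+ n *m x - r a)]].

Lemma cell_step n p : cell n.+1 (flatten (map children p)) = cell n p.
Proof.
apply/seteqP; split => x [Kx [P [a [Pp aP Ka]]]]; split => //.
  move: Pp => /flatten_mapP[P' P'p PP']; rewrite AnS in Ka.
  have [b bP' Kb] := expand_contract (fsubsetP (comps_sub PP') _ aP) Ka.
  by exists P', b.
have [z zP Kz] := expand_cover aP Ka; exists (component (expand P) z), z; split.
- by apply/flatten_mapP; exists P => //; exact: mem_comps.
- exact: mem_comp.
- by rewrite AnS.
Qed.

Lemma cell_gens L n p : cell (L + n) (gens L p) = cell n p.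
Proof. by elim: L => //= L IH; rewrite addSn cell_step. Qed.

Lemma cell_root n : cell n (gens n [:: [fset 0]%fset]) = K.
Proof.
rewrite -{1}(addn0 n) cell_gens; apply/seteqP; split => x; first by case.
move=> Kx; split => //; exists [fset 0]%fset, 0; rewrite mem_head in_fset1 eqxx; split => //.
by rewrite rmx0 subr0 expr0 mul1mx.
Qed.

Lemma cell_mono n p q : {subset p <= q} -> cell n p `<=` cell n q.
Proof. by move=> pq x [Kx [P [a [Pp aP Ka]]]]; split => //; exists P, a; split => //; exact: pq. Qed.

Lemma cell_flatten n pp x : cell n (flatten pp) x <-> exists2 p, p \in pp & cell n p x.
Proof.
split => [[Kx [P [a [/flattenP[p ppp Pp] aP Ka]]]]|[p ppp [Kx [P [a [Pp aP Ka]]]]]].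
  by exists p => //; split => //; exists P, a.
by split => //; exists P, a; split => //; apply/flattenP; exists p.
Qed.

Lemma cell_closed n p : closed (cell n p).
Proof.
rewrite (_ : cell n p = K `&`
    [set x | exists2 a, a \in flatten [seq enum_fset P | P <- p] & K (AR ^+ n *m x - r a)]).
  by apply: closedI; [exact: K_closed|exact: closed_patch].
apply/seteqP; split => x.
  by move=> [Kx [P [a [Pp aP Ka]]]]; split => //; exists a => //; apply/mem_flatten_fsets; exists P.
by move=> [Kx [a /mem_flatten_fsets[P Pp aP] Ka]]; split => //; exists P, a.
Qed.

(** Lists of distinct nodes of level [n]; only such lists have disjoint cells. *)
Definition valid n (p : seq {fset ZV}) := uniq p /\ {subset p <= components (Z n)}.

Lemma valid_gens L n p : valid n p -> valid (L + n) (gens L p).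
Proof.
move=> [up sub].
have perm0 : perm_eq (gens L (components (Z n))) (components (Z (L + n))).
  by rewrite /digit_sums iterD; exact: (perm_gens_comps adj_refl adj_sym adj_expand).
pose q := [seq P <- components (Z n) | P \notin p].
have perm1 : perm_eq (components (Z n)) (p ++ q).
  apply: uniq_perm; first exact: undup_uniq.
    rewrite cat_uniq up filter_uniq ?undup_uniq// andbT /=.
    by apply/hasPn => P; rewrite mem_filter => /andP[].
  move=> P; rewrite mem_cat mem_filter; case: (boolP (P \in p)) => [/sub ->|] //.
have perm2 : perm_eq (gens L p ++ gens L q) (components (Z (L + n))).
  by rewrite -gens_cat (perm_trans _ perm0)// perm_sym gens_perm.
split; first by have := perm_uniq perm2; rewrite undup_uniq cat_uniq => /andP[].
by move=> P PL; rewrite -(perm_mem perm2) mem_cat PL.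
Qed.

Lemma cell_neq0 n p : valid n p -> (0 < size p)%N -> cell n p !=set0.
Proof.
case: p => // P p [_ sub] _; have PZ := sub P (mem_head _ _).
have [a aP] := comps_neq0 PZ; have aZ := fsubsetP (comps_sub PZ) _ aP.
have [k Kk] := K_neq0; exists (AR^-1 ^+ n *m (k + r a)).
split; first exact: Z_inside.
by exists P, a; split => //; [exact: mem_head|rewrite AnVK addrK].
Qed.

(** Points of disjoint lists of nodes lie in tiles that do not meet, as
    the tiles that meet belong to a single node; [separation] applies. *)
Lemma cells_apart : exists2 delta, 0 < delta & forall n p q x y, valid n (p ++ q) ->
  cell n p x -> cell n q y -> delta <= `|AR ^+ n *m (x - y)|.
Proof.
have [delta delta0 sep] := separation; exists delta => // n p q x y [up sub].
move=> [_ [P [a [Pp aP Ka]]]] [_ [Q [b [Qq bQ Kb]]]].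
rewrite mulmxBr; apply: sep Ka Kb => ab.
have PZ : P \in components (Z n) by apply: sub; rewrite mem_cat Pp.
have QZ : Q \in components (Z n) by apply: sub; rewrite mem_cat Qq orbT.
have bP : b \in P.
  by apply: (comps_closed PZ aP _ ab); exact: (fsubsetP (comps_sub QZ)).
have PQ : P = Q by rewrite (comps_eq adj_sym PZ bP) -(comps_eq adj_sym QZ bQ).
move: up; rewrite cat_uniq => /and3P[_ /hasPn /(_ Q Qq)]; by rewrite -PQ /= Pp.
Qed.

(** The ancestor has bounded diameter, and each of the at most [c] generations
    below it adds a bounded error to the expansion of that diameter. *)
Lemma close_nodes_bound c : exists c', forall n p x y, close_nodes children node c p ->
  cell n p x -> cell n p y -> `|AR ^+ n *m (x - y)| <= c'.
Proof.
have [B B0 hB] := K_bounded; have [c0 hc0] := component_bounded.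
pose M := \sum_(e <- enum_fset D) `|r e|.
have M0 : 0 <= M by exact: sumr_ge0.
have DM e : e \in D -> `|r e| <= M.
  by move=> eD; rewrite /M (big_rem e)//= lerDl sumr_ge0.
pose spread (b : nat) := iter b (fun s => opsum AR * s + M) 0.
have spread0 (b : nat) : 0 <= spread b.
  by elim: b => //= b IH; rewrite addr_ge0// mulr_ge0 ?opsum_ge0.
have gensP (b : nat) p P a : P \in gens b p -> a \in P ->
    exists P0 u, [/\ P0 \in p, u \in P0 & `|r a - AR ^+ b *m r u| <= spread b].
  elim: b P a => [|b IH] P a /=.
    by move=> Pp aP; exists P, a; rewrite expr0 mul1mx subrr normr0.
  move=> /flatten_mapP[P' P'p PP'] aP.
  have /expandP[a' [e [a'P' eD ->]]] := fsubsetP (comps_sub PP') _ aP.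
  have [P0 [u [P0p uP0 bound]]] := IH P' a' P'p a'P'; exists P0, u; split => //.
  rewrite rmxD rmxM AnS addrAC -mulmxBr.
  apply: le_trans (ler_normD _ _) _; rewrite lerD ?DM//.
  by apply: le_trans (norm_mulmx _ _) _; rewrite ler_wpM2l ?opsum_ge0.
pose bnd (b : nat) := opsum (AR ^+ b) * `|c0| + 2 * spread b + 2 * B.
have bnd0 (b : nat) : 0 <= bnd b.
  by rewrite /bnd !addr_ge0 ?mulr_ge0 ?opsum_ge0 ?spread0// ltW.
exists (\sum_(i < c.+1) bnd i) => n p x y [P0 [b [[m P0Z] bc sub]]].
move=> [_ [P [a [Pp aP Ka]]]] [_ [Q [a' [Qp a'Q Ka']]]].
apply: (@le_trans _ _ (bnd b)); last first.
  by rewrite (bigD1 (inord b : 'I_c.+1))//= inordK ?ltnS// lerDl sumr_ge0.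
have [_ [u [/[!inE]/eqP -> uP hu]]] := gensP b [:: P0] P a (sub _ Pp) aP.
have [_ [v [/[!inE]/eqP -> vP hv]]] := gensP b [:: P0] Q a' (sub _ Qp) a'Q.
have uv : `|r u - r v| <= `|c0|.
  apply: le_trans (ler_norm c0); apply: (hc0 m); first exact: (fsubsetP (comps_sub P0Z)).
  by rewrite -(comps_eq adj_sym P0Z vP).
have huv : `|AR ^+ b *m (r u - r v)| <= opsum (AR ^+ b) * `|c0|.
  by apply: le_trans (norm_mulmx _ _) _; rewrite ler_wpM2l ?opsum_ge0.
rewrite mulmxBr; set X := AR ^+ n *m x in Ka *; set Y := AR ^+ n *m y in Ka' *.
have -> : X - Y = ((X - r a) - (Y - r a')) + ((r a - AR ^+ b *m r u) - (r a' - AR ^+ b *m r v))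
    + AR ^+ b *m (r u - r v).
  by rewrite mulmxBr; apply/matrixP => i j; rewrite !mxE; ring.
have := ler_normD (((X - r a) - (Y - r a')) + ((r a - AR ^+ b *m r u) - (r a' - AR ^+ b *m r v))) (AR ^+ b *m (r u - r v)).
have := ler_normD ((X - r a) - (Y - r a')) ((r a - AR ^+ b *m r u) - (r a' - AR ^+ b *m r v)).
have := ler_normB (X - r a) (Y - r a').
have := ler_normB (r a - AR ^+ b *m r u) (r a' - AR ^+ b *m r v).
have := hB _ Ka; have := hB _ Ka'; rewrite /bnd; lra.
Qed.

(** * Coding a self-affine set *)

Variables (eps0 : R) (heps0 : 0 < eps0 < 1 / 2) (phi : 'cV[R]_d.+1 -> R).
Hypothesis hphi : mollifier eps0 phi.
Hypothesis hw : forall x, pseudo_norm A phi x = 0 -> x = 0.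
Local Notation w := (pseudo_norm A phi).
Local Notation ratio := (ratio R A).

Lemma pseudo_norm_scaleX n x : w x = ratio ^+ n * w (AR ^+ n *m x).
Proof.
elim: n => [|n IH]; first by rewrite expr0 mul1r expr0 mul1mx.
rewrite [ratio ^+ n.+1]exprSr (AnS n x) -mulrA -(pseudo_norm_scale hA hphi (AR ^+ n *m x)).
exact: IH.
Qed.

Lemma expr_level (a : R) (i L H : nat) :
  a ^+ (i.+1 * L + H) = a ^+ (L + H) * (a ^+ L) ^+ i.
Proof. by rewrite -exprM -exprD; congr (a ^+ _); lia. Qed.

(** The pieces of an equal splitting are the cylinders of a coding of [K]. Two
    points whose codes first differ at index [k] lie in a common piece of level
    [k * L + H], of bounded spread, and in different pieces [L] levels below,
    which are separated. So [A ^+ ((k + 1) * L + H)] maps their difference into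
    a fixed shell. *)
Theorem self_affine_coding : exists2 L0, (0 < L0)%N & forall L, (0 < L)%N -> (L0 %| L)%N ->
  exists tau, coding w (ratio ^+ L) (#|` D| ^ L) K tau.
Proof.
have [W hW] := near_set.
have [L0 L0_gt0 split] := node_splitting fA_morph adj_refl adj_sym adj_shift adj_expand
  Z_expand_inj hW hD.
exists L0 => // L L_gt0 L0L.
have [H [c [Phi [Phi0 Phi_split Phi_gt0 Phi_close]]]] := split L L_gt0 L0L.
set Q := (#|` D| ^ L)%N in Phi_split *.
pose root := gens H [:: [fset 0 : ZV]%fset].
have [f fE] : exists f : seq {fset ZV} -> seq (seq {fset ZV}), forall p, Phi p ->
    [/\ size (f p) = Q, forall q, q \in f p -> Phi q & perm_eq (flatten (f p)) (gens L p)].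
  have [p|f hf] := choice (P := fun p parts => Phi p -> [/\ size parts = Q,
      forall q, q \in parts -> Phi q & perm_eq (flatten parts) (gens L p)]); last by exists f.
  have [/Phi_split[parts h]|np] := pselect (Phi p); last by exists [::].
  by exists parts.
pose lev (k : nat) := (k * L + H)%N.
have lS (k : nat) : lev k.+1 = (L + lev k)%N by rewrite /lev mulSn addnA.
(* the piece reached along the first [k] letters of [u] *)
pose pc := fix pc (u : nat -> nat) (k : nat) :=
  if k is k'.+1 then nth [::] (f (pc u k')) (u k') else root.
have pcE u (k : nat) : (forall i, (i < k)%N -> (u i < Q)%N) -> Phi (pc u k) /\ valid (lev k) (pc u k).
  elim: k => [_|k IH uQ].
    split => //; rewrite /lev mul0n add0n -[X in valid X](addn0 H); apply: valid_gens.
    by split => // P; rewrite inE => /eqP ->; rewrite /digit_sums /= comps1 mem_head.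
  have [|Pk Vk] := IH; first by move=> i ik; apply: uQ; exact: leqW.
  have [sz Pf perm] := fE _ Pk.
  have inf : pc u k.+1 \in f (pc u k) by apply: mem_nth; rewrite sz uQ.
  split; first exact: Pf.
  have [uL subL] := valid_gens L Vk; rewrite lS; split.
    by apply: uniq_flatten_part; rewrite (perm_uniq perm).
  move=> P Pp; apply: subL; rewrite -(perm_mem perm); apply/flattenP.
  by exists (pc u k.+1).
have cell_pcS u (k : nat) x : (forall i, (i < k)%N -> (u i < Q)%N) -> cell (lev k) (pc u k) x ->
    exists2 i, (i < Q)%N & cell (lev k.+1) (nth [::] (f (pc u k)) i) x.
  move=> uQ; have [Pk Vk] := pcE u k uQ; have [sz Pf perm] := fE _ Pk.
  rewrite -(cell_gens L) -lS => /(cell_mono (q := flatten (f (pc u k)))).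
  move=> /(_ (fun P h => etrans (perm_mem perm P) h)) /cell_flatten[q qf qx].
  by exists (index q (f (pc u k))); rewrite ?nth_index// -sz index_mem.
have apart u (k : nat) i j x y : (forall i, (i < k)%N -> (u i < Q)%N) -> i != j ->
    cell (lev k.+1) (nth [::] (f (pc u k)) i) x -> cell (lev k.+1) (nth [::] (f (pc u k)) j) y ->
    exists2 p, valid (lev k.+1) (p.1 ++ p.2) & cell (lev k.+1) p.1 x /\ cell (lev k.+1) p.2 y.
  move=> uQ ij cx cy; have [Pk Vk] := pcE u k uQ; have [sz Pf perm] := fE _ Pk.
  have [uL subL] := valid_gens L Vk.
  exists (nth [::] (f (pc u k)) i, nth [::] (f (pc u k)) j) => //=; split.
    by apply: uniq_flatten_cat => //; rewrite (perm_uniq perm).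
  rewrite lS => P; rewrite mem_cat => /orP[] Pn; apply: subL; rewrite -(perm_mem perm);
    apply/flattenP.
    exists (nth [::] (f (pc u k)) i) => //; apply: mem_nth; rewrite ltnNge; apply/negP => h.
    by rewrite nth_default in Pn.
  exists (nth [::] (f (pc u k)) j) => //; apply: mem_nth; rewrite ltnNge; apply/negP => h.
  by rewrite nth_default in Pn.
have [delta delta0 hdelta] := cells_apart.
have same_part u (k : nat) i j x : (forall i, (i < k)%N -> (u i < Q)%N) ->
    cell (lev k.+1) (nth [::] (f (pc u k)) i) x -> cell (lev k.+1) (nth [::] (f (pc u k)) j) x -> i = j.
  move=> uQ ci cj; apply/eqP; apply: contrapT => /negP ij.
  have [p vp [p1 p2]] := apart u k i j x x uQ ij ci cj.
  by have := hdelta _ _ _ _ _ vp p1 p2; rewrite subrr mulmx0 normr0 leNgt delta0.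
(* the pieces around [x], chosen together with the letters of its code; the
   identity [pxE] says that they are those of its code *)
pose px := fix px x (k : nat) := if k is k'.+1
  then nth [::] (f (px x k')) (find (fun q => `[< cell (lev k) q x >]) (f (px x k')))
  else root.
pose tau x (k : nat) := find (fun q => `[< cell (lev k.+1) q x >]) (f (px x k)).
have pxE x : px x =1 pc (tau x) by elim=> //= k <-.
have tauP x (k : nat) : K x -> [/\ (tau x k < Q)%N, cell (lev k) (pc (tau x) k) x &
    cell (lev k.+1) (nth [::] (f (pc (tau x) k)) (tau x k)) x].
  move=> Kx; suff H0 : (forall i, (i < k)%N -> (tau x i < Q)%N) /\ cell (lev k) (pc (tau x) k) x.
    have [tq ck] := H0; have [i iQ ci] := cell_pcS _ _ _ tq ck.
    have [Pk Vk] := pcE _ _ tq; have [sz Pf perm] := fE _ Pk.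
    have hs : has (fun q => `[< cell (lev k.+1) q x >]) (f (pc (tau x) k)).
      by apply/hasP; exists (nth [::] (f (pc (tau x) k)) i); [rewrite mem_nth// sz|exact/asboolP].
    split => //; first by rewrite /tau pxE -sz -has_find.
    by rewrite {2}/tau pxE; have /asboolP := nth_find [::] hs.
  elim: k => [|k [tq ck]].
    by split => //; rewrite /lev mul0n add0n /= cell_root.
  have [i iQ ci] := cell_pcS _ _ _ tq ck.
  have [Pk Vk] := pcE _ _ tq; have [sz Pf perm] := fE _ Pk.
  have hs : has (fun q => `[< cell (lev k.+1) q x >]) (f (pc (tau x) k)).
    by apply/hasP; exists (nth [::] (f (pc (tau x) k)) i); [rewrite mem_nth// sz|exact/asboolP].
  split.
    move=> j; rewrite ltnS leq_eqVlt => /orP[/eqP ->|]; last exact: tq.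
    by rewrite /tau pxE -sz -has_find.
  by rewrite /= {2}/tau pxE; have /asboolP := nth_find [::] hs.
have pc_ext u v (k : nat) : (forall i, (i < k)%N -> u i = v i) -> pc u k = pc v k.
  elim: k => //= k IH e; rewrite IH; first by rewrite e.
  by move=> i ik; apply: e; exact: leqW.
have [c' hc'] := close_nodes_bound c.
have near x y (k : nat) : K x -> K y -> (forall i, (i < k)%N -> tau x i = tau y i) ->
    `|AR ^+ lev k *m (x - y)| <= c'.
  move=> Kx Ky e; have tq i : (i < k)%N -> (tau x i < Q)%N by have [] := tauP x i Kx.
  have [Pk _] := pcE _ _ tq; apply: (hc' _ (pc (tau x) k)); first exact: Phi_close.
    by have [] := tauP x k Kx.
  by rewrite (pc_ext _ _ _ e); have [] := tauP y k Ky.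
exists tau; split.
- by move=> x k Kx; have [] := tauP x k Kx.
- move=> u uQ.
  have [||||x cx] := @nested_compact R _ K (fun k : nat => cell (lev k) (pc u k)) K_compact.
  + by move=> k; exact: cell_closed.
  + by move=> k x [].
  + move=> k; have [Pk Vk] := pcE u k (fun i _ => uQ i).
    by apply: cell_neq0 => //; exact: Phi_gt0.
  + move=> n k nk; rewrite -(subnK nk); elim: (k - n)%N => //= l IH.
    apply: subset_trans IH; have [Pk Vk] := pcE u (l + n)%N (fun i _ => uQ i).
    have [sz Pf perm] := fE _ Pk.
    rewrite -[X in _ `<=` X](cell_gens L) -lS; apply: cell_mono => P Pp.
    rewrite -(perm_mem perm); apply/flattenP; exists (pc u (l + n).+1) => //.
    by apply: mem_nth; rewrite sz.
  have Kx : K x by have [] := cx 0%N.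
  exists x => //; suff e (k : nat) : forall i, (i < k)%N -> tau x i = u i.
    by move=> k; exact: (e k.+1 k (ltnSn k)).
  elim: k => // k IH i; rewrite ltnS leq_eqVlt => /orP[/eqP ->|]; last exact: IH.
  have [_ _ ct] := tauP x k Kx; rewrite (pc_ext _ _ _ IH) in ct.
  exact: (same_part u k _ _ x (fun i _ => uQ i) ct (cx k.+1)).
- move=> x y Kx Ky e; apply/eqP; rewrite -subr_eq0 -normr_le0 leNgt; apply/negP => xy0.
  have c'0 : 0 < `|c'| + 1 by rewrite ltr_wpDl.
  have [n0 hn0] := expanding_inv hA (divr_gt0 xy0 c'0).
  have le_n0 : (n0 <= lev n0)%N by rewrite /lev; apply: leq_trans (leq_addr _ _); rewrite leq_pmulr.
  have := hn0 _ le_n0; rewrite ltr_pdivlMr//; apply/negP; rewrite -leNgt.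
  rewrite -[X in `|X|](AnKV (lev n0)); apply: le_trans (norm_mulmx _ _) _.
  rewrite ler_wpM2l ?opsum_ge0//; apply: le_trans (near x y n0 Kx Ky (fun i _ => e i)) _.
  by apply: le_trans (ler_norm _) _; rewrite lerDl.
- have [m [M [m0 M0 hmM]]] := pseudo_norm_shell hA heps0 hphi hw (opsum (AR ^+ L) * c') delta0.
  have r0 : 0 < ratio by exact: ratio_gt0.
  exists (m * ratio ^+ (L + H)), (M * ratio ^+ (L + H)); split; try by rewrite mulr_gt0 ?exprn_gt0.
  move=> x y k Kx Ky e ne.
  have [_ _ cx] := tauP x k Kx; have [_ _ cy] := tauP y k Ky.
  have tq i : (i < k)%N -> (tau x i < Q)%N by have [] := tauP x i Kx.
  rewrite -(pc_ext _ _ _ e) in cy.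
  have [p vp [p1 p2]] := apart _ _ _ _ _ _ tq ne cx cy.
  have low := hdelta _ _ _ _ _ vp p1 p2.
  have up : `|AR ^+ lev k.+1 *m (x - y)| <= opsum (AR ^+ L) * c'.
    rewrite lS AnD; apply: le_trans (norm_mulmx _ _) _.
    by rewrite ler_wpM2l ?opsum_ge0//; exact: near.
  have := hmM (AR ^+ lev k.+1 *m (x - y)); rewrite low up => /(_ isT) /andP[h1 h2].
  rewrite (pseudo_norm_scaleX (lev k.+1)).
  rewrite (expr_level ratio k L H).
  have q0 : 0 < ratio ^+ (L + H) * (ratio ^+ L) ^+ k by rewrite mulr_gt0 ?exprn_gt0.
  apply/andP; split.
    by rewrite -[leLHS]mulrA [leRHS]mulrC ler_pM2r.
  by rewrite -[leRHS]mulrA [leLHS]mulrC ler_pM2r.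
Qed.

End System.

Theorem theorem1p4 (R : realType) (d : nat)
    (A : 'M[int]_d.+1) (hA : expanding R A)
    (eps0 : R) (heps0 : 0 < eps0 < 1 / 2)
    (phi : 'cV[R]_d.+1 -> R) (hphi : mollifier eps0 phi)
    (* definiteness of w, which can fail if phi vanishes near 0 *)
    (hw : forall x, pseudo_norm A phi x = 0 -> x = 0)
    (D1 D2 : {fset 'cV[int]_d.+1})
    (hD1 : D1 != fset0) (hD2 : D2 != fset0)
    (K K' : set 'cV[R]_d.+1)
    (hK : self_affine_set A D1 K) (hK' : self_affine_set A D2 K')
    (hO1 : open_set_condition R A D1) (hO2 : open_set_condition R A D2)
    (hKd : totally_disconnected K) (hK'd : totally_disconnected K') :
  w_lipschitz_equiv (pseudo_norm A phi) K K' <-> #|` D1| = #|` D2|.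
Proof.
have [L1 L1_gt0 cod1] := self_affine_coding hA hD1 hK hO1 hKd heps0 hphi hw.
have [L2 L2_gt0 cod2] := self_affine_coding hA hD2 hK' hO2 hK'd heps0 hphi hw.
have L_gt0 : (0 < L1 * L2)%N by rewrite muln_gt0 L1_gt0.
have [tau1 c1] := cod1 _ L_gt0 (dvdn_mulr L2 (dvdnn L1)).
have [tau2 c2] := cod2 _ L_gt0 (dvdn_mull L1 (dvdnn L2)).
set L := (L1 * L2)%N in L_gt0 c1 c2.
have w0 := pseudo_norm_ge0 hA hphi.
have r0 := ratio_gt0 hA.
have rL : 0 < ratio R A ^+ L < 1.
  by rewrite exprn_gt0//= exprn_ilt1 ?gtn_eqF// ?ltW// ratio_lt1.
split => [equiv|e]; last first.
  by rewrite -e in c2; apply: (coding_equiv w0 (proj1 (andP rL)) c1 c2).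
have D_gt0 (D : {fset 'cV[int]_d.+1}) : D != fset0 -> (0 < #|` D| ^ L)%N.
  by move=> D0; rewrite expn_gt0 cardfs_gt0 D0.
have le12 := coding_le rL (D_gt0 _ hD1) c1 c2 equiv.
have le21 := coding_le rL (D_gt0 _ hD2) c2 c1 (lipschitz_equiv_sym equiv).
by apply/eqP; rewrite eqn_leq -(leq_exp2r _ #|` D2| L_gt0) le12 -(leq_exp2r _ #|` D1| L_gt0).
Qed.
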